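(* Let $B=(B_t;0\le t\le 1)$ be standard Brownian motion started at $0$. Then its Vervaat transform $(V(B)_t;\ 0 \leq t \leq 1)$ is a semimartingale with respect to its induced (natural) filtration.
   Context: Vervaat transform: for continuous $f:[0,1]\to\mathbb{R}$ with $f(0)=0$, let $\tau(f)$ be the first time at which $f$ attains its minimum on $[0,1]$. Define $V(f)(t)=f(\tau(f)+t)-f(\tau(f))$ for $0\le t\le 1-\tau(f)$ and $V(f)(t)=f(\tau(f)+t-1)+f(1)-f(\tau(f))$ for $1-\tau(f)\le t\le 1$. *)

(* Defs.v *)
From HB Require Import structures.
From mathcomp Require Import all_boot all_order all_algebra.
From mathcomp Require Import all_classical all_reals all_analysis.
Set Implicit Arguments.
Unset Strict Implicit.
Unset Printing Implicit Defensive.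
Import Order.TTheory GRing.Theory Num.Theory.
Import numFieldNormedType.Exports.
Local Open Scope classical_set_scope.
Local Open Scope ring_scope.

(* Processes are indexed by R, but only the times in [0, 1] matter: every
   definition below inspects a process at times of [0, 1] only. *)

Section vervaat_transform.
Context {R : realType}.
Implicit Types (f : R -> R) (t : R).

(* The infimum is attained when f is continuous on [0, 1]. *)
Definition argmin_time f : R :=
  inf [set t : R | t \in `[0, 1] /\ forall s : R, s \in `[0, 1] -> f t <= f s].

(* When f 0 = 0 both branches agree at t = 1 - argmin_time f. *)
Definition vervaat f t : R :=
  let tau := argmin_time f in
  if t <= 1 - tau then f (tau + t) - f tau
  else f (tau + t - 1) + f 1 - f tau.

End vervaat_transform.

Section brownian_motion.
Context {d : measure_display} {T : measurableType d} {R : realType}.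
Variable P : probability T R.

Definition mutually_independent (n : nat) (X : nat -> T -> R) : Prop :=
  forall A : nat -> set R, (forall i, (i < n)%N -> measurable (A i)) ->
    P (\bigcap_(i < n) (X i @^-1` A i)) =
    (\prod_(i < n) P (X i @^-1` A i))%E.

Record standard_brownian_motion (B : R -> {RV P >-> R}) : Prop := {
  bm_start : forall w, B 0 w = 0 ;
  bm_continuous : forall w, {within `[0, 1], continuous (fun t : R => B t w)} ;
  bm_independent_increments : forall (n : nat) (t : nat -> R),
    (forall i, (i <= n)%N -> t i \in `[0, 1]) ->
    (forall i, (i < n)%N -> t i <= t i.+1) ->
    mutually_independent n (fun i w => B (t i.+1) w - B (t i) w) ;
  (* the second parameter of normal_prob is the standard deviation *)
  bm_gaussian_increments : forall s t : R, 0 <= s -> s < t -> t <= 1 ->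
    forall A : set R, measurable A ->
      P ((fun w => B t w - B s w) @^-1` A) = normal_prob 0 (Num.sqrt (t - s)) A
}.

End brownian_motion.

Section semimartingales.
Context {d : measure_display} {T : measurableType d} {R : realType}.
Variable P : probability T R.
Implicit Types (F : R -> set_system T) (X M A : R -> T -> R) (S : T -> R).

Definition filtration F : Prop :=
  [/\ forall t, t \in `[0, 1] -> sigma_algebra setT (F t),
      forall t, t \in `[0, 1] -> F t `<=` measurable &
      forall s t, 0 <= s -> s <= t -> t <= 1 -> F s `<=` F t].

Definition natural_filtration X : R -> set_system T := fun t =>
  <<s \bigcup_(s in `[0, t]) preimage_set_system setT (X s) measurable >>.

Definition measurable_wrt (G : set_system T) (Y : T -> R) : Prop :=
  forall A : set R, measurable A -> G (Y @^-1` A).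

Definition adapted F X : Prop :=
  forall t, t \in `[0, 1] -> measurable_wrt (F t) (X t).

Definition cadlag (f : R -> R) : Prop :=
  (forall t : R, 0 <= t < 1 -> f x @[x --> t^'+] --> f t) /\
  (forall t : R, 0 < t <= 1 -> cvg (f x @[x --> t^'-])).

Definition as_cadlag X : Prop := {ae P, forall w, cadlag (X ^~ w)}.

(* Y is a version of the conditional expectation of Z given G. *)
Definition is_condexp (G : set_system T) (Z Y : T -> R) : Prop :=
  [/\ measurable_wrt G Y, P.-integrable setT (EFin \o Y) &
      forall C, G C ->
        (\int[P]_(w in C) (Y w)%:E = \int[P]_(w in C) (Z w)%:E)%E].

Definition martingale F M : Prop :=
  [/\ adapted F M,
      forall t, t \in `[0, 1] -> P.-integrable setT (EFin \o M t) &
      forall s t, 0 <= s -> s <= t -> t <= 1 -> is_condexp (F s) (M t) (M s)].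

Definition stopping_time F S : Prop :=
  (forall w, S w \in `[0, 1]) /\
  (forall t, t \in `[0, 1] -> F t [set w | S w <= t]).

Definition stopped S X : R -> T -> R := fun t w => X (Num.min t (S w)) w.

(* On the compact time set [0, 1], localizing means that almost surely the
   stopping times are eventually equal to the terminal time 1. *)
Definition local_martingale F M : Prop :=
  [/\ adapted F M, as_cadlag M &
      exists S : nat -> T -> R,
        [/\ forall n, stopping_time F (S n),
            forall n w, S n w <= S n.+1 w,
            {ae P, forall w, exists n, S n w = 1} &
            forall n, martingale F (fun t w => stopped (S n) M t w - M 0 w)]].

Definition finite_variation_process F A : Prop :=
  [/\ adapted F A, as_cadlag A &
      {ae P, forall w, bounded_variation 0 1 (A ^~ w)}].

(* The filtration is not assumed to be complete or right-continuous; this is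
   why path regularity is required almost surely. *)
Definition semimartingale F X : Prop :=
  filtration F /\
  exists M A : R -> T -> R,
    [/\ local_martingale F M, finite_variation_process F A,
        forall w, M 0 w = 0, forall w, A 0 w = 0 &
        forall t, t \in `[0, 1] -> forall w, X t w = X 0 w + M t w + A t w].

End semimartingales.

(* Main.v *)
Require Import Defs.
From HB Require Import structures.
From mathcomp Require Import all_boot all_order all_algebra.
From mathcomp Require Import all_classical all_reals all_analysis.
From mathcomp Require Import measurable_realfun ring lra zify.
Set Implicit Arguments.
Unset Strict Implicit.
Unset Printing Implicit Defensive.
Import Order.TTheory GRing.Theory Num.Theory.
Import numFieldNormedType.Exports.
Local Open Scope classical_set_scope.
Local Open Scope ring_scope.

(* The Vervaat transform V is B read cyclically from its first argmin.  Cut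
   [0, 1] into n cells.  Given that a time j is the first argmin of B over its
   own cell, an event of the increments inside that cell, the path of B read
   cyclically from j has, at the times of [1/n, 1 - 1/n], Gaussian increments
   independent of that event, so its stochastic exponentials have mean 1.
   Dropping the requirement that j be the global argmin and summing over the
   cells gives E exp(int h dV - int h^2 dt / 2) <= n for every bounded
   nonanticipating h supported in [1/n, 1 - 1/n], hence
   E int h dV <= ln n + E int h^2 dt / 2.  Applying this on dyadic shells that
   approach 0 and 1 yields E int h dV <= 36 + E int h^2 dK for the clock
   K(t) = sqrt t + 1 - sqrt (1 - t).  Thus h |-> E int h dV is bounded for the
   energy norm E int h^2 dK; a sequence of simple integrands represents it, and
   their integrals against K converge to the drift A of V.  By construction
   V - A is a martingale, and A is continuous of bounded variation. *)

(** * Independence of increments *)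

(** The first argmin is known only from the whole path, so conditioning on it would bias every
    increment. An argmin over one cell depends on that cell alone, and the path read cyclically from
    it has left the cell at time 1/n and is not back before 1 - 1/n; hence the window of times.
    Forgetting the global requirement only enlarges an event under a nonnegative integrand, and each
    of the n cells contributes at most 1. The price ln n diverges as the window grows to ]0, 1[. On
    the shell at distance between 4^-(p+1) and 4^-p from the ends it is ln 4^(p+1), linear in p.
    Testing with 2^p h and dividing by 2^p makes it summable, but the quadratic term becomes 2^p/2
    int h^2 dt. The clock runs at least at that speed there, yet has total mass 2, so that a drift
    whose density against the clock has finite energy is of finite variation. The filtration is
    neither complete nor right-continuous. The drift must therefore be adapted without discarding
    null sets, which is why it is a limsup of adapted approximations, with path properties only
    almost surely. *)

Section independence.
Context {d : measure_display} {T : measurableType d} {R : realType}.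
Variable P : probability T R.

(** With [E] fixed, both sides are finite measures of [A], and two finite measures that agree on a
    pi-system containing the whole space agree on the sigma-algebra it generates. *)
Lemma independent_pi_system (G : set_system T) (E : set T) :
  measurable E -> G `<=` measurable -> setI_closed G -> G setT ->
  (forall A, G A -> P (A `&` E) = (P A * P E)%E) ->
  forall A, <<s G >> A -> P (A `&` E) = (P A * P E)%E.
Proof.
move=> mE Gm GI GT GE A sA.
have r : 0 <= fine (P E) by exact: fine_ge0.
have PE : P E = (fine (P E))%:E by rewrite fineK// fin_num_measure.
have := @g_sigma_algebra_measure_unique d R T G Gm (fun=> setT) (fun=> GT) _
  (mrestr P mE) (mscale (NngNum r) P) GI.
rewrite /mrestr /mscale /= => h; rewrite PE muleC; apply: h sA => //.
- by rewrite bigcup_const.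
- by move=> C GC /=; rewrite /mrestr /mscale /= GE// muleC -PE.
- by move=> _; rewrite /mrestr setTI ltey_eq fin_num_measure.
Qed.

(** Cylinders whose factor at [c] is [setT] form a pi-system, and it generates the sigma-algebra of
    the other coordinates. Filling the free slot with [D] turns the joint event into another
    cylinder, to which the product formula applies. *)
Lemma independent_coordinate (n c : nat) (X : nat -> T -> R) :
  (forall i, measurable_fun setT (X i)) ->
  mutually_independent P n X -> (c < n)%N ->
  let G := \bigcup_(i in [set i | (i < n)%N /\ i <> c])
             preimage_set_system setT (X i) measurable in
  forall A D, <<s G >> A -> measurable D ->
    P (A `&` X c @^-1` D) = (P A * P (X c @^-1` D))%E.
Proof.
move=> mX indX cn G A D sA mD.
pose H := [set C : set T | exists F : nat -> set R,
  [/\ forall i, measurable (F i), F c = setT &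
      C = \bigcap_(i < n) X i @^-1` F i]].
have mXF i (F : set R) : measurable F -> measurable (X i @^-1` F).
  by move=> mF; rewrite -[_ @^-1` _]setTI; exact: mX.
apply: (@independent_pi_system H) => //.
- exact: mXF.
- move=> _ [F [mF _ ->]]; apply: bigcap_measurableType => // i _.
  exact: mXF.
- move=> _ _ [F1 [mF1 F1c ->]] [F2 [mF2 F2c ->]].
  exists (fun i => F1 i `&` F2 i); split.
  + by move=> i; exact: measurableI.
  + by rewrite F1c F2c setIT.
  + by rewrite -bigcapI.
- exists (fun=> setT); split => //.
  by apply/seteqP; split => // w _ i _.
- move=> _ [F [mF Fc ->]].
  pose F' i := if i == c then D else F i.
  have mF' i : measurable (F' i) by rewrite /F'; case: ifP.
  have -> : \bigcap_(i < n) X i @^-1` F i `&` X c @^-1` D =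
            \bigcap_(i < n) X i @^-1` F' i.
    apply/seteqP; split => [w [h1 h2] i /= ni|w h].
      by rewrite /F'; case: eqP => [->//|_]; exact: h1.
    split; last by have := h c cn; rewrite /F' eqxx.
    move=> i /= ni; have := h i ni; rewrite /F'; case: eqP => [->|//].
    by rewrite Fc.
  rewrite indX// indX// (bigD1 (Ordinal cn))//= [in RHS](bigD1 (Ordinal cn))//=.
  rewrite Fc preimage_setT probability_setT mul1e muleC /F' eqxx; congr (_ * _)%E.
  by apply: eq_bigr => i; rewrite -val_eqE /= => /negbTE ->.
- apply: smallest_sub A sA; first exact: smallest_sigma_algebra.
  move=> _ [i [/= ni ic] [F mF <-]]; apply: sub_sigma_algebra.
  exists (fun j => if j == i then F else setT); split.
  + by move=> j; case: ifP.
  + by case: eqP => // ci; case: ic.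
  + apply/seteqP; split => [w [_ Xw] j _ /=|w]; first by case: eqP => [->|].
    by move=> /(_ _ ni); rewrite eqxx; split.
Qed.

End independence.

Section outer_sigma.
Context {d : measure_display} {T : measurableType d} {R : realType}.
Variables (P : probability T R) (B : R -> {RV P >-> R}).
Hypothesis hB : standard_brownian_motion B.

Definition increment (X : R -> T -> R) (a b : R) (w : T) : R := X b w - X a w.

Definition outer_times (a b : R) : set R :=
  [set u | 0 <= u <= a \/ b <= u <= 1].

(** Each time is compared with the endpoint of ]a, b] on its own side, so that no increment crosses
    ]a, b]. A path that starts after [b] and wraps around at time 1 is still a combination of these
    increments. *)
Definition outer_increment (a b u : R) : T -> R :=
  if u <= a then increment B a u else increment B b u.

Definition outer_gen (a b : R) : set_system T :=
  \bigcup_(u in outer_times a b)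
    preimage_set_system setT (outer_increment a b u) measurable.

Lemma measurable_outer_increment a b u :
  measurable_fun setT (outer_increment a b u).
Proof. by rewrite /outer_increment; case: ifP => _; exact: measurable_funB. Qed.

Let finite_gen a b (s : seq R) : set_system T :=
  \bigcup_(u in [set` s]) preimage_set_system setT (outer_increment a b u) measurable.

(** Sorting the times around [a] and [b] gives a partition of which ]a, b] is one step. The outer
    increments are then sums of consecutive steps, leftwards from [a] or rightwards from [b], and
    the step over ]a, b] is independent of all the others. *)
Lemma outer_gen_finite (a b : R) (s : seq R) (A : set T) (D : set R) :
  0 <= a -> a < b -> b <= 1 -> (forall u, u \in s -> outer_times a b u) ->
  <<s finite_gen a b s >> A -> measurable D ->
  P (A `&` increment B a b @^-1` D) =
  (P A * P (increment B a b @^-1` D))%E.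
Proof.
move=> a0 ab b1 so sA mD.
pose sL := sort <=%R [seq u <- s | u <= a].
pose sR := sort <=%R [seq u <- s | b <= u].
pose l := sL ++ [:: a, b & sR].
pose t i := nth 0 l i.
(* The position of [a] in [l]; the next entry is [b], so the increment number [c] is the one over
   ]a, b]. *)
pose c := size sL.
pose n := (size l).-1.
have sizel : size l = n.+1 by rewrite /n /l size_cat /= addnS.
have cn : (c < n)%N by rewrite -ltnS -sizel /l size_cat /= -/c !addnS !ltnS leq_addr.
have tc : t c = a by rewrite /t /l nth_cat ltnn subnn.
have tc1 : t c.+1 = b by rewrite /t /l nth_cat ltnNge leqnSn /= subSn// subnn.
have memL u : u \in sL -> (u \in s) && (u <= a).
  by rewrite mem_sort mem_filter andbC.
have memR u : u \in sR -> (u \in s) && (b <= u).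
  by rewrite mem_sort mem_filter andbC.
have l01 u : u \in l -> u \in `[0, 1].
  rewrite in_itv/= mem_cat !inE.
  move=> /or3P[/memL /andP[us ua]|/eqP ->|/orP[/eqP ->|/memR /andP[us ub]]].
  - by case: (so _ us) => /andP[? ?]; lra.
  - lra.
  - lra.
  - by case: (so _ us) => /andP[? ?]; lra.
have sl : pairwise <=%R l.
  rewrite /l pairwise_cat; apply/and3P; split.
  - apply/allrelP => x y /memL/andP[_ xa]; rewrite !inE => /or3P[/eqP->|/eqP->|/memR/andP[_ ?]]; lra.
  - by rewrite -sorted_pairwise; [exact: sort_le_sorted|exact: le_trans].
  - rewrite /= (ltW ab) /=; apply/and3P; split.
    + by apply/allP => x /memR /andP[_ ?]; lra.
    + by apply/allP => x /memR /andP[_ ?]; lra.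
    + by rewrite -sorted_pairwise; [exact: sort_le_sorted|exact: le_trans].
pose X i w := B (t i.+1) w - B (t i) w.
have mX i : measurable_fun setT (X i) by exact: measurable_funB.
have indX : mutually_independent P n X.
  apply: (bm_independent_increments hB) => [i ni|i ni].
    by apply: l01; rewrite mem_nth// sizel.
  have sl' : sorted <=%R l by rewrite sorted_pairwise//; exact: le_trans.
  apply: (sorted_leq_nth le_trans (fun=> lexx _) 0 sl') => //;
    by rewrite inE sizel// ltnS ltnW.
have := independent_coordinate mX indX cn.
have -> : X c = increment B a b by rewrite /X tc tc1.
move=> /(_ A D); apply => //.
set G := \bigcup_(i in _) _ in sA *.
apply: smallest_sub A sA; first exact: smallest_sigma_algebra.
have mXG i : (i < n)%N -> i <> c -> measurable_fun setT (X i : g_sigma_algebraType G -> R).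
  move=> ni ic _ F mF; apply: sub_sigma_algebra; exists i => //.
  by exists F.
have left k : (k <= c)%N ->
    measurable_fun setT ((fun w => B (t (c - k)%N) w - B (t c) w) : g_sigma_algebraType G -> R).
  elim: k => [_|k ih kc]; first by
    under eq_fun do rewrite subn0 subrr; exact: measurable_cst.
  have -> : (fun w => B (t (c - k.+1)%N) w - B (t c) w) =
            ((fun w => (B (t (c - k)%N) w - B (t c) w)) \- X (c - k.+1)%N)%R.
    by apply/funext => w /=; rewrite /X -subSn// subSS; ring.
  apply: measurable_funB; first exact: ih (ltnW kc).
  apply: mXG; first by rewrite (leq_ltn_trans (leq_subr _ _)).
  by move=> /eqP; rewrite -{2}(subn0 c) eqn_sub2lE.
have right k : (c.+1 + k <= n)%N ->
    measurable_fun setT ((fun w => B (t (c.+1 + k)%N) w - B (t c.+1) w) : g_sigma_algebraType G -> R).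
  elim: k => [_|k ih kc]; first by
    under eq_fun do rewrite addn0 subrr; exact: measurable_cst.
  have -> : (fun w => B (t (c.+1 + k.+1)%N) w - B (t c.+1) w) =
            (fun w => (B (t (c.+1 + k)%N) w - B (t c.+1) w) + X (c.+1 + k)%N w).
    by apply/funext => w; rewrite /X addnS; ring.
  apply: measurable_funD; first by apply: ih; rewrite (leq_trans _ kc)// leq_add2l.
  apply: mXG; first by rewrite -addnS.
  by move=> /eqP; rewrite eqn_leq addSn ltnNge leq_addr.
move=> _ [u /= us [F mF <-]].
suff mZ : measurable_fun setT (outer_increment a b u : g_sigma_algebraType G -> R).
  exact: mZ.
have [ua|au] := leP u a.
  have usL : u \in sL by rewrite mem_sort mem_filter ua.
  have tu : t (c - (c - index u sL))%N = u.
    rewrite subKn; last by rewrite index_size.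
    by rewrite /t /l nth_cat index_mem usL nth_index.
  by have := left (c - index u sL)%N (leq_subr _ _); rewrite tu tc /outer_increment ua.
have bu : b <= u by case: (so _ us) => /andP[? ?]; lra.
have [->|nub] := eqVneq u b.
  rewrite /outer_increment leNgt ab /=.
  by rewrite /increment; under eq_fun do rewrite subrr; exact: measurable_cst.
have usR : u \in sR by rewrite mem_sort mem_filter bu.
have iR : (index u sR < size sR)%N by rewrite index_mem.
have tu : t (c.+1 + (index u sR).+1)%N = u.
  rewrite /t /l nth_cat addSnnS ltnNge leq_addr /= addKn /=.
  by rewrite nth_index.
have := right (index u sR).+1; rewrite tu tc1 /outer_increment leNgt au /=.
apply; rewrite -ltnS -sizel /l size_cat /= -/c !addSn !addnS !ltnS.
by rewrite ltn_add2l.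
Qed.

Lemma increment_independent (a b : R) (A : set T) (D : set R) :
  0 <= a -> a < b -> b <= 1 -> <<s outer_gen a b >> A -> measurable D ->
  P (A `&` increment B a b @^-1` D) =
  (P A * P (increment B a b @^-1` D))%E.
Proof.
move=> a0 ab b1 sA mD.
(* Events that depend on finitely many outer times; concatenating the two lists of times shows
   closure under intersection. *)
pose H := [set C | exists s : seq R,
  (forall u, u \in s -> outer_times a b u) /\ <<s finite_gen a b s >> C].
have Hm : H `<=` measurable.
  move=> C [s [_ sC]]; apply: smallest_sub C sC; first exact: sigma_algebra_measurable.
  move=> _ [u _ [F mF <-]]; exact: measurable_outer_increment.
apply: (@independent_pi_system _ _ _ P H) => //.
- rewrite -[_ @^-1` _]setTI; apply: measurable_funB => //.
- move=> C1 C2 [l1 [h1 sC1]] [l2 [h2 sC2]]; exists (l1 ++ l2); split.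
    by move=> u; rewrite mem_cat => /orP[/h1|/h2].
  apply: (@measurableI _ (g_sigma_algebraType (finite_gen a b (l1 ++ l2)))).
    apply: sub_smallest2r C1 sC1; first exact: smallest_sigma_algebra.
    by move=> X [u us Xu]; exists u => //=; rewrite mem_cat; apply/orP; left.
  apply: sub_smallest2r C2 sC2; first exact: smallest_sigma_algebra.
  by move=> X [u us Xu]; exists u => //=; rewrite mem_cat; apply/orP; right.
- exists [::]; split => //.
  exact: (@measurableT _ (g_sigma_algebraType (finite_gen a b [::]))).
- by move=> C [l [ho sC]]; exact: outer_gen_finite ho sC mD.
- apply: smallest_sub A sA; first exact: smallest_sigma_algebra.
  move=> X [u uo Xu]; apply: sub_sigma_algebra; exists [:: u]; split.
    by move=> v; rewrite inE => /eqP ->.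
  by apply: sub_sigma_algebra; exists u => //=; rewrite inE.
Qed.

End outer_sigma.

(** * Exponential tilting of Gaussian increments *)

Section gaussian_tilting.
Context {R : realType}.
Implicit Types (m s h x : R).

(** The change of variables is available for the Radon-Nikodym derivative, which equals the explicit
    density almost everywhere because both have the same integral over every measurable set. *)
Lemma ge0_integral_normal_prob m s (f : R -> \bar R) :
  measurable_fun setT f -> (forall x, 0 <= f x)%E ->
  (\int[normal_prob m s]_x f x =
   \int[lebesgue_measure]_x (f x * (normal_pdf m s x)%:E))%E.
Proof.
move=> mf f0.
have dom := @normal_prob_dominates R m s.
have mpdf : measurable_fun setT (EFin \o normal_pdf m s).
  by apply/measurable_EFinP; exact: measurable_normal_pdf.
rewrite -(Radon_Nikodym_SigmaFinite.change_of_variables dom f0)//.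
have iRN := Radon_Nikodym_SigmaFinite.f_integrable dom.
apply: ae_eq_integral => //.
- by apply: emeasurable_funM => //; exact: measurable_int iRN.
- by apply: emeasurable_funM.
- apply: ae_eqe_mul2l.
  apply: integral_ae_eq => //.
  by move=> A _ mA; rewrite -Radon_Nikodym_SigmaFinite.f_integral.
Qed.

(** Completing the square: the exponential weight moves the mean from 0 to [h * s ^+ 2], so its
    integral is again that of a probability density. *)
Lemma normal_pdf_tilt s h x : s != 0 ->
  expR (h * x - h ^+ 2 * s ^+ 2 / 2) * normal_pdf 0 s x = normal_pdf (h * s ^+ 2) s x.
Proof.
move=> s0; rewrite !normal_pdfE// /normal_fun mulrCA -expRD; congr (_ * expR _).
by rewrite -(mulr_natr (s ^+ 2)); field.
Qed.

Lemma integral_normal_tilt s h : s != 0 ->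
  (\int[normal_prob 0 s]_x (expR (h * x - h ^+ 2 * s ^+ 2 / 2))%:E = 1)%E.
Proof.
move=> s0; rewrite ge0_integral_normal_prob//; first last.
  apply/measurable_EFinP; apply: measurableT_comp => //.
  by apply: measurable_funB => //; exact: measurable_funM.
rewrite -(integral_normal_pdf (h * s ^+ 2) s); apply: eq_integral => x _.
by rewrite -EFinM normal_pdf_tilt.
Qed.

End gaussian_tilting.

Section gaussian_step.
Context {d : measure_display} {T : measurableType d} {R : realType}.
Variables (P : probability T R) (G : set_system T) (xi : T -> R) (s : R).
Hypotheses (Gm : G `<=` measurable) (mxi : measurable_fun setT xi) (s0 : s != 0).
Hypothesis ind : forall A D, <<s G >> A -> measurable D ->
  P (A `&` xi @^-1` D) = (P A * P (xi @^-1` D))%E.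
Hypothesis law : forall D, measurable D -> P (xi @^-1` D) = normal_prob 0 s D.

Let GT := g_sigma_algebraType G.

Lemma measurable_fun_sub_sigma (d' : measure_display) (U : measurableType d') (f : T -> U) :
  measurable_fun setT (f : GT -> U) -> measurable_fun setT f.
Proof.
move=> mf _ A mA; have := mf measurableT A mA.
by apply: smallest_sub; [exact: sigma_algebra_measurable|].
Qed.

(** By independence the pair of the sample point, seen through [G], and [xi] has a product law.
    Tonelli's theorem then integrates over [xi] with [Z] and [h] frozen, and the inner integral is
    the tilted Gaussian mass 1. This is one step of the martingale property of a stochastic
    exponential. *)
Lemma gaussian_step (Z h : T -> R) :
  measurable_fun setT (Z : GT -> R) -> measurable_fun setT (h : GT -> R) ->
  (forall w, 0 <= Z w) ->
  (\int[P]_w (Z w * expR (h w * xi w - h w ^+ 2 * s ^+ 2 / 2))%:E =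
   \int[P]_w (Z w)%:E)%E.
Proof.
move=> mZ mh Z0.
have mid : measurable_fun setT (id : T -> GT).
  move=> _ A mA; rewrite setTI.
  by apply: smallest_sub mA; [exact: sigma_algebra_measurable|].
have mpair : measurable_fun setT (fun w : T => ((w : GT), (xi w : measurableTypeR R))).
  exact: measurable_fun_pair.
pose idG : {mfun T >-> GT} := HB.pack (id : T -> GT) (isMeasurableFun.Build _ _ _ _ _ mid).
pose pG : {mfun T >-> (GT * measurableTypeR R)%type} :=
  HB.pack (fun w : T => ((w : GT), xi w)) (isMeasurableFun.Build _ _ _ _ _ mpair).
pose mG := distribution P idG.
pose F (z : GT * measurableTypeR R) := (Z z.1 * expR (h z.1 * z.2 - h z.1 ^+ 2 * s ^+ 2 / 2))%:E.
have mF : measurable_fun setT F.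
  have mZ1 : measurable_fun setT (fun z : GT * measurableTypeR R => Z z.1) by exact: measurableT_comp.
  have mh1 : measurable_fun setT (fun z : GT * measurableTypeR R => h z.1) by exact: measurableT_comp.
  apply/measurable_EFinP; apply: measurable_funM => //.
  apply: measurableT_comp => //; apply: measurable_funB => //.
    exact: measurable_funM.
  by do 2 apply: measurable_funM => //; exact: measurable_funX.
have F0 z : (0 <= F z)%E by rewrite lee_fin mulr_ge0// expR_ge0.
have pE : forall X, measurable X -> (mG \x normal_prob 0 s)%E X = distribution P pG X.
  apply: product_measure_unique => A D mA mD.
  rewrite /mG /distribution /pushforward /= -law// -ind//.
transitivity (\int[mG \x normal_prob 0 s]_z F z)%E.
  rewrite (@eq_measure_integral _ _ _ _ (distribution P pG)); last by move=> A mA _; exact: pE.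
  by rewrite ge0_integral_distribution.
rewrite fubini_tonelli1//= /fubini_F /=.
transitivity (\int[mG]_w (Z w)%:E)%E; last first.
  rewrite ge0_integral_distribution//.
  exact/measurable_EFinP.
apply: eq_integral => w _; rewrite /F /=.
under eq_integral do rewrite EFinM.
rewrite ge0_integralZl//.
- by rewrite integral_normal_tilt// mule1.
- apply/measurable_EFinP; apply: measurableT_comp => //.
  by apply: measurable_funB => //; exact: measurable_funM.
- by rewrite lee_fin; exact: Z0.
Qed.

End gaussian_step.

(** * Cyclic shifts and argmin cells *)

Section cyclic_shift.
Context {R : realType}.
Implicit Types (f : R -> R) (s t u : R).

(** Composition with this retraction onto [0, 1] turns continuity within [[0, 1]] into continuity on
    the whole line. *)
Definition clamp u : R := if u <= 0 then 0 else if 1 <= u then 1 else u.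

Lemma clamp_itv u : 0 <= clamp u <= 1.
Proof. by rewrite /clamp; case: (leP u 0) => ?; [|case: (leP 1 u) => ?]; lra. Qed.

Lemma clamp_id u : 0 <= u -> u <= 1 -> clamp u = u.
Proof. by move=> ? ?; rewrite /clamp; case: (leP u 0) => ?; [|case: (leP 1 u) => ?]; lra. Qed.

Lemma clamp0 u : u <= 0 -> clamp u = 0.
Proof. by rewrite /clamp => ->. Qed.

Lemma clamp1 u : 1 <= u -> clamp u = 1.
Proof. by move=> u1; rewrite /clamp u1 leNgt (lt_le_trans ltr01). Qed.

Lemma clamp_lipschitz u v : `|clamp u - clamp v| <= `|u - v|.
Proof.
have := ler_norm (u - v); have := ler_norm (v - u); rewrite (distrC v u) => h1 h2.
rewrite ler_norml /clamp; case: (leP u 0) => ?; case: (leP v 0) => ?;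
  try case: (leP 1 u) => ?; try case: (leP 1 v) => ?; lra.
Qed.

Lemma continuous_clamp f : {within `[0, 1], continuous f} -> continuous (f \o clamp).
Proof.
move=> cf u.
have Au : `[0, 1]%classic (clamp u) by rewrite /= in_itv/= clamp_itv.
apply/cvgrPdist_le => e e0.
have : f @ within `[0, 1] (nbhs (clamp u)) --> f (clamp u).
  by rewrite nbhs_subspace_in//; exact: cf.
move=> /cvgrPdist_le /(_ e e0) /nbhs_ballP[r /= r0 hr].
apply/nbhs_ballP; exists r => //= v uv; apply: hr.
  by rewrite /ball /= (le_lt_trans (clamp_lipschitz _ _)).
by rewrite /= in_itv/= clamp_itv.
Qed.

(* For a path with f 0 = 0 this repeats the increments of f periodically on
   [0, 2], so that the Vervaat transform becomes an ordinary time shift. *)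
Definition ext f u := f (clamp u) + f (clamp (u - 1)).

Lemma ext_le1 f u : f 0 = 0 -> 0 <= u -> u <= 1 -> ext f u = f u.
Proof. by move=> f0 ? ?; rewrite /ext clamp_id// clamp0 ?f0 ?addr0//; lra. Qed.

Lemma ext_ge1 f u : 1 <= u -> u <= 2 -> ext f u = f 1 + f (u - 1).
Proof. by move=> ? ?; rewrite /ext clamp1// clamp_id//; lra. Qed.

Lemma continuous_ext f : {within `[0, 1], continuous f} -> continuous (ext f).
Proof.
move=> /continuous_clamp cf u; apply: cvgD; first exact: cf.
have h : (v - 1 : R) @[v --> u] --> u - 1.
  by apply: cvgB; [exact: cvg_id|exact: cvg_cst].
exact: (cvg_comp _ _ h (cf (u - 1))).
Qed.

Definition cyc_shift f s t := ext f (s + t) - ext f s.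

Lemma continuous_cyc_shift f s : {within `[0, 1], continuous f} -> continuous (cyc_shift f s).
Proof.
move=> /continuous_ext cf t; apply: cvgB; last exact: cvg_cst.
have h : (s + v : R) @[v --> t] --> s + t.
  by apply: cvgD; [exact: cvg_cst|exact: cvg_id].
exact: (cvg_comp _ _ h (cf (s + t))).
Qed.

Lemma shift_cvg f (s : nat -> R) s0 t : {within `[0, 1], continuous f} ->
  s n @[n --> \oo] --> s0 -> cyc_shift f (s n) t @[n --> \oo] --> cyc_shift f s0 t.
Proof.
move=> /continuous_ext cf ss0; apply: cvgB.
  have h : s n + t @[n --> \oo] --> s0 + t by apply: cvgD; [exact: ss0|exact: cvg_cst].
  exact: (cvg_comp _ _ h (cf _)).
exact: (cvg_comp _ _ ss0 (cf _)).
Qed.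

Lemma vervaat_shift f t : f 0 = 0 -> 0 <= argmin_time f <= 1 -> 0 <= t <= 1 ->
  vervaat f t = cyc_shift f (argmin_time f) t.
Proof.
move=> f0 /andP[? ?] /andP[? ?]; rewrite /vervaat /cyc_shift; case: ifP => ?.
  by rewrite !ext_le1//; lra.
rewrite ext_ge1; [|lra|lra]; rewrite ext_le1//; lra.
Qed.

Definition dense_time (k : nat) : R :=
  clamp (if unpickle k is Some q then ratr q else 0).

Lemma dense_time_approx u e : 0 <= u <= 1 -> 0 < e -> exists k, `|dense_time k - u| < e.
Proof.
move=> /andP[u0 u1] e0; have [q] : exists q : rat, ratr q \in `]u, (u + e)[%R.
  by apply: rat_in_itvoo; lra.
rewrite in_itv/= => /andP[uq qe]; exists (pickle q).
rewrite /dense_time pickleK /= -{1}(clamp_id u0 u1) (le_lt_trans (clamp_lipschitz _ _))//.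
rewrite ger0_norm; lra.
Qed.

(** Only countably many times enter, so the value is measurable in the path; for a continuous path
    it is the minimum over the closed step. *)
Definition step_min (N i : nat) f : R :=
  inf (range (fun k : nat => f ((i%:R + dense_time k) / N%:R))).

Lemma step_in_itv (N i : nat) u : (i < N)%N -> i%:R / N%:R <= u <= i.+1%:R / N%:R ->
  0 <= u <= 1.
Proof.
move=> iN /andP[h1 h2].
have N0 : 0 < N%:R :> R by rewrite ltr0n (leq_trans _ iN).
apply/andP; split; first by rewrite (le_trans _ h1)// divr_ge0.
by rewrite (le_trans h2)// ler_pdivrMr// mul1r ler_nat.
Qed.

Lemma step_minP f (N i : nat) : {within `[0, 1], continuous f} -> (i < N)%N ->
  (forall u, i%:R / N%:R <= u <= i.+1%:R / N%:R -> step_min N i f <= f u) /\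
  exists2 u, i%:R / N%:R <= u <= i.+1%:R / N%:R & f u = step_min N i f.
Proof.
move=> cf iN.
have N0 : 0 < N%:R :> R by rewrite ltr0n (leq_trans _ iN).
have ii : i%:R / N%:R <= i.+1%:R / N%:R :> R by rewrite ler_pM2r ?invr_gt0// ler_nat.
have cg := continuous_clamp cf.
have /(EVT_min ii)[c] : {within `[i%:R / N%:R, i.+1%:R / N%:R], continuous (f \o clamp)}.
  exact: continuous_subspaceT.
rewrite in_itv/= => ci cmin.
have fc u : i%:R / N%:R <= u <= i.+1%:R / N%:R -> f c <= f u.
  move=> ui; have := cmin u; rewrite in_itv/= => /(_ ui).
  have /andP[? ?] := step_in_itv iN ui; have /andP[? ?] := step_in_itv iN ci.
  by rewrite !clamp_id.
have rk k : i%:R / N%:R <= (i%:R + dense_time k) / N%:R <= i.+1%:R / N%:R.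
  rewrite !ler_pM2r ?invr_gt0// -natr1.
  by have := clamp_itv (if unpickle k is Some q then ratr q else 0); rewrite -/(dense_time k); lra.
have hinf : has_inf (range (fun k : nat => f ((i%:R + dense_time k) / N%:R))).
  split; first by exists (f ((i%:R + dense_time 0) / N%:R)); exists 0%N.
  by exists (f c) => _ [k _ <-]; exact: fc.
suff E : step_min N i f = f c by split; [rewrite E|exists c].
apply/eqP; rewrite eq_le; apply/andP; split; last first.
  by apply: lb_le_inf => [|_ [k _ <-]]; [case: hinf|exact: fc].
apply/ler_addgt0Pr => e e0.
have := cg c => /cvgrPdist_lt /(_ _ e0); rewrite near_simpl => /nbhs_ballP[r /= r0 hr].
have /andP[c0 c1] := step_in_itv iN ci.
have [k hk] : exists k, `|dense_time k - (c * N%:R - i%:R)| < r * N%:R.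
  apply: dense_time_approx; last by rewrite mulr_gt0.
  move: ci; rewrite ler_pdivrMr// ler_pdivlMr// -natr1; lra.
have hk' : `|c - (i%:R + dense_time k) / N%:R| < r.
  rewrite -(ltr_pM2r N0); apply: le_lt_trans hk.
  rewrite -[X in _ * X](ger0_norm (ltW N0)) -normrM mulrBl divfK ?gt_eqF//.
  by rewrite distrC le_eqVlt; apply/orP; left; apply/eqP; congr `|_|; ring.
have := hr ((i%:R + dense_time k) / N%:R) hk'.
have /andP[? ?] := step_in_itv iN (rk k).
rewrite /= !clamp_id// => h.
apply: (@le_trans _ _ (f ((i%:R + dense_time k) / N%:R))).
  by apply: ge_inf; [case: hinf|exists k].
move: h; rewrite ltr_distlC; lra.
Qed.

Definition first_argmin (m : nat -> R) (lo hi i : nat) : bool :=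
  [&& (lo <= i < hi)%N, all (fun k => m i <= m k) (index_iota lo hi) &
      all (fun k => m i < m k) (index_iota lo i)].

Lemma first_argminP m lo hi i : reflect
  [/\ (lo <= i < hi)%N, forall k, (lo <= k < hi)%N -> m i <= m k &
      forall k, (lo <= k < i)%N -> m i < m k] (first_argmin m lo hi i).
Proof.
apply: (iffP and3P) => -[h1 h2 h3]; split => //.
- by move=> k hk; move/allP: h2; apply; rewrite mem_index_iota.
- by move=> k hk; move/allP: h3; apply; rewrite mem_index_iota.
- by apply/allP => k; rewrite mem_index_iota; exact: h2.
- by apply/allP => k; rewrite mem_index_iota; exact: h3.
Qed.

Lemma first_argmin_exists m lo hi : (lo < hi)%N -> exists i, first_argmin m lo hi i.
Proof.
elim: hi => // hi ih; rewrite ltnS leq_eqVlt => /predU1P[<-|].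
  exists lo; apply/first_argminP; split => [|k|k]; first by rewrite leqnn ltnSn.
    by rewrite ltnS -eqn_leq => /eqP <-.
  by move=> /andP[h1 h2]; have := leq_ltn_trans h1 h2; rewrite ltnn.
move=> lohi; have [i /first_argminP[/andP[h1 h2] h3 h4]] := ih lohi.
have [ihi|hii] := leP (m i) (m hi).
  exists i; apply/first_argminP; split => //; first by rewrite h1 ltnS ltnW.
  move=> k /andP[lok]; rewrite ltnS leq_eqVlt => /predU1P[->//|khi].
  by apply: h3; rewrite lok.
exists hi; apply/first_argminP; split; first by rewrite (ltnW lohi) ltnSn.
  move=> k /andP[lok]; rewrite ltnS leq_eqVlt => /predU1P[->//|khi].
  by rewrite (le_trans (ltW hii))// h3// lok.
by move=> k hk; rewrite (lt_le_trans hii)// h3.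
Qed.

Lemma first_argmin_uniq m lo hi i j :
  first_argmin m lo hi i -> first_argmin m lo hi j -> i = j.
Proof.
move=> /first_argminP[/andP[i1 i2] i3 i4] /first_argminP[/andP[j1 j2] j3 j4].
case: (ltngtP i j) => // [ij|ji].
  by have := i3 j; rewrite j1 j2 leNgt j4 ?i1// => /(_ isT).
by have := j3 i; rewrite i1 i2 leNgt i4 ?j1// => /(_ isT).
Qed.

(** This is the step that forgets the global requirement: a first argmin over everything is also a
    first argmin over its own cell. *)
Lemma first_argmin_sub m lo hi lo' hi' i : (lo <= lo')%N -> (hi' <= hi)%N ->
  (lo' <= i < hi')%N -> first_argmin m lo hi i -> first_argmin m lo' hi' i.
Proof.
move=> l h i' /first_argminP[_ i3 i4]; apply/first_argminP; split => // k /andP[k1 k2].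
  by apply: i3; rewrite (leq_trans l)// (leq_trans k2).
by apply: i4; rewrite (leq_trans l)// k2.
Qed.

(** The minimum over step [i] is a global one, attained in that step, which bounds the argmin from
    above. A minimizer before the step would lie in an earlier one, whose minimum is strictly
    larger. *)
Lemma argmin_time_step f (N i : nat) : {within `[0, 1], continuous f} ->
  first_argmin (fun k => step_min N k f) 0 N i ->
  i%:R / N%:R <= argmin_time f <= i.+1%:R / N%:R.
Proof.
move=> cf /first_argminP[/= iN imin ifirst].
have N0 : 0 < N%:R :> R by rewrite ltr0n (leq_trans _ iN).
have locate u : 0 <= u <= 1 ->
    exists2 k, (k < N)%N & k%:R / N%:R <= u <= k.+1%:R / N%:R.
  (* At [u = 1] truncation would give the index [N], one past the last step. *)
  move=> /andP[u0 u1]; have [->|nu1] := eqVneq u 1.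
    exists N.-1; first by rewrite prednK// (leq_trans _ iN).
    rewrite prednK ?(leq_trans _ iN)// divff ?gt_eqF// lexx andbT.
    by rewrite ler_pdivrMr// mul1r ler_nat leq_pred.
  have uN0 : 0 <= u * N%:R by rewrite mulr_ge0// ltW.
  have /andP[h1 h2] := truncn_itv uN0.
  exists (Num.truncn (u * N%:R)); last by rewrite ler_pdivrMr// ler_pdivlMr// h1 ltW.
  rewrite -(ltr_nat R) (le_lt_trans h1)// gtr_pMl//; lra.
have [lowi [c ci fc]] := step_minP cf iN.
have gmin u : 0 <= u <= 1 -> step_min N i f <= f u.
  by move=> /locate[k kN uk]; rewrite (le_trans (imin k _))//; exact: (step_minP cf kN).1.
rewrite /argmin_time; set A := [set _ | _].
have Ac : A c.
  split; first by rewrite in_itv/= (step_in_itv iN ci).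
  by move=> s; rewrite in_itv/= fc; exact: gmin.
apply/andP; split; last first.
  apply: (@le_trans _ _ c); last by case/andP: ci.
  by apply: ge_inf => //; exists 0 => u [+ _]; rewrite in_itv/= => /andP[].
apply: lb_le_inf; first by exists c.
move=> u [+ umin]; rewrite in_itv/= => u01; rewrite leNgt; apply/negP => ui.
have [k kN uk] := locate u u01.
have ki : (k < i)%N.
  rewrite -(ltr_nat R) -(@ltr_pM2r _ N%:R^-1) ?invr_gt0//.
  by case/andP: uk => + _; move=> /le_lt_trans; exact.
have := ifirst k ki; rewrite ltNge => /negP; apply.
rewrite -fc (le_trans ((step_minP cf kN).1 u uk))// umin//.
by rewrite in_itv/= (step_in_itv iN ci).
Qed.

Lemma argmin_time_itv f : {within `[0, 1], continuous f} -> 0 <= argmin_time f <= 1.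
Proof.
move=> cf; have [i hi] := first_argmin_exists (fun k => step_min 1 k f) (ltn0Sn 0).
have := argmin_time_step cf hi; move/first_argminP: hi => [/=].
by rewrite ltnS leqn0 => /eqP -> _ _; rewrite !divr1.
Qed.

End cyclic_shift.

Section step_min_measurable.
Context {R : realType}.

Lemma step_minB (f : R -> R) (N i : nat) (c : R) : {within `[0, 1], continuous f} ->
  (i < N)%N -> step_min N i (fun u => f u - c) = step_min N i f - c.
Proof.
move=> cf iN.
have cg : {within `[0, 1], continuous (fun u => f u - c)}.
  by move=> u; apply: cvgB; [exact: cf|exact: cvg_cst].
have [lf [u uI fu]] := step_minP cf iN.
have [lg [v vI gv]] := step_minP cg iN.
apply/eqP; rewrite eq_le; apply/andP; split.
  by rewrite (le_trans (lg u uI))// fu.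
by rewrite -gv lerD2r; exact: lf.
Qed.

Lemma measurable_step_min d (U : measurableType d) (X : R -> U -> R) (N i : nat) :
  (forall w, {within `[0, 1], continuous (X ^~ w)}) -> (i < N)%N ->
  (forall u, i%:R / N%:R <= u <= i.+1%:R / N%:R -> measurable_fun setT (X u)) ->
  measurable_fun setT (fun w => step_min N i (X ^~ w)).
Proof.
move=> cX iN mX.
have N0 : 0 < N%:R :> R by rewrite ltr0n (leq_trans _ iN).
pose t (k : nat) : R := (i%:R + dense_time k) / N%:R.
have tI k : i%:R / N%:R <= t k <= i.+1%:R / N%:R.
  rewrite /t !ler_pM2r ?invr_gt0// -natr1.
  by have := clamp_itv (if unpickle k is Some q then ratr q else 0 : R); rewrite -/(dense_time k); lra.
have -> : (fun w => step_min N i (X ^~ w)) = (fun w => infs (fun k => X (t k) w) 0).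
  apply/funext => w; rewrite /step_min /infs /sdrop; congr (inf _).
  by apply/seteqP; split => x [k _ <-]; exists k.
apply: measurable_fun_infs => [w _|k]; last exact: mX.
exists (step_min N i (X ^~ w)) => _ [k _ <-].
exact: (step_minP (cX w) iN).1.
Qed.

Lemma measurable_first_argmin d (U : measurableType d) (m : nat -> U -> R) lo hi i :
  (forall k, (lo <= k < hi)%N -> measurable_fun setT (m k)) ->
  measurable [set w | first_argmin (m ^~ w) lo hi i].
Proof.
move=> mm; have [ilohi|nilohi] := boolP (lo <= i < hi)%N; last first.
  rewrite (_ : [set _ | _] = set0)//; apply/seteqP; split => // w /= /first_argminP[].
  by rewrite (negbTE nilohi).
have -> : [set w | first_argmin (m ^~ w) lo hi i] =
  (\bigcap_(k in [set k | (lo <= k < hi)%N]) [set w | m i w <= m k w]) `&`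
  (\bigcap_(k in [set k | (lo <= k < i)%N]) [set w | m i w < m k w]).
  apply/seteqP; split => [w /first_argminP[_ h1 h2]|w [h1 h2]].
    by split => k hk; [exact: h1|exact: h2].
  by apply/first_argminP; split.
apply: measurableI; apply: bigcap_measurableType => // k /= hk.
  have -> : [set w | m i w <= m k w] = (fun w => m i w <= m k w) @^-1` [set true].
    by [].
  by rewrite -[_ @^-1` _]setTI; apply: measurable_fun_ler => //; exact: mm.
have hk' : (lo <= k < hi)%N.
  by case/andP: hk => -> ki; rewrite (ltn_trans ki)//; case/andP: ilohi.
have -> : [set w | m i w < m k w] = (fun w => m i w < m k w) @^-1` [set true] by [].
by rewrite -[_ @^-1` _]setTI; apply: measurable_fun_ltr => //; exact: mm.
Qed.

(** Subtracting the value of the path at one fixed time leaves the argmin unchanged; this makes the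
    argmin over a cell an event of increments rather than of values. *)
Lemma first_argmin_ext (m m' : nat -> R) (c : R) lo hi i :
  (forall k, (lo <= k < hi)%N -> m' k = m k - c) ->
  first_argmin m' lo hi i = first_argmin m lo hi i.
Proof.
move=> mm'; apply/first_argminP/first_argminP => -[h1 h2 h3]; split => // k hk.
- by have := h2 k hk; rewrite !mm'// lerD2r.
- have hk' : (lo <= k < hi)%N.
    by case/andP: hk => -> ki; rewrite (ltn_trans ki)//; case/andP: h1.
  by have := h3 k hk; rewrite !mm'// ltrD2r.
- by rewrite !mm'// lerD2r h2.
- have hk' : (lo <= k < hi)%N.
    by case/andP: hk => -> ki; rewrite (ltn_trans ki)//; case/andP: h1.
  by rewrite !mm'// ltrD2r h3.
Qed.

End step_min_measurable.

(** * Exponential bound for the Vervaat transform *)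

Section tame_functionals.
Context {d : measure_display} {T : measurableType d} {R : realType}.

(* Bounded functionals of the path up to time t, continuous for pointwise
   convergence; the last clause makes them nonanticipating. *)
Record tame (t : R) (Psi : (R -> R) -> R) : Prop := {
  tame_bounded : exists c, forall f, `|Psi f| <= c ;
  tame_cvg : forall (F : nat -> R -> R) (g : R -> R),
    (forall s, 0 <= s <= t -> F n s @[n --> \oo] --> g s) ->
    Psi (F n) @[n --> \oo] --> Psi g ;
  tame_measurable : forall (G : set_system T) (X : R -> T -> R),
    (forall s, 0 <= s <= t ->
      measurable_fun setT (X s : g_sigma_algebraType G -> R)) ->
    measurable_fun setT ((fun w => Psi (X ^~ w)) : g_sigma_algebraType G -> R) }.

Lemma tame_le s t Psi : s <= t -> tame s Psi -> tame t Psi.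
Proof.
move=> st [hb hc hm]; split => //.
  by move=> F g h; apply: hc => u /andP[? ?]; apply: h; lra.
by move=> G X h; apply: hm => u /andP[? ?]; apply: h; lra.
Qed.

Lemma tame_cst t c : tame t (fun=> c).
Proof.
split; first by exists `|c|.
  by move=> F g _; exact: cvg_cst.
by move=> G X _; exact: measurable_cst.
Qed.

Lemma tameD t Psi Phi : tame t Psi -> tame t Phi -> tame t (fun f => Psi f + Phi f).
Proof.
move=> [[c1 hb1] hc1 hm1] [[c2 hb2] hc2 hm2]; split.
- by exists (c1 + c2) => f; rewrite (le_trans (ler_normD _ _))// lerD.
- by move=> F g h; apply: cvgD; [exact: hc1|exact: hc2].
- by move=> G X h; apply: measurable_funD; [exact: hm1|exact: hm2].
Qed.

Lemma tameM t Psi Phi : tame t Psi -> tame t Phi -> tame t (fun f => Psi f * Phi f).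
Proof.
move=> [[c1 hb1] hc1 hm1] [[c2 hb2] hc2 hm2]; split.
- by exists (c1 * c2) => f; rewrite normrM ler_pM.
- by move=> F g h; apply: cvgM; [exact: hc1|exact: hc2].
- by move=> G X h; apply: measurable_funM; [exact: hm1|exact: hm2].
Qed.

End tame_functionals.

Section shifted_motion.
Context {d : measure_display} {T : measurableType d} {R : realType}.
Variables (P : probability T R) (B : R -> {RV P >-> R}).
Hypothesis hB : standard_brownian_motion B.

Definition bm_path (w : T) : R -> R := fun t => B t w.

Let B0 w : bm_path w 0 = 0. Proof. exact: (bm_start hB). Qed.
Let cB w : {within `[0, 1], continuous (bm_path w)}. Proof. exact: (bm_continuous hB). Qed.

Lemma measurable_outer (a b u : R) : outer_times a b u ->
  measurable_fun setT (outer_increment B a b u : g_sigma_algebraType (outer_gen B a b) -> R).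
Proof.
by move=> ou _ A mA; apply: sub_sigma_algebra; exists u => //; exists A.
Qed.

Lemma measurable_shift_before (a b s t : R) : 0 <= s -> 0 <= t -> s + t <= a -> a <= 1 ->
  measurable_fun setT ((fun w => cyc_shift (bm_path w) s t) : g_sigma_algebraType (outer_gen B a b) -> R).
Proof.
move=> s0 t0 sta a1.
have -> : (fun w => cyc_shift (bm_path w) s t) =
   outer_increment B a b (s + t) \- outer_increment B a b s.
  apply/funext => w; rewrite /cyc_shift !ext_le1//; try lra.
  rewrite /outer_increment /increment /bm_path sta.
  by rewrite (_ : s <= a)//=; [ring|lra].
by apply: measurable_funB; apply: measurable_outer; left; lra.
Qed.

(** The path may pass time 1, where it continues from time 0. The condition [s + t <= 1 + a] stops
    it before it enters ]a, b] from the left. After the wrap the value splits into an increment up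
    to 1, measured from [b], and one starting at 0, measured from [a]. *)
Lemma measurable_shift_after (a b s t : R) : 0 <= a -> a < b -> b <= s -> s <= 1 ->
  0 <= t -> s + t <= 1 + a ->
  measurable_fun setT ((fun w => cyc_shift (bm_path w) s t) : g_sigma_algebraType (outer_gen B a b) -> R).
Proof.
move=> a0 ab bs s1 t0 sta.
have [st1|st1] := leP (s + t) 1.
  have -> : (fun w => cyc_shift (bm_path w) s t) =
     outer_increment B a b (s + t) \- outer_increment B a b s.
    apply/funext => w; rewrite /cyc_shift !ext_le1//; try lra.
    rewrite /outer_increment /increment /bm_path !leNgt.
    by rewrite (_ : a < s)//=; [rewrite (_ : a < s + t)/=; [ring|lra]|lra].
  by apply: measurable_funB; apply: measurable_outer; right; lra.
have -> : (fun w => cyc_shift (bm_path w) s t) =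
   ((outer_increment B a b 1 \- outer_increment B a b s) \+
   (outer_increment B a b (s + t - 1) \- outer_increment B a b 0)).
  apply/funext => w; rewrite /cyc_shift ext_ge1; [|lra|lra]; rewrite ext_le1//; try lra.
  rewrite /outer_increment /increment a0 (_ : s + t - 1 <= a); last lra.
  rewrite !leNgt (_ : a < s); last lra.
  rewrite (_ : a < 1) /=; last lra.
  by have := B0 w; rewrite /bm_path => ->; ring.
by apply: measurable_funD; apply: measurable_funB; apply: measurable_outer;
  [right|right|left|left]; lra.
Qed.

Lemma measurable_cell_argmin (a b : R) (N lo hi i : nat) : 0 <= a -> a < b -> b <= 1 ->
  (hi <= N)%N -> hi%:R / N%:R <= a \/ b <= lo%:R / N%:R ->
  <<s outer_gen B a b >> [set w | first_argmin (fun k => step_min N k (bm_path w)) lo hi i].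
Proof.
move=> a0 ab b1 hiN ab_out.
have [hi0|hi_gt0] := posnP hi.
  rewrite hi0 (_ : [set w | _] = set0); first exact: (@measurable0 _ (g_sigma_algebraType _)).
  by apply/seteqP; split => // w /first_argminP[]; rewrite ltn0 andbF.
have N0 : 0 < N%:R :> R by rewrite ltr0n (leq_trans hi_gt0).
(* The endpoint of ]a, b] on the side of the cell: values relative to it are outer increments. *)
pose c : R := if `[< hi%:R / N%:R <= a >] then a else b.
pose Z (u : R) (w : T) := B u w - B c w.
have cZ w : {within `[0, 1], continuous (Z ^~ w)}.
  by move=> u; apply: cvgB; [exact: cB|exact: cvg_cst].
have -> : [set w | first_argmin (fun k => step_min N k (bm_path w)) lo hi i] =
          [set w | first_argmin (fun k => step_min N k (Z ^~ w)) lo hi i].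
  have E w : first_argmin (fun k => step_min N k (Z ^~ w)) lo hi i =
             first_argmin (fun k => step_min N k (bm_path w)) lo hi i.
    apply: (@first_argmin_ext _ _ _ (B c w)) => k /andP[_ khi].
    by rewrite -step_minB// (leq_trans khi).
  by apply/seteqP; split => w /=; rewrite E.
apply: (@measurable_first_argmin _ _ (g_sigma_algebraType (outer_gen B a b))
  (fun k w => step_min N k (Z ^~ w))).
move=> k /andP[lok khi]; apply: (@measurable_step_min _ _ (g_sigma_algebraType (outer_gen B a b))) => //.
  by rewrite (leq_trans khi).
move=> u /andP[ku uk].
have u0 : 0 <= u by rewrite (le_trans _ ku)// divr_ge0.
have uhi : u <= hi%:R / N%:R by rewrite (le_trans uk)// ler_pM2r ?invr_gt0// ler_nat.
have ulo : lo%:R / N%:R <= u by rewrite (le_trans _ ku)// ler_pM2r ?invr_gt0// ler_nat.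
have hi1 : hi%:R / N%:R <= 1 :> R by rewrite ler_pdivrMr// mul1r ler_nat.
rewrite /Z /c; case: asboolP => [hia|nhia].
  have -> : (fun w => B u w - B a w) = outer_increment B a b u.
    by rewrite /outer_increment (le_trans uhi).
  by apply: measurable_outer; left; lra.
have blo : b <= lo%:R / N%:R by case: ab_out.
have -> : (fun w => B u w - B b w) = outer_increment B a b u.
  by rewrite /outer_increment leNgt (_ : a < u)//; lra.
by apply: measurable_outer; right; lra.
Qed.

End shifted_motion.

Lemma measurable_sum_nat d (U : measurableType d) (R : realType) (K L : nat)
    (F : nat -> U -> R) :
  (forall l, (K <= l < L)%N -> measurable_fun setT (F l)) ->
  measurable_fun setT (fun w => \sum_(K <= l < L) F l w).
Proof.
move=> mF.
have -> : (fun w => \sum_(K <= l < L) F l w) =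
          (fun w => \sum_(K <= l < L) (if (K <= l < L)%N then F l else cst 0) w).
  by apply/funext => w; apply: eq_big_nat => l ->.
by apply: measurable_sum => l; case: ifP => [/mF//|_]; exact: measurable_cst.
Qed.

Section exponential_bound.
Context {d : measure_display} {T : measurableType d} {R : realType}.
Variables (P : probability T R) (B : R -> {RV P >-> R}).
Hypothesis hB : standard_brownian_motion B.

Let B0 w : bm_path B w 0 = 0. Proof. exact: (bm_start hB). Qed.
Let cB w : {within `[0, 1], continuous (bm_path B w)}. Proof. exact: (bm_continuous hB). Qed.

Lemma outer_gen_measurable a b : outer_gen B a b `<=` measurable.
Proof. by move=> _ [u _ [A mA <-]]; exact: measurable_outer_increment. Qed.

Lemma gaussian_increment_step (a b : R) (Z h : T -> R) :
  0 <= a -> a < b -> b <= 1 ->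
  measurable_fun setT (Z : g_sigma_algebraType (outer_gen B a b) -> R) ->
  measurable_fun setT (h : g_sigma_algebraType (outer_gen B a b) -> R) ->
  (forall w, 0 <= Z w) ->
  (\int[P]_w (Z w * expR (h w * increment B a b w - h w ^+ 2 * (b - a) / 2))%:E =
   \int[P]_w (Z w)%:E)%E.
Proof.
move=> a0 ab b1 mZ mh Z0.
have ba0 : 0 <= b - a by lra.
rewrite -[in LHS](sqr_sqrtr ba0).
apply: (gaussian_step (@outer_gen_measurable a b)) => //.
- by apply: measurable_funB.
- by rewrite gt_eqF// sqrtr_gt0; lra.
- by move=> A D sA mD; exact: increment_independent.
- by move=> D mD; exact: (bm_gaussian_increments hB).
Qed.

(* The logarithm of the stochastic exponential of Psi against the path x on the
   grid K/N, ..., L/N. *)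
Definition exponent (Psi : nat -> (R -> R) -> R) (N K L : nat) (x : R -> R) : R :=
  \sum_(K <= l < L) (Psi l x * (x (l.+1%:R / N%:R) - x (l%:R / N%:R)) -
                     Psi l x ^+ 2 / 2 * (l.+1%:R / N%:R - l%:R / N%:R)).

Definition shifted (N j : nat) (w : T) : R -> R := cyc_shift (bm_path B w) (j%:R / N%:R).

(** The choice [K = N], [c = 0] gives the event that step [j] is the first to hold the global
    minimum. *)
Definition in_cell (N K c j : nat) : set T :=
  [set w | first_argmin (fun k => step_min N k (bm_path B w)) (c * K) (c.+1 * K) j].

(** From [j] in cell [c], [K] steps suffice to leave the cell, and the first [N - K] steps do not
    lead back into it, even around the wrap at time 1. The step number [l] is thus an increment of
    [B] over some ]a, b] outside the cell, while both the argmin event and the path read so far use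
    only increments that avoid ]a, b]. The two cases are steps before and after the wrap. *)
Lemma cell_step_outside (N n K c j l : nat) : N = (n * K)%N -> (c < n)%N ->
  (c * K <= j < c.+1 * K)%N -> (K <= l < N - K)%N ->
  exists a b : R, [/\ 0 <= a, a < b, b <= 1,
    b - a = l.+1%:R / N%:R - l%:R / N%:R &
    [/\ (c.+1 * K)%:R / N%:R <= a \/ b <= (c * K)%:R / N%:R,
      forall w, shifted N j w (l.+1%:R / N%:R) - shifted N j w (l%:R / N%:R) =
               increment B a b w &
      forall t, 0 <= t <= l%:R / N%:R ->
        measurable_fun setT ((fun w => shifted N j w t) : g_sigma_algebraType (outer_gen B a b) -> R)]].
Proof.
move=> NE cn cj Kl.
have N0 : 0 < N%:R :> R by rewrite ltr0n; nia.
have leN (p q : nat) : (p <= q)%N -> p%:R / N%:R <= q%:R / N%:R :> R.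
  by move=> pq; rewrite ler_pM2r ?invr_gt0// ler_nat.
have ltN (p q : nat) : (p < q)%N -> p%:R / N%:R < q%:R / N%:R :> R.
  by move=> pq; rewrite ltr_pM2r ?invr_gt0// ltr_nat.
have le1 (p : nat) : (p <= N)%N -> p%:R / N%:R <= 1 :> R.
  by move=> pN; rewrite ler_pdivrMr// mul1r ler_nat.
have ge0 (p : nat) : 0 <= p%:R / N%:R :> R by rewrite divr_ge0.
have addN (p q : nat) : p%:R / N%:R + q%:R / N%:R = (p + q)%:R / N%:R :> R.
  by rewrite -mulrDl natrD.
have NN : N%:R / N%:R = 1 :> R by rewrite divff// gt_eqF.
have [jl|jl] := ltnP (j + l) N.
  exists ((j + l)%:R / N%:R), ((j + l.+1)%:R / N%:R); split => //.
  - by apply: ltN; lia.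
  - by apply: le1; lia.
  - by rewrite -!addN; ring.
  - split.
    + by left; apply: leN; nia.
    + move=> w; rewrite /shifted /cyc_shift !addN !ext_le1 ?le1//; [|lia..].
      by rewrite /increment /bm_path; ring.
    + move=> t /andP[t0 tl]; apply: measurable_shift_before => //.
        by rewrite -addN lerD2l.
      by apply: le1; lia.
have jN : (j <= N)%N by nia.
exists ((j + l - N)%:R / N%:R), ((j + l.+1 - N)%:R / N%:R).
have addBN (p : nat) : (N <= p)%N -> (p - N)%:R / N%:R = p%:R / N%:R - 1 :> R.
  by move=> Np; rewrite natrB// mulrBl NN.
have bc : ((j + l.+1 - N) <= c * K)%N by nia.
have ab : (j + l - N)%:R / N%:R < (j + l.+1 - N)%:R / N%:R :> R by apply: ltN; lia.
have b1 : (j + l.+1 - N)%:R / N%:R <= 1 :> R by apply: le1; nia.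
split => //.
- by rewrite !addBN -?addN; [ring|lia..].
- split.
  + by right; apply: leN.
  + move=> w; rewrite /shifted /cyc_shift !addN.
    have h1 : 1 <= (j + l.+1)%:R / N%:R :> R by move: (leN N (j + l.+1)%N); rewrite NN; apply; lia.
    have h2 : (j + l.+1)%:R / N%:R <= 2 :> R.
      by rewrite ler_pdivrMr// -natrM ler_nat; nia.
    have h3 : 1 <= (j + l)%:R / N%:R :> R by move: (leN N (j + l)%N); rewrite NN; apply; lia.
    have h4 : (j + l)%:R / N%:R <= 2 :> R.
      by rewrite ler_pdivrMr// -natrM ler_nat; nia.
    rewrite !(ext_ge1 _ h1 h2) !(ext_ge1 _ h3 h4) !addBN; [|lia..].
    by rewrite /increment /bm_path; ring.
  + move=> t /andP[t0 tl]; apply: (measurable_shift_after hB) => //.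
    * by apply: leN; nia.
    * by apply: le1; nia.
    * rewrite addBN; last lia.
      by rewrite -addN; lra.
Qed.

(** Induction on [L] removes the last factor of the exponential. The indicator of the cell event and
    the earlier factors form the weight [Z] of [gaussian_increment_step], all of it measurable for
    the increments outside the last step. *)
Lemma exponent_martingale (Psi : nat -> (R -> R) -> R) (N n K c j L : nat) :
  N = (n * K)%N -> (c < n)%N -> (c * K <= j < c.+1 * K)%N -> (L <= N - K)%N ->
  (forall l, (l < N)%N -> tame (T := T) (l%:R / N%:R) (Psi l)) ->
  (\int[P]_w (\1_(in_cell N K c j) w * expR (exponent Psi N K L (shifted N j w)))%:E
   = P (in_cell N K c j))%E.
Proof.
move=> NE cn cj LN tPsi.
have K0 : (0 < K)%N by nia.
have N0 : (0 < N)%N by nia.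
have NR0 : 0 < N%:R :> R by rewrite ltr0n.
have out a b : 0 <= a -> a < b -> b <= 1 ->
    (c.+1 * K)%:R / N%:R <= a \/ b <= (c * K)%:R / N%:R ->
    <<s outer_gen B a b >> (in_cell N K c j).
  by move=> a0 ab b1 o; apply: (measurable_cell_argmin hB) => //; nia.
have mD : measurable (in_cell N K c j).
  apply: measurable_first_argmin => k /andP[_ kK]; apply: measurable_step_min => //; nia.
elim: L LN => [|L ih] LN.
  under eq_integral do rewrite /exponent big_geq// expR0 mulr1.
  by rewrite integral_indic// setIT.
have [LK|KL] := ltnP L K.
  rewrite -ih; last lia.
  by apply: eq_integral => w _; rewrite /exponent !big_geq//; lia.
have KLN : (K <= L < N - K)%N by rewrite KL; lia.
have [a [b [a0 ab b1 ba [ho inc mt]]]] := cell_step_outside NE cn cj KLN.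
rewrite -ih; last lia.
rewrite -(@gaussian_increment_step a b
  (fun w => \1_(in_cell N K c j) w * expR (exponent Psi N K L (shifted N j w)))
  (fun w => Psi L (shifted N j w)))//.
- apply: eq_integral => w _; congr EFin.
  rewrite /exponent big_nat_recr//= expRD mulrA inc -ba.
  by congr (_ * expR _); ring.
- apply: measurable_funM.
    by apply: measurable_indic; exact: out ho.
  apply: measurableT_comp => //; rewrite /exponent.
  apply: measurable_sum_nat => l /andP[Kl lL].
  have mPsi : measurable_fun setT ((fun w => Psi l (shifted N j w)) : g_sigma_algebraType (outer_gen B a b) -> R).
    apply: (tame_measurable (tPsi l _) (X := fun t w => shifted N j w t)); first lia.
    move=> t /andP[t0 tl]; apply: mt; rewrite t0 (le_trans tl)//.
    by rewrite ler_pM2r ?invr_gt0// ler_nat ltnW.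
  apply: measurable_funB; last by apply: measurable_funM => //; apply: measurable_funM => //; exact: measurable_funX.
  apply: measurable_funM => //; apply: measurable_funB; apply: mt;
    by rewrite divr_ge0//= ler_pM2r ?invr_gt0// ler_nat//; lia.
- by apply: (tame_measurable (tPsi L _) (X := fun t w => shifted N j w t)) => //; lia.
Qed.

End exponential_bound.

Lemma integral_limit_le d (T : measurableType d) (R : realType)
    (mu : {measure set T -> \bar R}) (f_ : nat -> T -> R) (f : T -> R) (c : \bar R) :
  (forall n, measurable_fun setT (f_ n)) -> (forall n w, 0 <= f_ n w) ->
  (forall w, f_ n w @[n --> \oo] --> f w) ->
  (forall n, (\int[mu]_w (f_ n w)%:E <= c)%E) -> (\int[mu]_w (f w)%:E <= c)%E.
Proof.
move=> mf f0 ff fc.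
have := @fatou _ _ _ mu setT measurableT (fun n w => (f_ n w)%:E) _ _.
move=> /(_ (fun n => (measurable_EFinP _ _).2 (mf n))).
move=> /(_ (fun n w _ => f0 n w)) h.
have E : (\int[mu]_w (f w)%:E = \int[mu]_w limn_einf (fun n => (f_ n w)%:E))%E.
  apply: eq_integral => w _.
  have fw : (f_ n w)%:E @[n --> \oo] --> (f w)%:E by apply: cvg_EFin; [exact: nearW|exact: ff].
  rewrite is_cvg_limn_einfE; last by apply/cvg_ex; exists (f w)%:E.
  by apply/esym/cvg_lim.
rewrite E; apply: (le_trans h).
rewrite limn_einf_lim; apply: lime_le; first exact: is_cvg_einfs.
apply: nearW => n; apply: le_trans (fc n); apply: ereal_inf_lbound.
by exists n => /=.
Qed.

Lemma unit_frac (R : realType) (k N : nat) : (k <= N)%N -> (0 <= k%:R / N%:R :> R) && (k%:R / N%:R <= 1 :> R).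
Proof.
case: N => [|N] kN; first by rewrite invr0 mulr0 lexx ler01.
by rewrite divr_ge0//= ler_pdivrMr ?ltr0n// mul1r ler_nat.
Qed.

Lemma sum_blocks (R : realType) (F : nat -> R) (x : nat -> R) (r K L : nat) : (0 < r)%N ->
  \sum_(K * r <= l < L * r) F (l %/ r)%N * (x l.+1 - x l) =
  \sum_(K <= i < L) F i * (x (i.+1 * r)%N - x (i * r)%N).
Proof.
move=> r0; have [LK|KL] := leqP L K.
  by rewrite !big_geq// leq_mul2r LK orbT.
rewrite -(subnKC (ltnW KL)); elim: (L - K)%N => [|m ih]; first by rewrite addn0 !big_geq.
rewrite addnS big_nat_recr/=; last by rewrite leq_addr.
rewrite (@big_cat_nat _ _ _ ((K + m) * r))/=; [|by rewrite leq_mul2r leq_addr orbT|by rewrite leq_mul2r leqnSn orbT].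
rewrite ih; congr (_ + _).
have -> : \sum_((K + m) * r <= i < (K + m).+1 * r) F (i %/ r)%N * (x i.+1 - x i) =
   \sum_((K + m) * r <= i < (K + m).+1 * r) F (K + m)%N * (x i.+1 - x i).
  apply: eq_big_nat => i /andP[h1 h2]; congr (F _ * _).
  by apply/eqP; rewrite eqn_leq -ltnS ltn_divLR// h2 leq_divRL.
by rewrite -mulr_sumr telescope_sumr// leq_mul2r leqnSn orbT.
Qed.

(** * From discrete argmins to the Vervaat transform *)

Section master_bound.
Context {d : measure_display} {T : measurableType d} {R : realType}.
Variables (P : probability T R) (B : R -> {RV P >-> R}).
Hypothesis hB : standard_brownian_motion B.

Let B0 w : bm_path B w 0 = 0. Proof. exact: (bm_start hB). Qed.
Let cB w : {within `[0, 1], continuous (bm_path B w)}. Proof. exact: (bm_continuous hB). Qed.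

Lemma tame_measurableT t Psi (X : R -> T -> R) : tame (T := T) t Psi ->
  (forall s, 0 <= s <= t -> measurable_fun setT (X s)) ->
  measurable_fun setT (fun w => Psi (X ^~ w)).
Proof.
move=> tPsi mX; apply: (@measurable_fun_sub_sigma _ _ (@measurable d T)) => //.
apply: (tame_measurable tPsi) => s st _ A mA.
by apply: sub_sigma_algebra; exact: mX.
Qed.

Lemma measurable_exponent (Psi : nat -> (R -> R) -> R) (N K L : nat) (X : R -> T -> R) :
  (L <= N)%N -> (forall l, (l < N)%N -> tame (T := T) (l%:R / N%:R) (Psi l)) ->
  (forall t, 0 <= t <= 1 -> measurable_fun setT (X t)) ->
  measurable_fun setT (fun w => exponent Psi N K L (X ^~ w)).
Proof.
move=> LN tPsi mX; rewrite /exponent; apply: measurable_sum_nat => l /andP[Kl lL].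
have t1 k (kN : (k <= N)%N) := unit_frac R kN.
have mPsi : measurable_fun setT (fun w => Psi l (X ^~ w)).
  apply: (tame_measurableT (tPsi l _)) => [|s /andP[s0 sl]]; first lia.
  by apply: mX; rewrite s0 (le_trans sl)//; case/andP: (t1 l (ltac:(lia))).
apply: measurable_funB.
  by apply: measurable_funM => //; apply: measurable_funB; apply: mX; apply: t1; lia.
by do 2! apply: measurable_funM => //; exact: measurable_funX.
Qed.

Lemma exponent_cvg (Psi : nat -> (R -> R) -> R) (N K L : nat) (F : nat -> R -> R) (g : R -> R) :
  (L <= N)%N -> (forall l, (l < N)%N -> tame (T := T) (l%:R / N%:R) (Psi l)) ->
  (forall t, 0 <= t <= 1 -> F n t @[n --> \oo] --> g t) ->
  exponent Psi N K L (F n) @[n --> \oo] --> exponent Psi N K L g.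
Proof.
move=> LN tPsi FG; elim: L LN => [|L ih] LN.
  rewrite /exponent; under eq_fun do rewrite big_geq//.
  by rewrite big_geq//; exact: cvg_cst.
have [KL|LK] := leqP K L; last first.
  rewrite /exponent; under eq_fun do rewrite big_geq//.
  by rewrite big_geq//; exact: cvg_cst.
have t1 k (kN : (k <= N)%N) := unit_frac R kN.
rewrite /exponent; under eq_fun do rewrite big_nat_recr//.
rewrite big_nat_recr//=; apply: cvgD; first by apply: ih; lia.
have cPsi : Psi L (F n) @[n --> \oo] --> Psi L g.
  apply: (tame_cvg (tPsi L _)) => [|s /andP[s0 sl]]; first lia.
  by apply: FG; rewrite s0 (le_trans sl)//; case/andP: (t1 L (ltac:(lia))).
apply: cvgB.
  apply: cvgM => //; apply: cvgB; apply: FG; apply: t1; lia.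
by do 2! apply: cvgMl => //; rewrite !expr2; apply: cvgM.
Qed.

(** It allows the grid that locates the argmin to be refined while the integrand keeps its own
    coarser grid. *)
Lemma exponent_refine (Psi : nat -> (R -> R) -> R) (N K L r : nat) (x : R -> R) : (0 < r)%N ->
  exponent (fun l => Psi (l %/ r)%N) (N * r) (K * r) (L * r) x = exponent Psi N K L x.
Proof.
move=> r0; rewrite /exponent !big_split/= !sumrN.
rewrite (sum_blocks (fun i => Psi i x) (fun i => x (i%:R / (N * r)%:R)))//.
rewrite (sum_blocks (fun i => Psi i x ^+ 2 / 2) (fun i => i%:R / (N * r)%:R))//.
have E i : (i * r)%:R / (N * r)%:R = i%:R / N%:R :> R.
  have [->|N0] := posnP N; first by rewrite mul0n invr0 !mulr0.
  by rewrite !natrM -mulf_div divff ?mulr1// pnatr_eq0 -lt0n.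
by congr (_ - _); apply: eq_bigr => i _; rewrite !E.
Qed.

Lemma measurable_ext t : measurable_fun setT (fun w => ext (bm_path B w) t).
Proof. by apply: measurable_funD. Qed.

Lemma measurable_shifted N j t : measurable_fun setT (fun w => shifted B N j w t).
Proof. by apply: measurable_funB; exact: measurable_ext. Qed.

Lemma measurable_in_cell N K c j : (c.+1 * K <= N)%N -> measurable (in_cell B N K c j).
Proof.
move=> cN; apply: measurable_first_argmin => k /andP[_ kK].
by apply: measurable_step_min => //; lia.
Qed.

(** Exactly one indicator is 1, so this is the exponential along the path read from the left end of
    the step that holds the argmin. *)
Let grid_exp (Psi : nat -> (R -> R) -> R) N K L (w : T) : R :=
  \sum_(j < N) \1_(in_cell B N N 0 j) w * expR (exponent Psi N K L (shifted B N j w)).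

Lemma in_cell_sub N n K j w : N = (n * K)%N -> in_cell B N N 0 j w ->
  exists2 c, (c < n)%N & in_cell B N K c j w.
Proof.
move=> NE jw; have jN : (j < N)%N by move/first_argminP: jw => [+ _ _]; lia.
have jn : (j %/ K < n)%N by rewrite ltn_divLR; nia.
exists (j %/ K)%N => //.
apply: first_argmin_sub jw; [by rewrite mul0n| |].
  by rewrite mul1n NE leq_mul2r jn orbT.
by rewrite leq_divM ltn_ceil//; nia.
Qed.

(** The global event is contained in the event of the cell of [j]. For the latter the expectation is
    the probability of the event, and within one cell these events are disjoint, so each of the [n]
    cells adds at most 1. *)
Lemma grid_exp_le (Psi : nat -> (R -> R) -> R) (N n K : nat) : N = (n * K)%N ->
  (forall l, (l < N)%N -> tame (T := T) (l%:R / N%:R) (Psi l)) ->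
  (\int[P]_w (grid_exp Psi N K (N - K) w)%:E <= n%:R%:E)%E.
Proof.
move=> NE tPsi.
pose F c j w := \1_(in_cell B N K c j) w * expR (exponent Psi N K (N - K) (shifted B N j w)).
have F0 c j w : 0 <= F c j w by rewrite mulr_ge0// ?expR_ge0.
have mexp j : measurable_fun setT (fun w => expR (exponent Psi N K (N - K) (shifted B N j w))).
  apply: measurableT_comp => //; apply: measurable_exponent (leq_subr _ _) tPsi _ => t _.
  exact: measurable_shifted.
have mF c j : (c < n)%N -> measurable_fun setT (F c j).
  move=> cn; apply: measurable_funM => //; apply: measurable_indic.
  by apply: measurable_in_cell; rewrite NE leq_mul2r cn orbT.
have intF c j : (c < n)%N -> (j < N)%N ->
    (\int[P]_w (F c j w)%:E = P (in_cell B N K c j))%E.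
  move=> cn jN; have [cj|ncj] := boolP (c * K <= j < c.+1 * K)%N.
    exact: (exponent_martingale hB NE cn cj (leqnn _) tPsi).
  have e0 : in_cell B N K c j = set0.
    by apply/seteqP; split => // w /first_argminP[]; rewrite (negbTE ncj).
  rewrite e0 measure0; apply: integral0_eq => w _; rewrite /F e0.
  by rewrite indic0 mul0r.
apply: (@le_trans _ _ (\int[P]_w (\sum_(j < N) \sum_(c < n) (F c j w)%:E))%E).
  apply: ge0_le_integral => //.
  - by move=> w _; rewrite lee_fin sumr_ge0// => j _; rewrite mulr_ge0// expR_ge0.
  - apply/measurable_EFinP; apply: measurable_sum => j; apply: measurable_funM => //.
    by apply: measurable_indic; apply: measurable_in_cell; lia.
  - apply: emeasurable_sum => j; apply: emeasurable_sum => c.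
    by apply/measurable_EFinP; exact: mF.
  - move=> w _; rewrite /grid_exp -sumEFin; apply: lee_sum => j _.
    have [jw|njw] := pselect (in_cell B N N 0 j w); last first.
      rewrite indicE memNset// mul0r sume_ge0// => c _.
      by rewrite lee_fin.
    have [c cn cw] := in_cell_sub NE jw.
    rewrite (bigD1 (Ordinal cn))//= {1}/F !indicE (mem_set jw) (mem_set cw).
    by rewrite leeDl// sume_ge0// => i _; rewrite lee_fin.
rewrite ge0_integral_sum//; first last.
- by move=> j w _; rewrite sume_ge0// => c _; rewrite lee_fin.
- by move=> j; apply: emeasurable_sum => c; apply/measurable_EFinP; exact: mF.
under eq_bigr => j _.
  rewrite ge0_integral_sum//; first last.
  - by move=> c w _; rewrite lee_fin.
  - by move=> c; apply/measurable_EFinP; exact: mF.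
  under eq_bigr do rewrite intF//.
  over.
rewrite exchange_big/=.
apply: (@le_trans _ _ (\sum_(c < n) 1%E)); last first.
  by rewrite sumEFin sumr_const card_ord.
apply: lee_sum => c _; rewrite -measure_bigsetU_ord.
- by apply: probability_le1; apply: bigsetU_measurable => j _; apply: measurable_in_cell;
    rewrite NE leq_mul2r ltn_ord orbT.
- by move=> j; apply: measurable_in_cell; rewrite NE leq_mul2r ltn_ord orbT.
- move=> i j _ _ [w [iw jw]]; apply/val_inj; exact: first_argmin_uniq iw jw.
Qed.

Lemma shifted_cvg (M i : nat -> nat) w t : (forall r, (r < M r)%N) ->
  (forall r, first_argmin (fun k => step_min (M r) k (bm_path B w)) 0 (M r) (i r)) ->
  0 <= t <= 1 -> shifted B (M r) (i r) w t @[r --> \oo] --> vervaat (bm_path B w) t.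
Proof.
move=> rM hi t01; rewrite vervaat_shift ?argmin_time_itv//.
apply: shift_cvg => //; apply/cvgrPdist_le => e e0.
have := near_infty_natSinv_lt (PosNum e0) => /=; apply: filterS => r re.
have /andP[h1 h2] := argmin_time_step (@cB w) (hi r).
rewrite ger0_norm ?subr_ge0// (le_trans _ (ltW re))//.
rewrite lerBlDl (le_trans h2)// -natr1 mulrDl lerD2l mul1r.
by rewrite lef_pV2 ?posrE ?ltr0n ?(leq_trans _ (rM r))// ler_nat rM.
Qed.

(** The transform is the pointwise limit of the paths read from the discrete argmin, each of them a
    finite sum over the possible positions. *)
Lemma measurable_vervaat t : 0 <= t <= 1 ->
  measurable_fun setT (fun w => vervaat (bm_path B w) t).
Proof.
move=> t01.
apply: (@measurable_fun_cvg _ _ _ _ (fun r w =>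
  \sum_(j < r.+1) \1_(in_cell B r.+1 r.+1 0 j) w * shifted B r.+1 j w t)).
  move=> r; apply: measurable_sum => j; apply: measurable_funM; last exact: measurable_shifted.
  by apply: measurable_indic; apply: measurable_in_cell; lia.
move=> w _.
have /choice[i hi] : forall r, exists i, first_argmin (fun k => step_min r.+1 k (bm_path B w)) 0 r.+1 i.
  by move=> r; exact: first_argmin_exists.
have -> : (fun r => \sum_(j < r.+1) \1_(in_cell B r.+1 r.+1 0 j) w * shifted B r.+1 j w t) =
          (fun r => shifted B r.+1 (i r) w t).
  apply/funext => r.
  have iM : (i r < r.+1)%N by move/first_argminP: (hi r) => [/andP[]].
  rewrite (bigD1 (Ordinal iM))//= big1 ?addr0.
    by rewrite indicE mem_set ?mul1r//= /in_cell /= mul0n mul1n.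
  move=> j ji; rewrite indicE memNset ?mul0r// /in_cell /= mul0n mul1n => hj.
  by move/eqP: ji; apply; apply/val_inj => /=; exact: first_argmin_uniq hj (hi r).
exact: (shifted_cvg (M := fun r => r.+1)).
Qed.

(** The argmin grid is refined by [r.+1] with the integrand and the number [n] of cells fixed, so
    the bound is uniform in [r]. Path continuity gives convergence to the transform, and Fatou's
    lemma keeps the bound. *)
Lemma vervaat_exp_le (Psi : nat -> (R -> R) -> R) (N n K : nat) : N = (n * K)%N -> (0 < N)%N ->
  (forall l, (l < N)%N -> tame (T := T) (l%:R / N%:R) (Psi l)) ->
  (\int[P]_w (expR (exponent Psi N K (N - K) (vervaat (bm_path B w))))%:E <= n%:R%:E)%E.
Proof.
move=> NE N0 tPsi.
pose Psi' r l := Psi (l %/ r.+1)%N.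
pose M r := (N * r.+1)%N.
have M0 r : (0 < M r)%N by rewrite muln_gt0 N0.
have tPsi' r l : (l < M r)%N -> tame (T := T) (l%:R / (M r)%:R) (Psi' r l).
  move=> lM; apply: tame_le (tPsi _ _); last by rewrite ltn_divLR.
  rewrite ler_pdivrMr ?ltr0n// mulrAC ler_pdivlMr ?ltr0n// /M -!natrM ler_nat.
  by rewrite mulnCA mulnC leq_mul2r leq_divM orbT.
apply: (@integral_limit_le _ _ _ P
  (fun r w => grid_exp (Psi' r) (M r) (K * r.+1) (M r - K * r.+1) w)).
- move=> r; apply: measurable_sum => j; apply: measurable_funM => //.
    by apply: measurable_indic; apply: measurable_in_cell; lia.
  apply: measurableT_comp => //; apply: measurable_exponent (leq_subr _ _) (tPsi' r) _ => t _.
  exact: measurable_shifted.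
- by move=> r w; rewrite sumr_ge0// => j _; rewrite mulr_ge0// expR_ge0.
- move=> w.
  have /choice[i hi] : forall r, exists i, first_argmin (fun k => step_min (M r) k (bm_path B w)) 0 (M r) i.
    by move=> r; exact: first_argmin_exists.
  have iM r : (i r < M r)%N by move/first_argminP: (hi r) => [/andP[]].
  have -> : (fun r => grid_exp (Psi' r) (M r) (K * r.+1) (M r - K * r.+1) w) =
            (fun r => expR (exponent Psi N K (N - K) (shifted B (M r) (i r) w))).
    apply/funext => r; rewrite /grid_exp (bigD1 (Ordinal (iM r)))//= big1 ?addr0.
      rewrite indicE mem_set ?mul1r/=; last by rewrite /in_cell /= mul0n mul1n.
      by rewrite /M -mulnBl exponent_refine.
    move=> j ji; rewrite indicE memNset ?mul0r// /in_cell /= mul0n mul1n => hj.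
    by move/eqP: ji; apply; apply/val_inj => /=; exact: first_argmin_uniq hj (hi r).
  suff h : exponent Psi N K (N - K) (shifted B (M r) (i r) w) @[r --> \oo] -->
      exponent Psi N K (N - K) (vervaat (bm_path B w)).
    by apply: cvg_comp h _; exact: continuous_expR.
  apply: exponent_cvg (leq_subr _ _) tPsi _ => t t01.
  by apply: shifted_cvg => // r; rewrite /M leq_pmull.
- move=> r; apply: grid_exp_le (tPsi' r).
  by rewrite /M NE mulnA.
Qed.

End master_bound.

Lemma integral_probability_cst d (T : measurableType d) (R : realType)
  (P : probability T R) (c : R) : (\int[P]_w c%:E = c%:E)%E.
Proof.
rewrite (integral_cst P measurableT c%:E); transitivity (c%:E * 1)%E; last by rewrite mule1.
by congr (_ * _)%E; exact: probability_setT.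
Qed.

(** * Integrability of the supremum *)

Section geometric.
Context {R : realType}.

Lemma sum_geometric_le (q : R) (n : nat) : 0 <= q -> q < 1 ->
  \sum_(0 <= k < n) q ^+ k <= (1 - q)^-1.
Proof.
move=> q0 q1; have q10 : 0 < 1 - q by lra.
suff -> : \sum_(0 <= k < n) q ^+ k = (1 - q ^+ n) / (1 - q).
  by rewrite ler_pdivrMr// mulVf ?gt_eqF//; have := exprn_ge0 n q0; lra.
elim: n => [|n ih]; first by rewrite big_geq// expr0 subrr mul0r.
rewrite big_nat_recr//= ih exprS; field; lra.
Qed.

Lemma nneseries_geometric_lty (u : nat -> \bar R) (C q : R) : 0 <= q -> q < 1 ->
  (forall k, 0 <= u k)%E -> (forall k, u k <= (C * q ^+ k)%:E)%E ->
  (\sum_(0 <= k <oo) u k < +oo)%E.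
Proof.
move=> q0 q1 u0 uC.
have C0 : 0 <= C by have := le_trans (u0 0%N) (uC 0%N); rewrite lee_fin expr0 mulr1.
apply: (@le_lt_trans _ _ (C * (1 - q)^-1)%:E); last exact: ltry.
apply: lime_le; first by apply: is_cvg_nneseries => k _ _.
apply: nearW => n; apply: (@le_trans _ _ (\sum_(0 <= k < n) (C * q ^+ k)%:E)%E).
  by apply: lee_sum => k _; exact: uC.
by rewrite sumEFin lee_fin -mulr_sumr ler_wpM2l// sum_geometric_le.
Qed.

(** The tangent inequality for the exponential at [x - ln n]; it turns an exponential moment of size
    [n] into a first moment of size [ln n]. *)
Lemma le_ln_exp (n x : R) : 0 < n -> x <= ln n + expR x / n.
Proof.
move=> n0; have := expR_ge1Dx (x - ln n); rewrite expRD expRN lnK//; lra.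
Qed.

(** The ratio 3/2 is below 2, so that m * 2^-m is absorbed by a multiple of (3/4)^m in the sums over
    levels and shells. *)
Lemma natr_le_geometric (m : nat) : m%:R <= 2 * (3 / 2) ^+ m :> R.
Proof.
elim: m => [|m ih]; first by rewrite expr0; lra.
rewrite exprS -natr1; have [->|m0] := posnP m; first by rewrite expr0; lra.
have : (1 : R) <= m%:R by rewrite ler1n.
by case: m m0 ih => // -[|m] _ ih h; [rewrite expr1; lra|];
  have : (2 : R) <= m.+2%:R by [rewrite ler_nat|]; lra.
Qed.

End geometric.

Section chaining.
Context {R : realType}.
Variables (f : R -> R) (b : nat -> R).
Hypotheses (f0 : f 0 = 0) (cf : {within `[0, 1], continuous f}).
Hypothesis hb : forall m i, (i < 4 ^ m)%N ->
  `|f (i.+1%:R / (4 ^ m)%:R) - f (i%:R / (4 ^ m)%:R)| <= b m.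

Let b0 m : 0 <= b m.
Proof. by apply: le_trans (hb (i := 0) _); rewrite ?expn_gt0. Qed.

(** A point of level [m.+1] is at most three steps away from a point of level [m], namely the
    remainder modulo 4; hence the factor 3. *)
Lemma chaining_grid m i : (i <= 4 ^ m)%N ->
  `|f (i%:R / (4 ^ m)%:R)| <= \sum_(0 <= l < m.+1) 3 * b l.
Proof.
elim: m i => [|m ih] i.
  rewrite big_nat1 expn0 divr1 leq_eqVlt ltnS leqn0 => /orP[/eqP ->|/eqP ->]; last first.
    by rewrite f0 normr0 mulr_ge0.
  have := hb (ltnSn 0 : (0 < 4 ^ 0)%N); rewrite expn0 !divr1 f0 subr0.
  by have := b0 0; lra.
move=> iM; rewrite big_nat_recr//=.
have step p r : (p + r <= 4 ^ m.+1)%N ->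
    `|f ((p + r)%:R / (4 ^ m.+1)%:R) - f (p%:R / (4 ^ m.+1)%:R)| <= r%:R * b m.+1.
  elim: r => [|r ihr] prM; first by rewrite addn0 subrr normr0 mul0r.
  rewrite -(subrKA (f ((p + r)%:R / (4 ^ m.+1)%:R))) (le_trans (ler_normD _ _))//.
  rewrite -natr1 mulrDl mul1r addrC lerD//; first by apply: ihr; lia.
  by rewrite addnS; apply: hb; lia.
have p4 : (i %/ 4 <= 4 ^ m)%N.
  by rewrite -(leq_pmul2r (ltn0Sn 3)) (leq_trans (leq_divM _ _))// mulnC -expnS.
have E : (i %/ 4 * 4)%:R / (4 ^ m.+1)%:R = (i %/ 4)%:R / (4 ^ m)%:R :> R.
  by rewrite expnSr !natrM -mulf_div divff ?mulr1// pnatr_eq0.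
have := step (i %/ 4 * 4)%N (i %% 4)%N; rewrite -divn_eq => /(_ iM); rewrite E => h.
rewrite -(subrK (f ((i %/ 4)%:R / (4 ^ m)%:R)) (f (i%:R / _))) (le_trans (ler_normD _ _))//.
rewrite [leRHS]addrC lerD//; last exact: ih.
by rewrite (le_trans h)// ler_wpM2r// ler_nat -ltnS ltn_mod.
Qed.

Lemma chaining_bound (u : R) : 0 <= u <= 1 ->
  (`|f u|%:E <= \sum_(0 <= l <oo) (3 * b l)%:E)%E.
Proof.
move=> /andP[u0 u1].
set S := (\sum_(0 <= l <oo) _)%E.
have grid m i : (i <= 4 ^ m)%N -> (`|f (i%:R / (4 ^ m)%:R)|%:E <= S)%E.
  move=> iM; apply: (@le_trans _ _ (\sum_(0 <= l < m.+1) (3 * b l)%:E)%E).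
    by rewrite sumEFin lee_fin chaining_grid.
  by apply: nneseries_lim_ge => l _ _; rewrite lee_fin mulr_ge0.
apply/lee_addgt0Pr => e e0.
have cu : f (clamp u) = f u by rewrite clamp_id.
have /(_ u)/cvgrPdist_lt /(_ _ e0) /nbhs_ballP[r /= r0 hr] := continuous_clamp cf.
have [m mr] : exists m : nat, (4 ^ m)%:R^-1 < r :> R.
  have := near_infty_natSinv_lt (PosNum r0) => -[m _ /(_ m (leqnn _))] /= hm.
  exists m; apply: le_lt_trans hm; rewrite lef_pV2 ?posrE ?ltr0n ?expn_gt0//.
  by rewrite ler_nat ltn_expl.
have M0 : 0 < (4 ^ m)%:R :> R by rewrite ltr0n expn_gt0.
have uM0 : 0 <= u * (4 ^ m)%:R by rewrite mulr_ge0// ltW.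
have /andP[h1 h2] := truncn_itv uM0.
set i := Num.truncn _ in h1 h2.
have i4 : (i <= 4 ^ m)%N.
  by rewrite -(ler_nat R) (le_trans h1)// ger_pMl.
have iu : i%:R / (4 ^ m)%:R <= u by rewrite ler_pdivrMr.
have ui : u < i%:R / (4 ^ m)%:R + (4 ^ m)%:R^-1.
  by move: h2; rewrite -ltr_pdivlMr// -natr1 mulrDl mul1r.
have := hr (i%:R / (4 ^ m)%:R).
rewrite /= cu clamp_id; [|by rewrite divr_ge0|by rewrite (le_trans iu)].
rewrite /ball /= => /(_ _)/ltW h.
have {}h : `|f u - f (i%:R / (4 ^ m)%:R)| <= e.
  by apply: h; rewrite ger0_norm ?subr_ge0//; lra.
apply: (@le_trans _ _ (`|f (i%:R / (4 ^ m)%:R)|%:E + e%:E)%E).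
  rewrite -EFinD lee_fin -(subrK (f (i%:R / (4 ^ m)%:R)) (f u)).
  by rewrite (le_trans (ler_normD _ _))// addrC lerD.
by apply: leeD => //; exact: grid.
Qed.

End chaining.

Section supremum_integrable.
Context {d : measure_display} {T : measurableType d} {R : realType}.
Variables (P : probability T R) (B : R -> {RV P >-> R}).
Hypothesis hB : standard_brownian_motion B.

(** An increment over 4^-m has standard deviation 2^-m, so its multiple by 2^m is standard Gaussian.
    [le_ln_exp] with 4^m in place of n bounds the largest of the 4^m increments at the price ln 4^m,
    the sum of exponentials of both signs standing in for the maximum. *)
Let level_bound (m : nat) (w : T) : R :=
  2 ^- m * (ln (4 ^ m)%:R + (\sum_(i < 4 ^ m)
    (expR (2 ^+ m * increment B (i%:R / (4 ^ m)%:R) (i.+1%:R / (4 ^ m)%:R) w) +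
     expR (- 2 ^+ m * increment B (i%:R / (4 ^ m)%:R) (i.+1%:R / (4 ^ m)%:R) w))) / (4 ^ m)%:R).

Let level_increment m i w : (i < 4 ^ m)%N ->
  `|bm_path B w (i.+1%:R / (4 ^ m)%:R) - bm_path B w (i%:R / (4 ^ m)%:R)| <= level_bound m w.
Proof.
move=> i4; set y := _ - _.
have M0 : 0 < (4 ^ m)%:R :> R by rewrite ltr0n expn_gt0.
have p0 : 0 < 2 ^+ m :> R by rewrite exprn_gt0.
rewrite /level_bound mulrC ler_pdivlMr//.
apply: le_trans (le_ln_exp _ M0) _.
rewrite lerD2l ler_pM2r ?invr_gt0// (bigD1 (Ordinal i4))//= -/y.
rewrite -{1}(addr0 (expR _)) lerD//; last first.
  by rewrite sumr_ge0// => k _; rewrite addr_ge0// expR_ge0.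
rewrite mulrC -[X in expR X]/(2 ^+ m * `|y|) /increment -/(bm_path B w _) -/(bm_path B w _) -/y.
case: (ger0P y) => _; first by rewrite lerDl expR_ge0.
by rewrite mulrN mulNr lerDr expR_ge0.
Qed.

Let expR_increment m i (s : R) : (i < 4 ^ m)%N -> s ^+ 2 = (4 ^ m)%:R ->
  (\int[P]_w (expR (s * increment B (i%:R / (4 ^ m)%:R) (i.+1%:R / (4 ^ m)%:R) w))%:E
   = (expR (1 / 2))%:E)%E.
Proof.
move=> i4 s2.
have M0 : 0 < (4 ^ m)%:R :> R by rewrite ltr0n expn_gt0.
set a := i%:R / _; set b := i.+1%:R / _.
have ba : b - a = (4 ^ m)%:R^-1 by rewrite /a /b -mulrBl -natr1 addrC addKr mul1r.
have a0 : 0 <= a by rewrite divr_ge0.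
have b1 : b <= 1 by rewrite ler_pdivrMr// mul1r ler_nat.
have ab : a < b by rewrite -subr_gt0 ba invr_gt0.
have E : s ^+ 2 * (b - a) / 2 = 1 / 2 by rewrite ba s2 divff// gt_eqF.
have := @gaussian_increment_step _ _ _ P B hB a b (cst (expR (1 / 2))) (cst s) a0 ab b1.
move=> /(_ (@measurable_cst _ _ _ _ _ _) (@measurable_cst _ _ _ _ _ _) (fun=> expR_ge0 _)).
have -> : (\int[P]_w (cst (expR (1 / 2)) w)%:E = (expR (1 / 2))%:E)%E.
  exact: integral_probability_cst.
move=> <-; apply: eq_integral => w _.
by rewrite /= E -expRD; congr (expR _)%:E; ring.
Qed.

Let measurable_level m : measurable_fun setT (level_bound m).
Proof.
apply: measurable_funM => //; apply: measurable_funD => //; apply: measurable_funM => //.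
apply: measurable_sum => i; apply: measurable_funD; apply: measurableT_comp => //;
  by apply: measurable_funM => //; apply: measurable_funB.
Qed.

Let level_bound_ge0 m w : 0 <= level_bound m w.
Proof.
have h : (0 < 4 ^ m)%N by rewrite expn_gt0.
exact: le_trans (normr_ge0 _) (level_increment w h).
Qed.

(** The expectation is 2^-m * (ln 4^m + 2 exp (1/2)). With ln 4 <= 3 and exp (1/2) <= 2 this is at
    most 2^-m * (3 m + 4), and [natr_le_geometric] gives 6 + 4 = 10. *)
Let integral_level m :
  (\int[P]_w (level_bound m w)%:E <= (10 * (3 / 4) ^+ m)%:E)%E.
Proof.
have M0 : 0 < (4 ^ m)%:R :> R by rewrite ltr0n expn_gt0.
have e1 : expR (1 / 2) <= 2 :> R.
  rewrite -[X in expR X]opprK expRN invf_ple ?posrE ?expR_gt0//.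
  by have := expR_ge1Dx (- (1 / 2) : R); lra.
have l4 : ln (4 ^ m)%:R <= 3 * m%:R :> R.
  rewrite natrX lnXn// -(mulr_natr (ln 4)) ler_wpM2r//.
  by have := expR_ge1Dx (ln 4 : R); rewrite lnK ?posrE//; lra.
have l0 : 0 <= ln (4 ^ m)%:R :> R by rewrite ln_ge0// ler1n expn_gt0.
pose c : R := 2 ^- m / (4 ^ m)%:R.
have c0 : 0 <= c by rewrite divr_ge0// invr_ge0 exprn_ge0.
pose e (s : R) (i : nat) w :=
  expR (s * increment B (i%:R / (4 ^ m)%:R) (i.+1%:R / (4 ^ m)%:R) w).
have me s i : measurable_fun setT (fun w => (e s i w)%:E).
  apply/measurable_EFinP; apply: measurableT_comp => //.
  by apply: measurable_funM => //; apply: measurable_funB.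
have e0 s i w : (0 <= (e s i w)%:E)%E by rewrite lee_fin expR_ge0.
have ee0 i w : (0 <= (e (2 ^+ m) i w)%:E + (e (- 2 ^+ m) i w)%:E)%E by exact: adde_ge0.
have cee0 i w : (0 <= c%:E * ((e (2 ^+ m) i w)%:E + (e (- 2 ^+ m) i w)%:E))%E.
  by apply: mule_ge0 => //; rewrite lee_fin.
rewrite (_ : \int[P]_w _ = \int[P]_w ((2 ^- m * ln (4 ^ m)%:R)%:E +
    \sum_(i < 4 ^ m) (c%:E * ((e (2 ^+ m) i w)%:E + (e (- 2 ^+ m) i w)%:E))))%E; last first.
  apply: eq_integral => w _; rewrite /level_bound mulrDr EFinD; congr (_ + _)%E.
  by rewrite (mulrC (\sum_(_ < _) _)) mulrA mulr_sumr -sumEFin.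
rewrite ge0_integralD//; first last.
- by apply: emeasurable_sum => i; apply: emeasurable_funM => //; apply: emeasurable_funD.
- by move=> w _; rewrite sume_ge0.
- by move=> w _; rewrite lee_fin mulr_ge0// invr_ge0 exprn_ge0.
rewrite integral_probability_cst ge0_integral_sum//; last first.
  by move=> i; apply: emeasurable_funM => //; apply: emeasurable_funD.
have s2 : (2 ^+ m : R) ^+ 2 = (4 ^ m)%:R by rewrite -exprM mulnC exprM natrX; congr (_ ^+ _); lra.
under eq_bigr => i _.
  rewrite ge0_integralZl//; last exact: emeasurable_funD.
  rewrite ge0_integralD// !expR_increment ?sqrrN//.
  over.
rewrite -EFinD -EFinM sumEFin sumr_const card_ord -EFinD.
rewrite lee_fin -(mulr_natr (c * _)) /c mulrAC divfK ?gt_eqF//.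
have -> : (3 / 4) ^+ m = 2 ^- m * (3 / 2) ^+ m :> R.
  by rewrite -exprVn -exprMn; congr (_ ^+ _); field.
have m0 : 0 < 2 ^- m :> R by rewrite invr_gt0 exprn_gt0.
have g1 : 1 <= (3 / 2) ^+ m :> R by rewrite exprn_ege1//; lra.
have := natr_le_geometric (R := R) m => h.
rewrite -[leRHS]mulrCA (_ : _ + _ = 2 ^- m * (ln (4 ^ m)%:R + 2 * expR (1 / 2))); last by ring.
by rewrite ler_pM2l//; lra.
Qed.

Lemma motion_dominated : exists2 g : T -> \bar R, P.-integrable setT g &
  forall w u, 0 <= u <= 1 -> (`|bm_path B w u|%:E <= g w)%E.
Proof.
pose g w := (\sum_(0 <= l <oo) (3 * level_bound l w)%:E)%E.
exists g; last first.
  move=> w u u01; apply: (@chaining_bound _ (bm_path B w) (level_bound^~ w)) => //.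
  - exact: (bm_start hB).
  - exact: (bm_continuous hB).
  - by move=> m i; exact: level_increment.
have mg k : measurable_fun setT (fun w => (3 * level_bound k w)%:E).
  by apply/measurable_EFinP; apply: measurable_funM.
have g0 k w : (0 <= (3 * level_bound k w)%:E)%E by rewrite lee_fin mulr_ge0.
apply/integrableP; split.
  by apply: ge0_emeasurable_sum => // k w _ _; exact: g0.
under eq_integral => w _ do rewrite gee0_abs ?nneseries_ge0//.
rewrite integral_nneseries//.
apply: (@nneseries_geometric_lty _ _ 30 (3 / 4)); [lra|lra| |].
  by move=> k; apply: integral_ge0 => w _; exact: g0.
move=> k; under eq_integral do rewrite EFinM.
rewrite ge0_integralZl//; [|exact/measurable_EFinP|by move=> w _; rewrite lee_fin].
rewrite (_ : 30 * _ = 3 * (10 * (3 / 4) ^+ k)); last by ring.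
by rewrite EFinM; apply: lee_wpmul2l; [rewrite lee_fin|exact: integral_level].
Qed.

Lemma vervaat_dominated : exists2 g : T -> \bar R, P.-integrable setT g &
  forall w t, 0 <= t <= 1 -> (`|vervaat (bm_path B w) t|%:E <= g w)%E.
Proof.
have [g ig hg] := motion_dominated.
(* A cyclic shift combines four values of the path at clamped times. *)
exists (fun w => (4%:E * g w)%E); first exact: integrableZl.
move=> w t t01.
have cB : {within `[0, 1], continuous (bm_path B w)} by exact: (bm_continuous hB).
rewrite vervaat_shift ?argmin_time_itv//; last exact: (bm_start hB).
rewrite /cyc_shift /ext.
have h u : (`|bm_path B w (clamp u)|%:E <= g w)%E by apply: hg; exact: clamp_itv.
case: (g w) h => [x|h|h]; last 2 first.
- by rewrite gt0_muley ?lte_fin// leey.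
- by have := h 0; rewrite leeNy_eq.
rewrite -EFinM => h.
have {}h u : `|bm_path B w (clamp u)| <= x by rewrite -lee_fin.
rewrite lee_fin.
set s := argmin_time _.
have := h (s + t); have := h (s + t - 1); have := h s; have := h (s - 1).
rewrite !ler_norml; lra.
Qed.

End supremum_integrable.

(** * Energy bound for simple integrands *)

Section expectation.
Context {d : measure_display} {T : measurableType d} {R : realType}.
Variable P : probability T R.
Implicit Types (f g : T -> R).

Definition has_expect f := P.-integrable setT (EFin \o f).
Definition expect f : R := \int[P]_w f w.

Lemma has_expect_measurable f : has_expect f -> measurable_fun setT f.
Proof. by move=> /measurable_int/measurable_EFinP. Qed.

Lemma has_expect_le f g : measurable_fun setT f -> has_expect g ->
  (forall w, `|f w| <= `|g w|) -> has_expect f.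
Proof.
move=> mf ig fg; apply: le_integrable ig => //; first exact/measurable_EFinP.
by move=> w _; rewrite /= lee_fin.
Qed.

Lemma has_expect_cst c : has_expect (fun=> c).
Proof. exact: finite_measure_integrable_cst. Qed.

Lemma has_expectD f g : has_expect f -> has_expect g -> has_expect (fun w => f w + g w).
Proof. by move=> hf hg; have := integrableD measurableT hf hg. Qed.

Lemma has_expectB f g : has_expect f -> has_expect g -> has_expect (fun w => f w - g w).
Proof. by move=> hf hg; have := integrableB measurableT hf hg. Qed.

Lemma has_expectZ c f : has_expect f -> has_expect (fun w => c * f w).
Proof. by move=> hf; have := integrableZl measurableT c hf. Qed.

Lemma has_expect_norm f : has_expect f -> has_expect (fun w => `|f w|).
Proof. by move=> hf; have := integrable_abse hf. Qed.

Lemma has_expectM f g c : measurable_fun setT f -> (forall w, `|f w| <= c) ->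
  has_expect g -> has_expect (fun w => f w * g w).
Proof.
move=> mf fc hg.
apply: (@has_expect_le _ (fun w => c * g w)); [|exact: has_expectZ|].
  by apply: measurable_funM => //; exact: has_expect_measurable.
by move=> w; rewrite !normrM ler_wpM2r// (le_trans (fc w))// ler_norm.
Qed.

Lemma has_expect_sum (K L : nat) (F : nat -> T -> R) :
  (forall i, (K <= i < L)%N -> has_expect (F i)) ->
  has_expect (fun w => \sum_(K <= i < L) F i w).
Proof.
elim: L => [|L ih] hF.
  by under eq_fun do rewrite big_geq//; exact: has_expect_cst.
have [KL|LK] := leqP K L; last first.
  by under eq_fun do rewrite big_geq//; exact: has_expect_cst.
under eq_fun do rewrite big_nat_recr//=.
apply: has_expectD; last by apply: hF; lia.
by apply: ih => i Ki; apply: hF; lia.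
Qed.

Lemma expectD f g : has_expect f -> has_expect g ->
  expect (fun w => f w + g w) = expect f + expect g.
Proof. by move=> hf hg; exact: RintegralD. Qed.

Lemma expectB f g : has_expect f -> has_expect g ->
  expect (fun w => f w - g w) = expect f - expect g.
Proof. by move=> hf hg; exact: RintegralB. Qed.

Lemma expectZ c f : has_expect f -> expect (fun w => c * f w) = c * expect f.
Proof. by move=> hf; exact: RintegralZl. Qed.

Lemma expect_cst c : expect (fun=> c) = c.
Proof. by rewrite /expect /Rintegral integral_probability_cst. Qed.

Lemma expect_sum (K L : nat) (F : nat -> T -> R) :
  (forall i, (K <= i < L)%N -> has_expect (F i)) ->
  expect (fun w => \sum_(K <= i < L) F i w) = \sum_(K <= i < L) expect (F i).
Proof.
elim: L => [|L ih] hF.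
  by under eq_fun do rewrite big_geq//; rewrite big_geq// expect_cst.
have [KL|LK] := leqP K L; last first.
  by under eq_fun do rewrite big_geq//; rewrite big_geq// expect_cst.
under eq_fun do rewrite big_nat_recr//=.
rewrite big_nat_recr//= expectD.
- by rewrite ih// => i Ki; apply: hF; lia.
- by apply: has_expect_sum => i Ki; apply: hF; lia.
- by apply: hF; lia.
Qed.

Lemma expect_le f g : has_expect f -> has_expect g -> (forall w, f w <= g w) ->
  expect f <= expect g.
Proof. by move=> hf hg fg; apply: le_Rintegral. Qed.

Lemma expect_ge0 f : (forall w, 0 <= f w) -> 0 <= expect f.
Proof. by move=> f0; apply: Rintegral_ge0. Qed.

Lemma expect_EFin f : has_expect f -> (expect f)%:E = (\int[P]_w (f w)%:E)%E.
Proof. by move=> hf; rewrite fineK//; exact: integrable_fin_num. Qed.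

(* Jensen's inequality for the exponential, from y <= ln n + exp y / n - 1. *)
Lemma expect_le_ln f (n : nat) : (0 < n)%N -> has_expect f ->
  (\int[P]_w (expR (f w))%:E <= n%:R%:E)%E -> expect f <= ln n%:R.
Proof.
move=> n0 hf hexp.
have nR : 0 < n%:R :> R by rewrite ltr0n.
have mexp : measurable_fun setT (fun w => expR (f w)).
  by apply: measurableT_comp => //; exact: has_expect_measurable.
have sexp : has_expect (fun w => expR (f w)).
  apply/integrableP; split; first exact/measurable_EFinP.
  under eq_integral => w _ do rewrite /= ger0_norm ?expR_ge0//.
  by rewrite (le_lt_trans hexp)// ltry.
have le w : f w <= (ln n%:R - 1) + n%:R^-1 * expR (f w).
  have := expR_ge1Dx (f w - ln n%:R); rewrite expRD expRN lnK ?posrE//; lra.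
apply: (le_trans (expect_le hf _ le)).
  by apply: has_expectD; [exact: has_expect_cst|exact: has_expectZ].
rewrite expectD ?expect_cst ?expectZ//; [|exact: has_expect_cst|exact: has_expectZ].
have : expect (fun w => expR (f w)) <= n%:R by rewrite -lee_fin expect_EFin.
move=> h; rewrite -lerBrDl opprB addrC subrK mulrC ler_pdivrMr// mul1r.
by [].
Qed.

End expectation.

(** * Simple integrals on grids of mesh 4^-m *)

Section simple_integral.
Context {R : realType}.
Implicit Types (h g : nat -> R) (x : R -> R).

(** Powers of 4 suit the square root in the clock: the time scale 4^-p has square root 2^-p. *)
Definition grid (m i : nat) : R := i%:R / (4 ^ m)%:R.

(* Integral of the step function with value h i on ]grid m i, grid m i.+1]
   against the path x. *)
Definition stint (m : nat) h (x : R -> R) : R :=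
  \sum_(0 <= i < 4 ^ m) h i * (x (grid m i.+1) - x (grid m i)).

Lemma grid_scale m k i : grid (m + k) (i * 4 ^ k) = grid m i.
Proof.
by rewrite /grid expnD !natrM -mulf_div divff ?mulr1// pnatr_eq0 -lt0n expn_gt0.
Qed.

Lemma grid_itv m i : (i <= 4 ^ m)%N -> (0 <= grid m i) && (grid m i <= 1).
Proof. exact: unit_frac. Qed.

Lemma grid_le m i j : (i <= j)%N -> grid m i <= grid m j.
Proof. by move=> ij; rewrite ler_pM2r ?ler_nat// invr_gt0 ltr0n expn_gt0. Qed.

Lemma stint_refine m k h x : stint (m + k) (fun i => h (i %/ 4 ^ k)%N) x = stint m h x.
Proof.
rewrite /stint expnD -[in LHS](mul0n (4 ^ k)%N).
rewrite (sum_blocks h (fun i => x (grid (m + k) i)))// ?expn_gt0//.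
by apply: eq_bigr => i _; rewrite !grid_scale.
Qed.

Lemma stint_refine' m k h x : stint (k + m) (fun i => h (i %/ 4 ^ k)%N) x = stint m h x.
Proof. by rewrite addnC stint_refine. Qed.

Lemma stint_lin m (a b : R) h g x :
  stint m (fun i => a * h i + b * g i) x = a * stint m h x + b * stint m g x.
Proof.
by rewrite /stint !mulr_sumr -big_split; apply: eq_bigr => i _ /=; ring.
Qed.

Lemma stint_le m h g (x : R -> R) :
  (forall s t, 0 <= s -> s <= t -> t <= 1 -> x s <= x t) ->
  (forall i, (i < 4 ^ m)%N -> h i <= g i) -> stint m h x <= stint m g x.
Proof.
move=> nx hg; rewrite /stint big_nat [leRHS]big_nat; apply: ler_sum => i /andP[_ im].
rewrite ler_wpM2r ?hg// subr_ge0 nx//.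
- by case/andP: (grid_itv (ltnW im)).
- exact: grid_le.
- by case/andP: (grid_itv im).
Qed.

Lemma stint_cst m c x : stint m (fun=> c) x = c * (x 1 - x 0).
Proof.
by rewrite /stint -mulr_sumr telescope_sumr// /grid divff ?mul0r.
Qed.

Lemma stint_norm m h x : (forall s t, 0 <= s -> s <= t -> t <= 1 -> x s <= x t) ->
  `|stint m h x| <= stint m (fun i => `|h i|) x.
Proof.
move=> nx; rewrite /stint (le_trans (ler_norm_sum _ _ _))// big_nat [leRHS]big_nat.
apply: ler_sum => i /andP[_ im]; rewrite normrM ler_wpM2l// ger0_norm// subr_ge0 nx//.
- by case/andP: (grid_itv (ltnW im)).
- exact: grid_le.
- by case/andP: (grid_itv im).
Qed.

End simple_integral.

Section clock.
Context {R : realType}.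

(* The clock runs infinitely fast at 0 and at 1: on the time scale 4^-p from
   either end its speed is at least 2^p / 2. *)
Definition clock (t : R) : R := Num.sqrt t + 1 - Num.sqrt (1 - t).

Lemma clock0 : clock 0 = 0.
Proof. by rewrite /clock sqrtr0 subr0 sqrtr1; ring. Qed.

Lemma clock1 : clock 1 = 2.
Proof. by rewrite /clock subrr sqrtr0 sqrtr1; ring. Qed.

Lemma clock_le (s t : R) : s <= t -> clock s <= clock t.
Proof.
move=> st; rewrite /clock; have := ler_wsqrtr st.
have : 1 - t <= 1 - s by lra.
by move=> /ler_wsqrtr; lra.
Qed.

Lemma continuous_clock : continuous clock.
Proof.
move=> t; apply: cvgB.
  by apply: cvgD; [exact: sqrt_continuous|exact: cvg_cst].
have h : (1 - s : R) @[s --> t] --> 1 - t by apply: cvgB; [exact: cvg_cst|exact: cvg_id].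
exact: (cvg_comp _ _ h (@sqrt_continuous _ _)).
Qed.

(** The increment t - s factors through the square roots, whose sum is at most 2 * 2^-p on this
    scale. *)
Lemma sqrt_speed (p : nat) (s t : R) : 0 <= s -> s <= t -> t <= 4 ^- p ->
  2 ^+ p / 2 * (t - s) <= Num.sqrt t - Num.sqrt s.
Proof.
move=> s0 st tp.
have p2 : 0 < 2 ^+ p :> R by rewrite exprn_gt0.
have t0 : 0 <= t by lra.
have E : t - s = (Num.sqrt t - Num.sqrt s) * (Num.sqrt t + Num.sqrt s).
  by rewrite -{1}(sqr_sqrtr t0) -{1}(sqr_sqrtr s0); ring.
have d0 : 0 <= Num.sqrt t - Num.sqrt s by rewrite subr_ge0 ler_wsqrtr.
have h : Num.sqrt t <= (2 ^+ p)^-1.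
  have -> : (2 ^+ p)^-1 = Num.sqrt (4 ^- p) :> R.
    rewrite (_ : 4 ^- p = (2 ^+ p)^-1 ^+ 2 :> R); last first.
      by rewrite exprVn -exprM mulnC exprM; congr (_ ^+ _)^-1; lra.
    by rewrite sqrtr_sqr ger0_norm// invr_ge0 ltW.
  exact: ler_wsqrtr.
have h' : Num.sqrt s <= (2 ^+ p)^-1 by apply: le_trans h; exact: ler_wsqrtr.
rewrite E mulrCA ler_piMr// mulrAC ler_pdivrMr// mul1r.
rewrite -ler_pdivlMl//; lra.
Qed.

Lemma clock_speed (p : nat) (s t : R) : 0 <= s -> s <= t -> t <= 1 ->
  t <= 4 ^- p \/ 1 - 4 ^- p <= s -> 2 ^+ p / 2 * (t - s) <= clock t - clock s.
Proof.
move=> s0 st t1 [tp|sp].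
  have := sqrt_speed s0 st tp; rewrite /clock.
  have : Num.sqrt (1 - t) <= Num.sqrt (1 - s) by apply: ler_wsqrtr; lra.
  lra.
have h : 2 ^+ p / 2 * ((1 - s) - (1 - t)) <= Num.sqrt (1 - s) - Num.sqrt (1 - t).
  by apply: sqrt_speed; lra.
rewrite (_ : 1 - s - (1 - t) = t - s) in h; last by ring.
by have := ler_wsqrtr st; rewrite /clock; lra.
Qed.

End clock.

(** * Riesz representation by a minimizing sequence *)

Section minimizing_sequence.
Context {R : realType} {W : Type}.
Variables (lin : R -> W -> R -> W -> W) (q l : W -> R) (b : W -> W -> R) (C : R) (w0 : W).
Hypothesis l_lin : forall s x t y, l (lin s x t y) = s * l x + t * l y.
Hypothesis q_lin : forall s x t y,
  q (lin s x t y) = s ^+ 2 * q x + 2 * s * t * b x y + t ^+ 2 * q y.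
Hypothesis q_ge0 : forall x, 0 <= q x.
Hypothesis l_le : forall x, l x <= C + q x.

(* Riesz representation of l without completeness: the minimizing sequence of
   q - l is Cauchy for q and represents l / 2 in the limit. *)
Lemma minimizing_sequence : exists x : nat -> W,
  (forall k, q (lin 1 (x k.+1) (-1) (x k)) <= 16 ^- k) /\
  (forall k y, `|2 * b (x k) y - l y| <= 4 ^- k * (1 + q y)).
Proof.
pose J x := q x - l x.
have hJ : has_inf (range J).
  split; first by exists (J w0), w0.
  by exists (- C) => _ [x _ <-]; have := l_le x; rewrite /J; lra.
pose I := inf (range J).
have IJ x : I <= J x by apply: ge_inf; [case: hJ|exists x].
have e0 k : 0 < 16 ^- k.+1 :> R by rewrite invr_gt0 exprn_gt0.
have /choice[x hx] : forall k, exists x, J x < I + 16 ^- k.+1.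
  by move=> k; have [_ [y _ <-] h] := inf_adherent (e0 k) hJ; exists y.
exists x; split => [k|k y].
  (* Parallelogram identity at the midpoint: [q] of the difference is at most twice the sum of the
     two excesses over the infimum, that is 2 * (16^-(k+1) + 16^-(k+2)), below 16^-k. *)
  have := IJ (lin 2^-1 (x k.+1) 2^-1 (x k)).
  have := hx k; have := hx k.+1.
  rewrite /J !q_lin !l_lin.
  have -> : 16 ^- k.+2 = 16 ^- k / 256 :> R by rewrite !exprS !invfM; field; rewrite expf_neq0.
  have -> : 16 ^- k.+1 = 16 ^- k / 16 :> R by rewrite !exprS !invfM; field; rewrite expf_neq0.
  have : 0 < 16 ^- k :> R by rewrite invr_gt0 exprn_gt0.
  lra.
have d0 : 0 < 4 ^- k.+1 :> R by rewrite invr_gt0 exprn_gt0.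
have E : 16 ^- k.+1 = 4 ^- k.+1 * 4 ^- k.+1 :> R.
  by rewrite -invfM -exprMn; congr (_ ^+ _)^-1; lra.
have := hx k; rewrite E.
(* Near-stationarity: a move by e y or -e y with e = 4^-(k+1) cannot go below the infimum, while the
   excess of [x k] is less than e^2. Dividing by e bounds the derivative by e * (1 + q y). *)
have := IJ (lin 1 (x k) (4 ^- k.+1) y); have := IJ (lin 1 (x k) (- 4 ^- k.+1) y).
rewrite /J !q_lin !l_lin sqrrN.
have E4 : 4 ^- k = 4 * 4 ^- k.+1 :> R by rewrite exprS invfM mulrA divff// mul1r.
rewrite E4; set e := 4 ^- k.+1 in d0 *.
move=> h1 h2 h3; rewrite ler_norml; have q0 := q_ge0 y.
have eq0 : 0 <= e * (1 + q y) by rewrite mulr_ge0//; lra.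
have g1 : e * - (2 * b (x k) y - l y) <= e * (e * (1 + q y)) by nra.
have g2 : e * (2 * b (x k) y - l y) <= e * (e * (1 + q y)) by nra.
rewrite !ler_pM2l// in g1 g2.
apply/andP; split; lra.
Qed.

End minimizing_sequence.

Section simple_processes.
Context {d : measure_display} {T : measurableType d} {R : realType}.

(* Simple predictable integrands: the value on ]grid m i, grid m i.+1] is a
   tame functional of the path up to grid m i; they vanish near 0 and 1. *)
Record simple := Simple {
  level : nat ;
  value : nat -> (R -> R) -> R ;
  value_tame : forall i, (i < 4 ^ level)%N -> tame (T := T) (grid level i) (value i) ;
  value_ends : forall i f, i = 0%N \/ i.+1 = (4 ^ level)%N -> value i f = 0 }.

Lemma tameZ t (c : R) Psi : tame (T := T) t Psi -> tame (T := T) t (fun f => c * Psi f).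
Proof. by move=> h; apply: tameM => //; exact: tame_cst. Qed.

Lemma tame_refine m k (h : nat -> (R -> R) -> R) :
  (forall i, (i < 4 ^ m)%N -> tame (T := T) (grid m i) (h i)) ->
  forall i, (i < 4 ^ (m + k))%N -> tame (T := T) (grid (m + k) i) (h (i %/ 4 ^ k)%N).
Proof.
move=> th i im; apply: tame_le (th _ _).
  by rewrite -(grid_scale m k); apply: grid_le; exact: leq_divM.
by rewrite ltn_divLR ?expn_gt0// -expnD.
Qed.

Lemma lin_tame (a b : R) (H G : simple) (i : nat) : (i < 4 ^ (level H + level G))%N ->
  tame (T := T) (grid (level H + level G) i)
    (fun f => a * value H (i %/ 4 ^ level G)%N f + b * value G (i %/ 4 ^ level H)%N f).
Proof.
move=> im; apply: tameD; apply: tameZ.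
  exact: (tame_refine (@value_tame H)).
rewrite addnC in im *; exact: (tame_refine (@value_tame G)).
Qed.

Lemma ends_refine (m k i : nat) : i = 0%N \/ i.+1 = (4 ^ (m + k))%N ->
  (i %/ 4 ^ k)%N = 0%N \/ (i %/ 4 ^ k)%N.+1 = (4 ^ m)%N.
Proof.
case=> [->|ii]; first by left; rewrite div0n.
right; have k0 : (0 < 4 ^ k)%N by rewrite expn_gt0.
apply/eqP; rewrite eqn_leq; apply/andP; split.
  by rewrite ltn_divLR// -expnD -ii.
by rewrite -(leq_pmul2r k0) -expnD -ii ltn_ceil.
Qed.

Lemma lin_ends (a b : R) (H G : simple) (i : nat) (f : R -> R) :
  i = 0%N \/ i.+1 = (4 ^ (level H + level G))%N ->
  a * value H (i %/ 4 ^ level G)%N f + b * value G (i %/ 4 ^ level H)%N f = 0.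
Proof.
move=> hi; rewrite (value_ends _ (ends_refine hi)).
by rewrite addnC in hi; rewrite (value_ends _ (ends_refine hi)) !mulr0 addr0.
Qed.

(** Both summands are carried to the grid of level [level H + level G], so vector space laws hold
    only after integration. This is why [minimizing_sequence] takes an abstract combination and asks
    for identities of [l] and [q] alone. *)
Definition lin (a : R) (H : simple) (b : R) (G : simple) : simple :=
  Simple (@lin_tame a b H G) (@lin_ends a b H G).

Lemma simple0_tame i : (i < 4 ^ 0)%N -> tame (T := T) (grid 0 i) (fun=> 0 : R).
Proof. by move=> _; exact: tame_cst. Qed.

Definition simple0 : simple := @Simple 0 (fun _ _ => 0) simple0_tame (fun _ _ _ => erefl).

Definition sint (H : simple) (f x : R -> R) : R :=
  stint (level H) (fun i => value H i f) x.

Definition sint_sq (H : simple) (f x : R -> R) : R :=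
  stint (level H) (fun i => value H i f ^+ 2) x.

Definition sint_mul (H G : simple) (f x : R -> R) : R :=
  stint (level H + level G)
    (fun i => value H (i %/ 4 ^ level G)%N f * value G (i %/ 4 ^ level H)%N f) x.

Lemma sint_lin a H b G f x :
  sint (lin a H b G) f x = a * sint H f x + b * sint G f x.
Proof.
rewrite /sint /= stint_lin; congr (_ * _ + _ * _).
  exact: (stint_refine _ _ (fun i => value H i f)).
exact: (stint_refine' _ _ (fun i => value G i f)).
Qed.

Lemma sint_sq_lin a H b G f x : sint_sq (lin a H b G) f x =
  a ^+ 2 * sint_sq H f x + 2 * a * b * sint_mul H G f x + b ^+ 2 * sint_sq G f x.
Proof.
rewrite /sint_sq /sint_mul.
rewrite -(stint_refine (level H) (level G) (fun i => value H i f ^+ 2)).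
rewrite -(stint_refine' (level G) (level H) (fun i => value G i f ^+ 2)).
rewrite /stint /= !mulr_sumr -!big_split/=.
by apply: eq_bigr => i _; ring.
Qed.

End simple_processes.
Arguments simple {d} T R.
Arguments simple0 {d} T R.

Section energy_bound.
Context {d : measure_display} {T : measurableType d} {R : realType}.
Variables (P : probability T R) (B : R -> {RV P >-> R}).
Hypothesis hB : standard_brownian_motion B.

Definition vpath (w : T) : R -> R := vervaat (bm_path B w).

Lemma measurable_vpath t : 0 <= t <= 1 -> measurable_fun setT (fun w => vpath w t).
Proof. exact: measurable_vervaat. Qed.

Lemma has_expect_vpath t : 0 <= t <= 1 -> has_expect P (fun w => vpath w t).
Proof.
move=> t01; have [g ig hg] := vervaat_dominated hB.
apply: le_integrable ig => //; first by apply/measurable_EFinP; exact: measurable_vpath.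
by move=> w _; rewrite /= (le_trans (hg w t t01))// lee_abs.
Qed.

Lemma measurable_value (H : simple T R) i : (i < 4 ^ level H)%N ->
  measurable_fun setT (fun w => value H i (vpath w)).
Proof.
move=> im; apply: (tame_measurableT (value_tame im) (X := fun t w => vpath w t)).
move=> s /andP[s0 sg]; apply: measurable_vpath; rewrite s0 (le_trans sg)//.
by case/andP: (grid_itv (R := R) (ltnW im)).
Qed.

Lemma value_bounded (H : simple T R) i : (i < 4 ^ level H)%N ->
  exists c, forall f, `|value H i f| <= c.
Proof. by move=> /(@value_tame _ _ _ H)/tame_bounded. Qed.

Lemma has_expect_vpath_increment m i : (i < 4 ^ m)%N ->
  has_expect P (fun w => vpath w (grid m i.+1) - vpath w (grid m i)).
Proof.
by move=> im; apply: has_expectB; apply: has_expect_vpath; apply: grid_itv => //; exact: ltnW.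
Qed.

Lemma has_expect_sint (H : simple T R) : has_expect P (fun w => sint H (vpath w) (vpath w)).
Proof.
apply: has_expect_sum => i /andP[_ im]; have [c hc] := value_bounded im.
by apply: (has_expectM (c := c)) (measurable_value im) _ (has_expect_vpath_increment im).
Qed.

Lemma has_expect_stint m (h : nat -> T -> R) (x : R -> R) :
  (forall i, (i < 4 ^ m)%N -> measurable_fun setT (h i)) ->
  (forall i, (i < 4 ^ m)%N -> exists c, forall w, `|h i w| <= c) ->
  has_expect P (fun w => stint m (fun i => h i w) x).
Proof.
move=> mh bh; apply: has_expect_sum => i /andP[_ im]; have [c hc] := bh i im.
by apply: (has_expectM (c := c)) (mh i im) hc (has_expect_cst P _).
Qed.

Lemma has_expect_sint_sq (H : simple T R) x : has_expect P (fun w => sint_sq H (vpath w) x).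
Proof.
apply: (has_expect_stint (h := fun i w => value H i (vpath w) ^+ 2)) => i im.
  by apply: measurable_funX; exact: measurable_value.
have [c hc] := value_bounded im; exists (c ^+ 2) => w.
by rewrite normrX lerXn2r ?nnegrE// (le_trans _ (hc (vpath w))).
Qed.

Lemma refine_lt m k i : (i < 4 ^ (m + k))%N -> (i %/ 4 ^ k < 4 ^ m)%N.
Proof. by move=> im; rewrite ltn_divLR ?expn_gt0// -expnD. Qed.

Lemma has_expect_sint_mul (H G : simple T R) x : has_expect P (fun w => sint_mul H G (vpath w) x).
Proof.
apply: (has_expect_stint (h := fun i w => value H (i %/ 4 ^ level G)%N (vpath w) *
    value G (i %/ 4 ^ level H)%N (vpath w))) => i im;
  have iH := refine_lt im; rewrite addnC in im; have iG := refine_lt im.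
  by apply: measurable_funM; exact: measurable_value.
have [c hc] := value_bounded iH; have [c' hc'] := value_bounded iG.
by exists (c * c') => w; rewrite normrM ler_pM.
Qed.

Definition linear_form (H : simple T R) : R := expect P (fun w => sint H (vpath w) (vpath w)).

Definition energy (H : simple T R) : R := expect P (fun w => sint_sq H (vpath w) clock).

Definition energy_form (H G : simple T R) : R :=
  expect P (fun w => sint_mul H G (vpath w) clock).

Lemma linear_form_lin a H b G :
  linear_form (lin a H b G) = a * linear_form H + b * linear_form G.
Proof.
rewrite /linear_form; under eq_fun do rewrite sint_lin.
by rewrite expectD ?expectZ//; try apply: has_expectZ; exact: has_expect_sint.
Qed.

Lemma energy_lin a H b G : energy (lin a H b G) =
  a ^+ 2 * energy H + 2 * a * b * energy_form H G + b ^+ 2 * energy G.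
Proof.
rewrite /energy /energy_form; under eq_fun do rewrite sint_sq_lin.
have h1 := has_expect_sint_sq H clock; have h2 := has_expect_sint_sq G clock.
have h3 := has_expect_sint_mul H G clock.
by rewrite !expectD ?expectZ//; do ?[apply: has_expectD|apply: has_expectZ].
Qed.

Lemma energy_ge0 H : 0 <= energy H.
Proof.
apply: expect_ge0 => w; rewrite /sint_sq /stint sumr_ge0// => i _.
rewrite mulr_ge0 ?sqr_ge0// subr_ge0; apply: clock_le; exact: grid_le.
Qed.

(* Indices of the cells of ]4^-p, 1 - 4^-p]. *)
Let inner (m p i : nat) : bool := (4 ^ (m - p) <= i < 4 ^ m - 4 ^ (m - p))%N.

(** The integrand is 2^p times [H] on the cells of ]4^-(p+1), 1 - 4^-(p+1)] outside ]4^-p, 1 -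
    4^-p], with 4^(p+1) cells for the argmin. Dividing the exponent by 2^p leaves the price 2^-p *
    ln 4^(p+1) and a quadratic term of weight 2^p/2, which the clock dominates on that shell. *)
Let shell_exponent (H : simple T R) p (x : R -> R) : R :=
  exponent (fun i f => 2 ^+ p * (if inner (level H) p i then 0 else value H i f))
    (4 ^ level H) (4 ^ (level H - p.+1)) (4 ^ level H - 4 ^ (level H - p.+1)) x.

Let shell_tame (H : simple T R) p i : (i < 4 ^ level H)%N -> tame (T := T) (grid (level H) i)
   (fun f => 2 ^+ p * (if inner (level H) p i then 0 else value H i f)).
Proof.
by move=> im; apply: tameZ; case: (inner _ p i); [exact: tame_cst|exact: value_tame].
Qed.

Let has_expect_shell H p : has_expect P (fun w => shell_exponent H p (vpath w)).
Proof.
apply: has_expect_sum => i /andP[_ im].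
have {}im : (i < 4 ^ level H)%N by rewrite (leq_trans im)// leq_subr.
have [c hc] := tame_bounded (shell_tame p im).
have mh : measurable_fun setT (fun w => 2 ^+ p * (if inner (level H) p i then 0 else value H i (vpath w))).
  apply: measurable_funM => //; case: (inner _ p i); first exact: measurable_cst.
  exact: measurable_value.
apply: has_expectB.
  by apply: (has_expectM (c := c)) mh _ (has_expect_vpath_increment im).
apply: (has_expectM (c := c ^+ 2 / 2)); last exact: has_expect_cst.
  by apply: measurable_funM => //; exact: measurable_funX.
move=> w; rewrite normrM normrX (ger0_norm (_ : 0 <= 2^-1))// ler_wpM2r//.
by rewrite lerXn2r ?nnegrE// (le_trans _ (hc (vpath w))).
Qed.

Let expect_shell (H : simple T R) p : (p < level H)%N ->
  expect P (fun w => shell_exponent H p (vpath w)) <= 3 * p.+1%:R.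
Proof.
move=> pm; apply: (@le_trans _ _ (ln (4 ^ p.+1)%:R)).
  apply: expect_le_ln; [by rewrite expn_gt0|exact: has_expect_shell|].
  apply: (vervaat_exp_le hB); [|by rewrite expn_gt0|exact: shell_tame].
  by rewrite -expnD; congr (_ ^ _)%N; lia.
rewrite natrX lnXn// -(mulr_natr (ln 4)) ler_wpM2r//.
by have := expR_ge1Dx (ln 4 : R); rewrite lnK ?posrE//; lra.
Qed.

Let shell_exponentE (H : simple T R) p x : 2 ^- p * shell_exponent H p x =
  \sum_(0 <= i < 4 ^ level H)
    if inner (level H) p.+1 i && ~~ inner (level H) p i then
      value H i x * (x (grid (level H) i.+1) - x (grid (level H) i)) -
      2 ^+ p / 2 * value H i x ^+ 2 * (grid (level H) i.+1 - grid (level H) i)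
    else 0.
Proof.
rewrite /shell_exponent /exponent (big_nat_widen _ _ (4 ^ level H)) ?leq_subr//.
rewrite (big_nat_widenl _ 0)// big_mkcond mulr_sumr; apply: eq_bigr => i _ /=.
rewrite andbC -/(inner _ _ _); case: (inner _ p.+1 i) => /=; last by rewrite mulr0.
case: (inner _ p i) => /=; first by rewrite !mulr0 expr0n/= !mul0r subrr mulr0.
by rewrite -!/(grid _ _); field; rewrite expf_neq0.
Qed.

Let inner_mono m p i : inner m p i -> inner m p.+1 i.
Proof.
move=> /andP[h1 h2].
have le : (4 ^ (m - p.+1) <= 4 ^ (m - p))%N by rewrite leq_exp2l//; lia.
by rewrite /inner (leq_trans le h1) (leq_trans h2)// leq_sub2l.
Qed.

Let shell_speed m p i : (p <= m)%N -> (i < 4 ^ m)%N -> ~~ inner m p i ->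
  2 ^+ p / 2 * (grid m i.+1 - grid m i) <= clock (grid m i.+1) - clock (grid m i) :> R.
Proof.
move=> pm im; have M0 : 0 < (4 ^ m)%:R :> R by rewrite ltr0n expn_gt0.
have E : (4 ^ (m - p))%:R = 4 ^- p * (4 ^ m)%:R :> R.
  by rewrite -{2}(subnK pm) expnD natrM mulrCA natrX -(natrX _ 4 p) mulVf ?mulr1 ?natrX// expf_neq0.
move=> nin; apply: clock_speed.
- by case/andP: (grid_itv (R := R) (ltnW im)).
- exact: grid_le.
- by case/andP: (grid_itv (R := R) im).
- move: nin; rewrite /inner negb_and -!ltnNge => /orP[h|]; [left|rewrite ltnS => h; right].
    by rewrite /grid ler_pdivrMr// -E ler_nat.
  rewrite /grid ler_pdivlMr// mulrBl mul1r -E lerBlDr -natrD ler_nat addnC.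
  by rewrite -leq_subLR.
Qed.

(** The shells telescope: [inner m 0] is empty, and [inner m m] omits only the first and the last
    cell, where simple integrands vanish. *)
Let sint_le_shells (H : simple T R) x : sint H x x - sint_sq H x clock <=
  \sum_(0 <= p < level H) 2 ^- p * shell_exponent H p x.
Proof.
under eq_bigr do rewrite shell_exponentE.
rewrite exchange_big/= /sint /sint_sq /stint -sumrB [leLHS]big_nat [leRHS]big_nat.
apply: ler_sum => i /andP[_ im].
set m := level H in im *; set c := value H i x * _; set D := _ - clock _.
apply: (@le_trans _ _ (\sum_(0 <= p < m)
    ((inner m p.+1 i)%:R - (inner m p i)%:R) * (c - value H i x ^+ 2 * D))).
  rewrite -mulr_suml telescope_sumr//.
  have -> : inner m 0 i = false by rewrite /inner subn0 subnn ltn0 andbF.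
  rewrite subr0; case: (boolP (inner m m i)) => [_|]; first by rewrite mul1r.
  rewrite /inner subnn expn0 negb_and -!ltnNge => h.
  have h0 : i = 0%N \/ i.+1 = (4 ^ m)%N by case/orP: h => h; [left|right]; lia.
  by rewrite /c (value_ends _ h0) mul0r expr0n/= mul0r subrr mulr0.
rewrite [leLHS]big_nat [leRHS]big_nat; apply: ler_sum => p /andP[_ pm].
have [ip|nip] := boolP (inner m p i).
  by rewrite (inner_mono ip) subrr mul0r.
case: (inner m p.+1 i) => /=; last by rewrite subrr mul0r.
rewrite subr0 mul1r lerD2l lerN2 mulrAC mulrC.
by rewrite ler_wpM2l ?sqr_ge0//; exact: (shell_speed (ltnW pm)).
Qed.

(** Shell [p] costs 2^-p * 3 (p + 1), at most 9 (3/4)^p since p + 1 <= 3 (3/2)^p; the geometric sum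
    is at most 4, whence 36. *)
Lemma linear_form_le H : linear_form H <= 36 + energy H.
Proof.
rewrite -lerBlDr -expectB; [|exact: has_expect_sint|exact: has_expect_sint_sq].
apply: (le_trans (expect_le _ _ (fun w => sint_le_shells H (vpath w)))).
- by apply: has_expectB; [exact: has_expect_sint|exact: has_expect_sint_sq].
- by apply: has_expect_sum => p _; apply: has_expectZ; exact: has_expect_shell.
rewrite expect_sum; last by move=> p _; apply: has_expectZ; exact: has_expect_shell.
apply: (@le_trans _ _ (\sum_(0 <= p < level H) 9 * (3 / 4) ^+ p)).
  rewrite [leLHS]big_nat [leRHS]big_nat; apply: ler_sum => p /andP[_ pm].
  rewrite expectZ; last exact: has_expect_shell.
  have p0 : 0 < 2 ^- p :> R by rewrite invr_gt0 exprn_gt0.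
  rewrite (le_trans (ler_wpM2l (ltW p0) (expect_shell pm)))//.
  have -> : 9 * (3 / 4) ^+ p = 2 ^- p * (9 * (3 / 2) ^+ p) :> R.
    by rewrite mulrCA -exprVn -exprMn; congr (_ * _ ^+ _); field.
  rewrite ler_pM2l//; have := natr_le_geometric (R := R) p.+1.
  rewrite exprS; lra.
have h : \sum_(0 <= p < level H) (3 / 4) ^+ p <= (1 - 3 / 4)^-1 :> R.
  by apply: sum_geometric_le; lra.
rewrite (_ : (1 - 3 / 4)^-1 = 4) in h; last by field.
by rewrite -mulr_sumr; lra.
Qed.

End energy_bound.

(** * The drift *)

Section stopped_clock.
Context {R : realType}.
Implicit Types (s t u v : R) (h : nat -> R).

(** Integrating against it gives the integral up to [t]: stopping the integrator leaves the grid of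
    the integrand untouched and allows any [t], on the grid or not. *)
Definition stopped_clock t u : R := clock (Num.min t u).

Lemma stopped_clock_le t u v : u <= v -> stopped_clock t u <= stopped_clock t v.
Proof.
move=> uv; apply: clock_le; rewrite le_min ge_min lexx/= ge_min uv orbT//.
Qed.

Lemma stopped_clock_increment s t u v : s <= t -> u <= v ->
  stopped_clock s v - stopped_clock s u <= stopped_clock t v - stopped_clock t u.
Proof.
move=> st uv; rewrite /stopped_clock.
have [su|us] := leP s u.
  rewrite (min_idPl (le_trans su uv)) subrr subr_ge0; exact: stopped_clock_le.
rewrite (min_idPr (le_trans (ltW us) st)) lerD2r; apply: clock_le.
by rewrite le_min !ge_min st lexx orbT.
Qed.

Lemma stopped_clock_increment_le t u v : u <= v ->
  stopped_clock t v - stopped_clock t u <= clock v - clock u.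
Proof.
move=> uv; have := stopped_clock_increment (t := Num.max t v) (s := t) (u := u) (v := v).
rewrite le_max lexx/= => /(_ isT uv) h; apply: (le_trans h).
rewrite /stopped_clock.
by rewrite !(min_idPr _)// le_max ?lexx ?uv orbT.
Qed.

Lemma stint_stopped_norm m h s t : s <= t ->
  `|stint m h (stopped_clock t) - stint m h (stopped_clock s)| <=
  stint m (fun i => `|h i|) (stopped_clock t) - stint m (fun i => `|h i|) (stopped_clock s).
Proof.
move=> st; rewrite /stint -!sumrB (le_trans (ler_norm_sum _ _ _))//.
apply: ler_sum => i _; rewrite -!mulrBr normrM ler_wpM2l// ger0_norm// subr_ge0.
by apply: stopped_clock_increment => //; exact: grid_le.
Qed.

Lemma stint_stopped_ge0 m h t : (forall i, 0 <= h i) -> 0 <= stint m h (stopped_clock t).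
Proof.
move=> h0; apply: sumr_ge0 => i _; rewrite mulr_ge0// subr_ge0.
by apply: stopped_clock_le; exact: grid_le.
Qed.

Lemma stint_stopped_le m h t : (forall i, 0 <= h i) ->
  stint m h (stopped_clock t) <= stint m h clock.
Proof.
move=> h0; apply: ler_sum => i _; rewrite ler_wpM2l//.
by apply: stopped_clock_increment_le; exact: grid_le.
Qed.

Lemma stint_stopped_norm_le m h t :
  `|stint m h (stopped_clock t)| <= stint m (fun i => `|h i|) clock.
Proof.
apply: le_trans (stint_stopped_le _ _ (fun i => normr_ge0 _)).
by apply: stint_norm => u v _ uv _; exact: stopped_clock_le.
Qed.

Lemma stint_stopped0 m h : stint m h (stopped_clock 0) = 0.
Proof.
rewrite /stint big1// => i _; rewrite /stopped_clock !(min_idPl _) ?subrr ?mulr0//;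
  by rewrite divr_ge0.
Qed.

Lemma continuous_stint_stopped m h : continuous (fun t => stint m h (stopped_clock t)).
Proof.
have cm u : continuous (fun t => stopped_clock t u).
  move=> t; have : Num.min s u @[s --> t] --> Num.min t u.
    by apply: continuous_min; [exact: cvg_id|exact: cvg_cst].
  by move=> /cvg_comp/(_ (@continuous_clock R _)).
move=> t; rewrite /stint.
apply: (@cvg_big _ _ +%R 0 xpredT _ _ _ _ (fun i s => h i * (stopped_clock s (grid m i.+1) - stopped_clock s (grid m i)))).
  exact: add_continuous.
move=> i _; apply: cvgMr; apply: cvgB; exact: cm.
Qed.

Lemma stopped_clock_grid m a b i : (a <= b)%N ->
  (stopped_clock (grid m b) (grid m i.+1) - stopped_clock (grid m b) (grid m i)) -
  (stopped_clock (grid m a) (grid m i.+1) - stopped_clock (grid m a) (grid m i)) =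
  (a <= i < b)%:R * (clock (grid m i.+1) - clock (grid m i)) :> R.
Proof.
move=> ab; rewrite /stopped_clock.
have E (c : nat) : clock (Num.min (grid m c) (grid m i.+1)) - clock (Num.min (grid m c) (grid m i))
    = (i < c)%:R * (clock (grid m i.+1) - clock (grid m i)) :> R.
  case: ltnP => [ic|ci].
    by rewrite mul1r !(min_idPr _)//; apply: grid_le => //; exact: ltnW.
  by rewrite mul0r !(min_idPl _) ?subrr//; apply: grid_le => //; exact: leq_trans (leqnSn _).
rewrite !E -mulrBl; congr (_ * _).
case: (ltnP i a) => ia; first by rewrite (leq_trans ia ab)/= subrr.
by rewrite subr0.
Qed.

End stopped_clock.

Section dominated.
Context {d : measure_display} {T : measurableType d} {R : realType}.
Variable P : probability T R.

Lemma expect_dominated (f_ : nat -> T -> R) (f : T -> R) (g : T -> \bar R) :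
  (forall n, measurable_fun setT (f_ n)) -> measurable_fun setT f ->
  P.-integrable setT g ->
  {ae P, forall w, f_ n w @[n --> \oo] --> f w} ->
  {ae P, forall w, forall n, (`|f_ n w|%:E <= g w)%E} ->
  has_expect P f /\ expect P (f_ n) @[n --> \oo] --> expect P f.
Proof.
move=> mf_ mf ig cf dom.
have dom' : {ae P, forall w n, setT w -> (`|(f_ n w)%:E| <= g w)%E}.
  by apply: filterS dom => w h n _; exact: h.
have cf' : {ae P, forall w, setT w -> (f_ n w)%:E @[n --> \oo] --> (f w)%:E}.
  by apply: filterS cf => w h _; apply: cvg_EFin; [exact: nearW|exact: h].
have [i1 _ i2] := dominated_convergence measurableT
  (fun n => (measurable_EFinP _ _).2 (mf_ n)) ((measurable_EFinP _ _).2 mf) cf' ig dom'.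
split => //; rewrite /expect /Rintegral; apply: fine_cvg.
by rewrite fineK//; exact: integrable_fin_num.
Qed.

End dominated.

Section summable_increments.
Context {R : realType}.

Lemma summable_increments_cvg (u N : nat -> R) (S : R) :
  (forall k, `|u k.+1 - u k| <= N k) -> series N n @[n --> \oo] --> S ->
  cvgn u /\ forall k, `|limn u - u k| <= S - series N k.
Proof.
move=> uN NS.
have N0 k : 0 <= N k by rewrite (le_trans _ (uN k)).
have tel n : series (fun k => u k.+1 - u k) n = u n - u 0%N.
  by rewrite seriesEnat /= telescope_sumr.
have cu : cvgn u.
  have -> : u = (fun n => u 0%N + series (fun k => u k.+1 - u k) n).
    by apply/funext => n; rewrite tel addrC subrK.
  apply: is_cvgD; first exact: is_cvg_cst.
  apply: normed_cvg; apply: (@series_le_cvg _ _ N) => //.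
    by move=> n /=; exact: normr_ge0.
  by apply/cvg_ex; exists S.
split => // k.
have le n : (k <= n)%N -> `|u n - u k| <= series N n - series N k.
  move=> kn; rewrite sub_series_geq// -telescope_sumr//.
  by rewrite (le_trans (ler_norm_sum _ _ _))//; apply: ler_sum.
have c1 : `|u n - u k| @[n --> \oo] --> `|limn u - u k|.
  by apply: cvg_norm; apply: cvgB => //; exact: cvg_cst.
have c2 : series N n - series N k @[n --> \oo] --> S - series N k.
  by apply: cvgB => //; exact: cvg_cst.
by apply: (ler_cvg_to c1 c2); exists k.
Qed.

End summable_increments.

Section compensator.
Context {d : measure_display} {T : measurableType d} {R : realType}.
Variables (P : probability T R) (B : R -> {RV P >-> R}).
Hypothesis hB : standard_brownian_motion B.
Variable x : nat -> simple T R.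
Hypothesis x_fast : forall k, energy B (lin 1 (x k.+1) (-1) (x k)) <= 16 ^- k.

Let D k := lin 1 (x k.+1) (-1) (x k).

Definition drift_approx k t w : R := sint (x k) (vpath B w) (stopped_clock t).
Definition increments k w : R :=
  stint (level (D k)) (fun i => `|value (D k) i (vpath B w)|) clock.
(** The limsup and the default value of [fine] make it defined and adapted everywhere, also on the
    null set where the approximations diverge. It is only half of the drift because at the minimum
    of [energy - linear_form] twice the bilinear form equals the linear form. *)
Definition half_drift t w : R := fine (limn_esup (fun k => (drift_approx k t w)%:E)).

Let mass k w : R := stint (level (x k)) (fun i => `|value (x k) i (vpath B w)|) clock.

Lemma increments_ge0 k w : 0 <= increments k w.
Proof. by apply: sumr_ge0 => i _; rewrite mulr_ge0// subr_ge0; apply: clock_le; exact: grid_le. Qed.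

Let mass_ge0 k w : 0 <= mass k w.
Proof. by apply: sumr_ge0 => i _; rewrite mulr_ge0// subr_ge0; apply: clock_le; exact: grid_le. Qed.

Let clock_mono (s t : R) : 0 <= s -> s <= t -> t <= 1 -> clock s <= clock t.
Proof. by move=> _ st _; exact: clock_le. Qed.

Lemma approx_increment k t w : `|drift_approx k.+1 t w - drift_approx k t w| <= increments k w.
Proof.
have -> : drift_approx k.+1 t w - drift_approx k t w = sint (D k) (vpath B w) (stopped_clock t).
  by rewrite /D sint_lin mul1r mulN1r.
exact: stint_stopped_norm_le.
Qed.

Let mass_le k w : mass k w <= mass 0 w + series (increments ^~ w) k.
Proof.
elim: k => [|k ih]; first by rewrite seriesEnat/= big_geq// addr0.
suff : mass k.+1 w <= mass k w + increments k w.
  by rewrite seriesEnat /= big_nat_recr//= addrA; move: ih; rewrite seriesEnat /=; lra.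
rewrite /mass -(stint_refine (level (x k.+1)) (level (x k)) (fun i => `|value (x k.+1) i (vpath B w)|)).
rewrite -(stint_refine' (level (x k)) (level (x k.+1)) (fun i => `|value (x k) i (vpath B w)|)).
rewrite /increments /D /= -[leRHS]addr0 -(mul0r 0).
rewrite -[X in X + _ + _]mul1r -[X in _ + X + _]mul1r mul0r addr0 -stint_lin.
apply: stint_le => // i _; rewrite !mul1r mulN1r.
rewrite -{1}(subrK (value (x k) (i %/ 4 ^ level (x k.+1))%N (vpath B w)) (value (x k.+1) _ _)).
by rewrite addrC ler_normD.
Qed.

Lemma approx_le_mass k t w : `|drift_approx k t w| <= mass 0 w + series (increments ^~ w) k.
Proof. by apply: le_trans (mass_le k w); exact: stint_stopped_norm_le. Qed.

(** The weighted inequality |h| <= 4^-k / 2 + 4^k h^2 / 2 in place of Cauchy-Schwarz; the clock has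
    total mass 2. With energy at most 16^-k both terms are of order 4^-k after taking expectations,
    hence summable. *)
Let increments_le k w :
  increments k w <= 4 ^- k + 4 ^+ k / 2 * sint_sq (D k) (vpath B w) clock.
Proof.
have e0 : 0 < 4 ^+ k :> R by rewrite exprn_gt0.
apply: (@le_trans _ _ (stint (level (D k))
   (fun i => 1 * (4 ^- k / 2) + 4 ^+ k / 2 * value (D k) i (vpath B w) ^+ 2) clock)).
  apply: stint_le => // i _; rewrite mul1r.
  set h := value _ _ _; rewrite -(real_normK (num_real h)).
  rewrite -(ler_pM2l e0) mulrDr mulrA mulfV ?gt_eqF//.
  have := sqr_ge0 (4 ^+ k * `|h| - 1); nra.
by rewrite stint_lin stint_cst clock0 clock1 subr0 mul1r divfK.
Qed.

Let measurable_increments k : measurable_fun setT (increments k).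
Proof.
apply: measurable_sum_nat => i /andP[_ im]; apply: measurable_funM => //.
by apply: measurableT_comp => //; exact: measurable_value.
Qed.

Let has_expect_mass k : has_expect P (mass k).
Proof.
apply: (has_expect_stint P (h := fun i w => `|value (x k) i (vpath B w)|)) => i im.
  by apply: measurableT_comp => //; exact: measurable_value.
by have [c hc] := value_bounded im; exists c => w; rewrite normr_id.
Qed.

Let integral_increments k : (\int[P]_w (increments k w)%:E <= (2 * (4^-1) ^+ k)%:E)%E.
Proof.
have s1 : has_expect P (fun w => sint_sq (D k) (vpath B w) clock) by exact: has_expect_sint_sq.
have s2 : has_expect P (increments k).
  apply: (has_expect_stint P (h := fun i w => `|value (D k) i (vpath B w)|)) => i im.
    by apply: measurableT_comp => //; exact: measurable_value.
  by have [c hc] := value_bounded im; exists c => w; rewrite normr_id.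
have s3 := has_expectZ (4 ^+ k / 2) s1.
rewrite -expect_EFin// lee_fin.
apply: (le_trans (expect_le s2 (has_expectD (has_expect_cst P _) s3) (increments_le k))).
rewrite expectD ?expect_cst ?expectZ//; last exact: has_expect_cst.
have e0 : 0 < 4 ^+ k :> R by rewrite exprn_gt0.
have := x_fast k; rewrite /energy -/(D k) => h.
have : 4 ^+ k / 2 * expect P (fun w => sint_sq (D k) (vpath B w) clock) <= 4 ^+ k / 2 * 16 ^- k.
  by rewrite ler_wpM2l// divr_ge0// ltW.
have -> : 4 ^+ k / 2 * 16 ^- k = 4 ^- k / 2 :> R.
  have -> : 16 ^- k = 4 ^- k * 4 ^- k :> R by rewrite -invfM -exprMn; congr (_ ^+ _)^-1; lra.
  by field; rewrite expf_neq0.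
rewrite exprVn; have : 0 < 4 ^- k :> R by rewrite invr_gt0.
lra.
Qed.

Definition total w : \bar R := (\sum_(0 <= k <oo) (increments k w)%:E)%E.
Definition drift_bound w : \bar R := ((mass 0 w)%:E + total w)%E.

Lemma integrable_total : P.-integrable setT total.
Proof.
have mi k : measurable_fun setT (fun w => (increments k w)%:E) by exact/measurable_EFinP.
apply/integrableP; split.
  by apply: ge0_emeasurable_sum => // k w _ _; rewrite lee_fin increments_ge0.
have tot0 w : (0 <= total w)%E.
  by apply: nneseries_ge0 => k _ _; rewrite lee_fin increments_ge0.
under eq_integral => w _ do rewrite (gee0_abs (tot0 w)).
rewrite integral_nneseries//; last by move=> k w _; rewrite lee_fin increments_ge0.
apply: (@nneseries_geometric_lty _ _ 2 (4^-1)); [lra|lra| |exact: integral_increments].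
by move=> k; apply: integral_ge0 => w _; rewrite lee_fin increments_ge0.
Qed.

Lemma integrable_drift_bound : P.-integrable setT drift_bound.
Proof. by apply: integrableD => //; [exact: has_expect_mass|exact: integrable_total]. Qed.

(** The summed increments bound the distance to the limit independently of [t], so on this event of
    full measure the approximations converge uniformly in time and continuity passes to the
    limit. *)
Definition good w : Prop := total w \is a fin_num.

Lemma ae_good : {ae P, forall w, good w}.
Proof. by have := integrable_ae measurableT integrable_total; apply: filterS => w /(_ I). Qed.

Lemma series_le_total w k : ((series (increments ^~ w) k)%:E <= total w)%E.
Proof.
rewrite seriesEnat /= -sumEFin; apply: nneseries_lim_ge => i _ _.
by rewrite lee_fin increments_ge0.
Qed.

Lemma series_increments_cvg w : good w ->
  series (increments ^~ w) n @[n --> \oo] --> fine (total w).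
Proof.
move=> gw.
apply: (fine_cvg (f := fun n => (series (increments ^~ w) n)%:E)); rewrite fineK//.
have -> : (fun n => (series (increments ^~ w) n)%:E) = (fun n => \sum_(0 <= i < n) (increments i w)%:E)%E.
  by apply/funext => n; rewrite seriesEnat /= sumEFin.
by apply: is_cvg_nneseries => i _ _; rewrite lee_fin increments_ge0.
Qed.

Lemma half_drift_cvg w t : good w -> drift_approx k t w @[k --> \oo] --> half_drift t w.
Proof.
move=> gw.
have [ca _] := summable_increments_cvg (fun k => approx_increment k t w) (series_increments_cvg gw).
have cE : (drift_approx k t w)%:E @[k --> \oo] --> (limn (fun k => drift_approx k t w))%:E.
  by apply: cvg_EFin; [exact: nearW|exact: ca].
by rewrite /half_drift (cvg_limn_einf_sup cE).2.
Qed.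

Lemma half_drift_approx w t k : good w ->
  `|half_drift t w - drift_approx k t w| <= fine (total w) - series (increments ^~ w) k.
Proof.
move=> gw.
have [_] := summable_increments_cvg (fun k => approx_increment k t w) (series_increments_cvg gw).
by rewrite (cvg_lim _ (half_drift_cvg gw)).
Qed.

Lemma approx_bound k t w : (`|drift_approx k t w|%:E <= drift_bound w)%E.
Proof.
apply: (@le_trans _ _ ((mass 0 w)%:E + (series (increments ^~ w) k)%:E)%E).
  by rewrite -EFinD lee_fin approx_le_mass.
by apply: leeD => //; exact: series_le_total.
Qed.

Lemma half_drift_bound t w : good w -> (`|half_drift t w|%:E <= drift_bound w)%E.
Proof.
move=> gw; rewrite /drift_bound -(fineK gw) -EFinD lee_fin.
apply: (ler_cvg_to (cvg_norm (half_drift_cvg (t := t) gw)) (cvg_cst _)).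
apply: nearW => k; have := approx_bound k t w.
by rewrite /drift_bound -(fineK gw) -EFinD lee_fin.
Qed.

Lemma continuous_half_drift w : good w -> continuous (half_drift ^~ w).
Proof.
move=> gw t; apply/cvgrPdist_le => e e0.
have e3 : 0 < e / 3 by lra.
have /cvgrPdist_le/(_ _ e3)[k _ /(_ k (leqnn k))] := series_increments_cvg gw.
move=> /(le_trans (ler_norm _)) hk.
have := @continuous_stint_stopped R (level (x k)) (fun i => value (x k) i (vpath B w)) t.
move=> /cvgrPdist_le/(_ _ e3); apply: filterS => s hs.
have h1 := le_trans (half_drift_approx t k gw) hk.
have h2 := le_trans (half_drift_approx s k gw) hk.
have -> : half_drift t w - half_drift s w = (half_drift t w - drift_approx k t w) +
    (drift_approx k t w - drift_approx k s w) - (half_drift s w - drift_approx k s w) by ring.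
rewrite (le_trans (ler_normB _ _))// (le_trans (lerD (ler_normD _ _) (lexx _)))//.
by have : `|drift_approx k t w - drift_approx k s w| <= e / 3 by []; lra.
Qed.

Lemma half_drift_bounded_variation w : good w -> bounded_variation 0 1 (half_drift ^~ w).
Proof.
move=> gw; exists (mass 0 w + fine (total w)) => _ [l [lpath _] <-].
rewrite /variation /=; set p := nth 1 (0 :: l).
have cv : \sum_(0 <= n < size l) `|drift_approx k (p n.+1) w - drift_approx k (p n) w| @[k --> \oo] -->
    \sum_(0 <= n < size l) `|half_drift (p n.+1) w - half_drift (p n) w|.
  apply: (@cvg_big _ _ +%R 0 xpredT _ _ _ _ (fun n k => `|drift_approx k (p n.+1) w - drift_approx k (p n) w|)).
    exact: add_continuous.
  by move=> n _; apply: cvg_norm; apply: cvgB; exact: half_drift_cvg.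
apply: (ler_cvg_to cv (cvg_cst _)); apply: nearW => k.
(* Nondecreasing in [t] and dominating the increments of the approximation, so the sum over the
   partition telescopes to at most [mass k w], which is bounded uniformly in [k]. *)
pose W t := stint (level (x k)) (fun i => `|value (x k) i (vpath B w)|) (stopped_clock t).
apply: (@le_trans _ _ (\sum_(0 <= n < size l) (W (p n.+1) - W (p n)))).
  rewrite [leLHS]big_nat [leRHS]big_nat; apply: ler_sum => n /andP[_ nl].
  apply: stint_stopped_norm; apply: ltW.
  exact: (pathP 1 lpath n nl).
rewrite telescope_sumr//.
have W0 : 0 <= W (p 0%N) by exact: stint_stopped_ge0.
have W1 : W (p (size l)) <= mass k w by exact: stint_stopped_le.
have W2 := mass_le k w.
have W3 : series (increments ^~ w) k <= fine (total w).
  by rewrite -lee_fin fineK//; exact: series_le_total.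
lra.
Qed.

Lemma half_drift0 w : half_drift 0 w = 0.
Proof.
rewrite /half_drift (_ : (fun k => _) = cst 0%:E); last first.
  by apply/funext => k; rewrite /drift_approx /sint stint_stopped0.
by rewrite (cvg_limn_einf_sup (@cvg_cst _ _ _ _ _)).2.
Qed.

(** Its form makes the generated sigma-algebra convertible to [natural_filtration] of the Vervaat
    transform. *)
Definition path_gen (t : R) : set_system T :=
  \bigcup_(s in `[0, t]) preimage_set_system setT (fun w => vpath B w s) measurable.

Lemma measurable_path_gen (s t : R) : 0 <= s -> s <= t ->
  measurable_fun setT ((fun w => vpath B w s) : g_sigma_algebraType (path_gen t) -> R).
Proof.
move=> s0 st _ A mA; apply: sub_sigma_algebra; exists s; last by exists A.
by rewrite /= in_itv/= s0.
Qed.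

Lemma measurable_tame (s t : R) Psi : s <= t -> tame (T := T) s Psi ->
  measurable_fun setT ((fun w => Psi (vpath B w)) : g_sigma_algebraType (path_gen t) -> R).
Proof.
move=> st tPsi; apply: (tame_measurable tPsi (X := fun u w => vpath B w u)).
by move=> u /andP[u0 us]; apply: measurable_path_gen => //; exact: le_trans st.
Qed.

Lemma measurable_approx k t :
  measurable_fun setT (drift_approx k t : g_sigma_algebraType (path_gen t) -> R).
Proof.
apply: (@measurable_sum_nat _ (g_sigma_algebraType (path_gen t)) R 0 (4 ^ level (x k))
  (fun i w => value (x k) i (vpath B w) * _)) => i /andP[_ im].
have [it|ti] := leP (grid (level (x k)) i) t.
  apply: measurable_funM => //.
  exact: measurable_tame it (value_tame im).
(* A cell that starts after [t] contributes nothing, since the stopped clock is constant there; only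
   values known by time [t] remain. *)
rewrite /stopped_clock !(min_idPl _) ?subrr; last 2 first.
- exact: ltW.
- by rewrite (le_trans (ltW ti))//; apply: grid_le.
by under eq_fun do rewrite mulr0; exact: measurable_cst.
Qed.

Lemma measurable_half_drift t :
  measurable_fun setT (half_drift t : g_sigma_algebraType (path_gen t) -> R).
Proof.
apply: (@measurableT_comp _ _ _ _ _ _ fine) => //.
apply: (@measurable_fun_limn_esup _ (g_sigma_algebraType (path_gen t)) R setT
  (fun k w => (drift_approx k t w)%:E)) => k.
by apply/measurable_EFinP; exact: measurable_approx.
Qed.

Lemma path_gen_measurable t : t <= 1 -> path_gen t `<=` measurable.
Proof.
move=> t1 _ [s /= + [A mA <-]]; rewrite in_itv/= => /andP[s0 st].
by apply: measurable_vpath => //; rewrite s0 (le_trans st).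
Qed.

End compensator.

(** * The martingale part *)

Section simple_indicator.
Context {R : realType}.

Lemma stint_indicator m a b (c : R) y : (a <= b)%N -> (b <= 4 ^ m)%N ->
  stint m (fun i => if (a <= i < b)%N then c else 0) y = c * (y (grid m b) - y (grid m a)).
Proof.
move=> ab bm; rewrite /stint (@big_cat_nat _ _ _ a)/=; [|by []|exact: leq_trans bm].
rewrite (@big_cat_nat _ _ _ b _ (4 ^ m))//=.
rewrite big_nat big1 ?add0r; last by move=> i /andP[_ ia]; rewrite leqNgt ia mul0r.
rewrite [X in _ + X]big_nat [X in _ + X]big1 ?addr0; last first.
  by move=> i /andP[bi _]; rewrite ltnNge bi andbF mul0r.
rewrite (@eq_big_nat _ _ _ _ _ _ (fun i => c * (y (grid m i.+1) - y (grid m i)))); last first.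
  by move=> i ->.
by rewrite -mulr_sumr telescope_sumr.
Qed.

End simple_indicator.

Section martingale_part.
Context {d : measure_display} {T : measurableType d} {R : realType}.
Variables (P : probability T R) (B : R -> {RV P >-> R}).
Hypothesis hB : standard_brownian_motion B.
Variable x : nat -> simple T R.
Hypothesis x_fast : forall k, energy B (lin 1 (x k.+1) (-1) (x k)) <= 16 ^- k.
Hypothesis x_form : forall k y,
  `|2 * energy_form B (x k) y - linear_form B y| <= 4 ^- k * (1 + energy B y).

Definition drift t w : R := 2 * half_drift B x t w.
Definition mart t w : R := vpath B w t - drift t w.

Let hd t := half_drift B x t.

Let measurable_of_path_gen t (f : T -> R) : t <= 1 ->
  measurable_fun setT (f : g_sigma_algebraType (path_gen B t) -> R) -> measurable_fun setT f.
Proof.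
move=> t1 mf; apply: (measurable_fun_sub_sigma (G := path_gen B t)) => //.
exact: path_gen_measurable.
Qed.

Lemma measurable_half_driftT t : t <= 1 -> measurable_fun setT (hd t).
Proof.
by move=> t1; apply: (@measurable_of_path_gen t) => //; exact: measurable_half_drift.
Qed.

Lemma measurable_approxT k t : t <= 1 -> measurable_fun setT (drift_approx B x k t).
Proof.
by move=> t1; apply: (@measurable_of_path_gen t) => //; exact: measurable_approx.
Qed.

Lemma half_drift_dominated t : {ae P, forall w, (`|hd t w|%:E <= drift_bound B x w)%E}.
Proof.
by have := ae_good hB x_fast; apply: filterS => w; exact: half_drift_bound.
Qed.

Lemma has_expect_half_drift t : t <= 1 -> has_expect P (hd t).
Proof.
move=> t1.
have [] := @expect_dominated _ _ _ P (fun=> hd t) (hd t) (drift_bound B x) _ _ _ _ _ => //.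
- by move=> _; exact: measurable_half_driftT.
- exact: measurable_half_driftT.
- exact: integrable_drift_bound.
- by apply: nearW => w; exact: cvg_cst.
- by have := half_drift_dominated t; apply: filterS => w h _.
Qed.

Lemma has_expect_mart t : 0 <= t <= 1 -> has_expect P (mart t).
Proof.
move=> /andP[t0 t1]; apply: has_expectB.
  by apply: has_expect_vpath; rewrite // t0.
by apply: has_expectZ; exact: has_expect_half_drift.
Qed.

Lemma mart_dominated : exists2 g : T -> \bar R, P.-integrable setT g &
  {ae P, forall w, forall t, 0 <= t <= 1 -> (`|mart t w|%:E <= g w)%E}.
Proof.
have [g ig hg] := vervaat_dominated hB.
exists (fun w => g w + 2%:E * drift_bound B x w)%E.
  apply: integrableD => //; apply: integrableZl => //; exact: integrable_drift_bound.
have := ae_good hB x_fast; apply: filterS => w gw t t01.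
apply: (@le_trans _ _ (`|vpath B w t|%:E + 2%:E * `|hd t w|%:E)%E).
  rewrite -EFinM -EFinD lee_fin (le_trans (ler_normB _ _))// normrM.
  by rewrite (ger0_norm (_ : 0 <= 2)).
apply: leeD; first exact: hg.
by apply: lee_wpmul2l; [rewrite lee_fin|exact: half_drift_bound].
Qed.

Section simple_test.
Variables (m a b : nat) (Psi : (R -> R) -> R).
Hypotheses (a0 : (0 < a)%N) (ab : (a <= b)%N) (bm : (b < 4 ^ m)%N).
Hypothesis tPsi : tame (T := T) (grid m a) Psi.

Let test_tame i : (i < 4 ^ m)%N ->
  tame (T := T) (grid m i) (fun f => if (a <= i < b)%N then Psi f else 0).
Proof.
move=> im; case: (boolP (a <= i < b)%N) => [/andP[ai _]|_]; last exact: tame_cst.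
by apply: tame_le tPsi; exact: grid_le.
Qed.

Let test_ends (i : nat) (f : R -> R) : i = 0%N \/ i.+1 = (4 ^ m)%N ->
  (if (a <= i < b)%N then Psi f else 0) = 0.
Proof. by move=> h; case: ifP => // /andP[? ?]; lia. Qed.

Let test := Simple test_tame test_ends.

Let linear_form_test :
  linear_form B test = expect P (fun w => Psi (vpath B w) * (vpath B w (grid m b) - vpath B w (grid m a))).
Proof.
rewrite /linear_form; congr (expect P _); apply/funext => w.
by rewrite /sint /= stint_indicator// ltnW.
Qed.

Let energy_form_test k : energy_form B (x k) test =
  expect P (fun w => Psi (vpath B w) * (drift_approx B x k (grid m b) w - drift_approx B x k (grid m a) w)).
Proof.
rewrite /energy_form; congr (expect P _); apply/funext => w.
rewrite /sint_mul /drift_approx /sint /=.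
set l := level (x k).
rewrite -(stint_refine l m (fun i => value (x k) i (vpath B w)) (stopped_clock (grid m b))).
rewrite -(stint_refine l m (fun i => value (x k) i (vpath B w)) (stopped_clock (grid m a))).
rewrite /stint -sumrB mulr_sumr; apply: eq_bigr => i _.
rewrite -mulrBr -(grid_scale m l a) -(grid_scale m l b) addnC.
rewrite stopped_clock_grid; last by rewrite leq_mul2r ab orbT.
rewrite -leq_divRL ?expn_gt0// -ltn_divLR ?expn_gt0//.
by case: ifP => _ /=; ring.
Qed.

(** The representation is tested on the simple integrand equal to [Psi] on ]grid m a, grid m b]. Its
    linear form is the mean of [Psi] times the increment of the transform, its form with [x k] that
    of [Psi] times the increment of [drift_approx]; the error 4^-k * (1 + energy) vanishes in the
    limit. The strict conditions on [a] and [b] keep the test integrand zero on the end cells. *)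
Lemma expect_mart_tame : expect P (fun w => Psi (vpath B w) * (mart (grid m b) w - mart (grid m a) w)) = 0.
Proof.
have [c hc] := tame_bounded tPsi.
have c0 : 0 <= c by rewrite (le_trans _ (hc (fun=> 0))).
have /andP[b0 b1] := grid_itv (R := R) (ltnW bm).
have am : (a <= 4 ^ m)%N by lia.
have /andP[ga0 ga1] := grid_itv (R := R) am.
have mPsi : measurable_fun setT (fun w => Psi (vpath B w)).
  by apply: (@measurable_of_path_gen (grid m a)) => //; exact: measurable_tame (lexx _) tPsi.
pose u k w := Psi (vpath B w) * (drift_approx B x k (grid m b) w - drift_approx B x k (grid m a) w).
pose v w := Psi (vpath B w) * (hd (grid m b) w - hd (grid m a) w).
have [sv cv] : has_expect P v /\ expect P (u k) @[k --> \oo] --> expect P v.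
  apply: (@expect_dominated _ _ _ P u v (fun w => (2 * c)%:E * drift_bound B x w)%E).
  - move=> k; apply: measurable_funM => //.
    by apply: measurable_funB; exact: measurable_approxT.
  - by apply: measurable_funM => //; apply: measurable_funB; exact: measurable_half_driftT.
  - by apply: integrableZl => //; exact: integrable_drift_bound.
  - have := ae_good hB x_fast; apply: filterS => w gw.
    by apply: cvgMr; apply: cvgB; exact: half_drift_cvg.
  - have := ae_good hB x_fast; apply: filterS => w gw k.
    have h1 := approx_bound B x k (grid m b) w; have h2 := approx_bound B x k (grid m a) w.
    have fb : drift_bound B x w = (fine (drift_bound B x w))%:E.
      by rewrite fineK// /drift_bound -(fineK gw).
    rewrite fb lee_fin in h1; rewrite fb lee_fin in h2; rewrite fb -EFinM lee_fin.
    rewrite /u normrM [2 * c]mulrC -mulrA.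
    by rewrite ler_pM// (le_trans (ler_normB _ _))//; lra.
have e0 : 0 <= energy B test by exact: energy_ge0.
have lim0 : 4 ^- k * (1 + energy B test) @[k --> \oo] --> (0 : R).
  rewrite -(mul0r (1 + energy B test)); apply: cvgMl.
  have := @cvg_geometric R 1 4^-1; rewrite ger0_norm//.
  have h : 4^-1 < 1 :> R by lra.
  move=> /(_ h); rewrite /geometric /=.
  by under eq_fun do rewrite mul1r exprVn.
have lim1 : `|2 * expect P (u k) - linear_form B test| @[k --> \oo] -->
    `|2 * expect P v - linear_form B test|.
  by apply: cvg_norm; apply: cvgB; [apply: cvgMr|exact: cvg_cst].
have : `|2 * expect P v - linear_form B test| <= 0.
  apply: (ler_cvg_to lim1 lim0); apply: nearW => k.
  by rewrite -energy_form_test; exact: x_form.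
rewrite normr_le0 subr_eq0 linear_form_test => /eqP E.
have sV : has_expect P (fun w => Psi (vpath B w) * (vpath B w (grid m b) - vpath B w (grid m a))).
  apply: (has_expectM (c := c)) => //; apply: has_expectB; apply: has_expect_vpath => //.
    by rewrite b0.
  by rewrite ga0.
have -> : (fun w => Psi (vpath B w) * (mart (grid m b) w - mart (grid m a) w)) =
  (fun w => Psi (vpath B w) * (vpath B w (grid m b) - vpath B w (grid m a)) - 2 * v w).
  by apply/funext => w; rewrite /mart /drift /v /hd; ring.
by rewrite expectB ?expectZ ?E ?subrr//; exact: has_expectZ.
Qed.

End simple_test.

(* A pi-system that generates the filtration. *)
Let approximable (s : R) : set_system T := [set C | exists Psi : nat -> (R -> R) -> R,
  [/\ forall n, tame (T := T) s (Psi n), forall n f, `|Psi n f| <= 1 &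
      forall w, Psi n (vpath B w) @[n --> \oo] --> (\1_C w : R)]].

Let approximableI s : setI_closed (approximable s).
Proof.
move=> C1 C2 [Psi [tPsi bPsi cPsi]] [Phi [tPhi bPhi cPhi]].
exists (fun n f => Psi n f * Phi n f); split.
- by move=> n; exact: tameM.
- by move=> n f; rewrite normrM mulr_ile1.
- by move=> w; rewrite indicI; apply: cvgM.
Qed.

Let approximableT s : approximable s setT.
Proof.
exists (fun _ _ => 1); split.
- by move=> n; exact: tame_cst.
- by move=> n f; rewrite normr1.
- by move=> w; rewrite indicT; exact: cvg_cst.
Qed.

Let path_gen_approximable s : path_gen B s `<=` <<s approximable s >>.
Proof.
move=> _ [u /= us [A mA <-]].
suff mu : measurable_fun setT ((fun w => vpath B w u) : g_sigma_algebraType (approximable s) -> R).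
  exact: mu.
apply: (measurability _ (RGenOInfty.measurableE R)) => _ [_ [c ->] <-].
apply: sub_sigma_algebra.
(* Bounded continuous functions of one value of the path that increase to the indicator of ]c, +oo[;
   these half-lines generate the Borel sets. *)
exists (fun n f => Num.min 1 (n%:R * Num.max 0 (f u - c))); split.
- move=> n; rewrite in_itv/= in us; split.
  + exists 1 => f; have h : 0 <= n%:R * Num.max 0 (f u - c) by rewrite mulr_ge0// le_max lexx.
    by rewrite ger0_norm ?ge_min ?lexx// le_min ler01.
  + move=> F g Fg.
    apply: (@continuous_cvg _ _ _ _ _ (fun n => F n u) (fun z : R => Num.min 1 (n%:R * Num.max 0 (z - c)))); last exact: Fg.
    apply: (@continuous_min R R (fun=> 1) (fun z => n%:R * Num.max 0 (z - c))); first exact: cvg_cst.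
    apply: cvgMr; apply: (@continuous_max R R (fun=> 0) (fun z => z - c)); first exact: cvg_cst.
    by apply: cvgB; [exact: cvg_id|exact: cvg_cst].
  + move=> G X mX; apply: measurable_minr => //; apply: measurable_funM => //.
    by apply: measurable_maxr => //; apply: measurable_funB => //; exact: mX.
- move=> n f; have h : 0 <= n%:R * Num.max 0 (f u - c) by rewrite mulr_ge0// le_max lexx.
  by rewrite ger0_norm ?ge_min ?lexx// le_min ler01.
- move=> w; rewrite setTI indicE.
  have [uc|cu] := leP (vpath B w u) c.
    rewrite memNset; last by rewrite /= in_itv/= andbT => h; lra.
    rewrite max_l; last by lra.
    by under eq_fun do rewrite mulr0 min_r//; exact: cvg_cst.
  rewrite mem_set; last by rewrite /= in_itv/= andbT.
  have e0 : 0 < vpath B w u - c by lra.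
  apply: cvg_near_cst; have := near_infty_natSinv_lt (PosNum e0) => -[k _ hk].
  exists k.+1 => // n /= kn; rewrite max_r; last exact: ltW.
  rewrite min_l//; have := hk k (leqnn k); rewrite /= => h.
  have n0 : (0 : R) < k.+1%:R by rewrite ltr0n.
  apply: (@le_trans _ _ (k.+1%:R * (vpath B w u - c))).
    by have := ltW h; rewrite -(ler_pM2l n0) divff// lt0r_neq0.
  by rewrite ler_pM2r// ler_nat.
Qed.

(** Pi-lambda argument: dominated convergence carries [expect_mart_tame] to approximable events, and
    the events whose indicator has mean zero against a fixed integrable increment form a
    lambda-system. *)
Lemma expect_mart_grid m a b (C : set T) : (0 < a)%N -> (a <= b)%N -> (b < 4 ^ m)%N ->
  <<s path_gen B (grid m a) >> C ->
  measurable C /\ expect P (fun w => \1_C w * (mart (grid m b) w - mart (grid m a) w)) = 0.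
Proof.
move=> a0 ab bm sC; set s := grid m a in sC *.
have /andP[b0 b1] := grid_itv (R := R) (ltnW bm).
have am : (a <= 4 ^ m)%N by lia.
have /andP[s0 s1] := grid_itv (R := R) am.
pose Y w := mart (grid m b) w - mart s w.
have sY : has_expect P Y by apply: has_expectB; apply: has_expect_mart; rewrite ?b0 ?s0.
have mY := has_expect_measurable sY.
have lim1 (f_ : nat -> T -> R) (f : T -> R) : (forall n, measurable_fun setT (f_ n)) ->
    (forall n w, `|f_ n w| <= 1) -> (forall w, f_ n w @[n --> \oo] --> f w) ->
    expect P (fun w => f_ n w * Y w) @[n --> \oo] --> expect P (fun w => f w * Y w).
  move=> mf bf cf.
  have mlim : measurable_fun setT f.
    by apply: (@measurable_fun_cvg _ _ _ _ f_) => // w _; exact: cf.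
  have [] := @expect_dominated _ _ _ P (fun n w => f_ n w * Y w) (fun w => f w * Y w)
    (fun w => `|Y w|%:E) _ _ _ _ _ => //.
  - by move=> n; exact: measurable_funM.
  - exact: measurable_funM.
  - exact: has_expect_norm sY.
  - by apply: nearW => w; apply: cvgMl.
  - by apply: nearW => w n; rewrite lee_fin normrM ler_piMl.
pose H := [set C : set T | measurable C /\ expect P (fun w => \1_C w * Y w) = 0].
have sum1 (A : set T) : measurable A -> has_expect P (fun w => \1_A w * Y w).
  move=> mA; apply: (has_expectM (c := 1)) => // w.
  by rewrite indicE; case: (_ \in _); rewrite ?normr1 ?normr0.
have apH : approximable s `<=` H.
  move=> A [Psi [tPsi bPsi cPsi]].
  have mPsi n : measurable_fun setT (fun w => Psi n (vpath B w)).
    by apply: (@measurable_of_path_gen s) => //; exact: measurable_tame (lexx _) (tPsi n).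
  have mA : measurable A.
    apply/(measurable_indicP R).
    exact: (@measurable_fun_cvg _ _ _ _ (fun n w => Psi n (vpath B w))).
  split => //.
  have := lim1 (fun n w => Psi n (vpath B w)) _ mPsi (fun n w => bPsi n _) cPsi.
  have -> : (fun n => expect P (fun w => Psi n (vpath B w) * Y w)) = cst 0.
    by apply/funext => n; exact: expect_mart_tame.
  by move=> h; apply: (cvg_unique _ h); [exact: Rhausdorff|exact: cvg_cst].
suff : H C by [].
have lamH : lambda_system setT H.
  split => //.
  - exact: apH (approximableT s).
  - move=> A A' A'A [mA EA] [mA' EA']; split; first exact: measurableD.
    have -> : (fun w => \1_(A `\` A') w * Y w) = (fun w => \1_A w * Y w - \1_A' w * Y w).
      apply/funext => w; rewrite -mulrBl; congr (_ * _); rewrite !indicE in_setD.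
      have [wA'|wA'] := boolP (w \in A'); last by rewrite andbT subr0.
      by rewrite (mem_set (A'A _ (set_mem wA'))) subrr.
    by rewrite expectB ?EA ?EA' ?subrr//; exact: sum1.
  - move=> F ndF HF; split; first by apply: bigcupT_measurable => i; case: (HF i).
    have := lim1 (fun n => \1_(F n)) \1_(\bigcup_i F i).
    have -> : (fun n => expect P (fun w => \1_(F n) w * Y w)) = cst 0.
      by apply/funext => n; case: (HF n).
    move=> h; apply: (cvg_unique _ (h _ _ _)); [exact: Rhausdorff| | | |exact: cvg_cst].
    + by move=> n; apply: measurable_indic; case: (HF n).
    + by move=> n w; rewrite indicE; case: (_ \in _); rewrite ?normr1 ?normr0.
    + move=> w; apply: cvg_near_cst.
      have [[i _ Fi]|nF] := pselect ((\bigcup_i F i) w).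
        exists i => // n /= i_n; have Fn : F n w by have := ndF _ _ i_n; rewrite subsetEset; exact.
        have Fu : (\bigcup_i F i) w by exists i.
        by rewrite !indicE !mem_set.
      by exists 0%N => // n _; rewrite !indicE !memNset// => Fn; apply: nF; exists n.
have sub := @lambda_system_subset _ _ (@approximableI s) setT H lamH apH (fun _ _ => @subsetT _ _).
apply: sub; apply: smallest_sub sC; first exact: smallest_sigma_algebra.
exact: path_gen_approximable.
Qed.

End martingale_part.

(** * The martingale property at all times and the decomposition *)

Section martingale_property.
Context {d : measure_display} {T : measurableType d} {R : realType}.
Variables (P : probability T R) (B : R -> {RV P >-> R}).
Hypothesis hB : standard_brownian_motion B.
Variable x : nat -> simple T R.
Hypothesis x_fast : forall k, energy B (lin 1 (x k.+1) (-1) (x k)) <= 16 ^- k.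
Hypothesis x_form : forall k y,
  `|2 * energy_form B (x k) y - linear_form B y| <= 4 ^- k * (1 + energy B y).

Let M := mart B x.

Lemma vpath_continuous_ext w :
  exists2 g : R -> R, continuous g & forall t, 0 <= t <= 1 -> vpath B w t = g t.
Proof.
have cB : {within `[0, 1], continuous (bm_path B w)} by exact: bm_continuous.
exists (cyc_shift (bm_path B w) (argmin_time (bm_path B w))); first exact: continuous_cyc_shift.
by move=> t t01; apply: vervaat_shift => //; [exact: bm_start|exact: argmin_time_itv].
Qed.

Lemma vpath0 w : vpath B w 0 = 0.
Proof.
have cB : {within `[0, 1], continuous (bm_path B w)} by exact: bm_continuous.
have /andP[a0 a1] := argmin_time_itv cB.
by rewrite /vpath /vervaat subr_ge0 a1 addr0 subrr.
Qed.

Lemma mart0 w : M 0 w = 0.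
Proof. by rewrite /M /mart /drift vpath0 half_drift0 mulr0 subr0. Qed.

Lemma mart_continuous_ext w : good B x w ->
  exists2 g : R -> R, continuous g & forall t, 0 <= t <= 1 -> M t w = g t.
Proof.
move=> gw; have [g cg Vg] := vpath_continuous_ext w.
exists (fun t => g t - drift B x t w); last by move=> t t01; rewrite /M /mart Vg.
move=> t; apply: cvgB; first exact: cg.
by apply: cvgMr; exact: continuous_half_drift.
Qed.

Lemma path_gen_sigma_le (s t : R) : s <= t -> <<s path_gen B s >> `<=` <<s path_gen B t >>.
Proof.
move=> st; suff sub : path_gen B s `<=` path_gen B t by exact: sub_sigma_algebra2 sub.
move=> A [u /= us uA]; exists u => //=.
by move: us; rewrite !in_itv/= => /andP[-> us]; exact: le_trans st.
Qed.

Lemma path_gen_sigma_measurable (t : R) : t <= 1 -> <<s path_gen B t >> `<=` measurable.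
Proof.
move=> t1; apply: smallest_sub; first exact: sigma_algebra_measurable.
exact: path_gen_measurable.
Qed.

Lemma measurable_path_gen_mart (s t : R) : 0 <= s -> s <= t ->
  measurable_fun setT (M s : g_sigma_algebraType (path_gen B t) -> R).
Proof.
move=> s0 st; apply: measurable_funB; first exact: measurable_path_gen.
apply: measurable_funM => //.
have mh := @measurable_half_drift _ _ _ P B x s.
by move=> _ A mA; apply: (path_gen_sigma_le st); exact: mh.
Qed.

(** Both times are approached by interior grid times, [s] from the right so that [C] is already
    known there, [t] from the left. Path continuity with the integrable bound of [mart_dominated]
    passes to the limit; this also covers [s = 0] and [t = 1]. *)
Lemma expect_mart_eq s t (C : set T) : 0 <= s -> s <= t -> t <= 1 ->
  <<s path_gen B s >> C ->
  expect P (fun w => \1_C w * M s w) = expect P (fun w => \1_C w * M t w).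
Proof.
move=> s0; rewrite le_eqVlt => /predU1P[-> //|st] t1 sC.
have mC : measurable C by apply: path_gen_sigma_measurable sC; lra.
have s1 : s <= 1 by lra.
have t0 : 0 <= t by lra.
have geo : (4 ^+ n)^-1 @[n --> \oo] --> (0 : R).
  have := @cvg_geometric R 1 4^-1; rewrite ger0_norm//.
  have h : 4^-1 < 1 :> R by lra.
  move=> /(_ h); rewrite /geometric /=.
  by under eq_fun do rewrite mul1r exprVn.
(* Three mesh lengths leave room for the two roundings and the extra step at [t], so that
   [a n <= b n]. *)
have ts : 0 < (t - s) / 3 by lra.
have [N _ hN] : \forall n \near \oo, (4 ^+ n)^-1 <= (t - s) / 3 :> R.
  move/cvgrPdist_le : geo => /(_ _ ts); apply: filterS => n.
  by rewrite sub0r normrN ger0_norm// invr_ge0 exprn_ge0.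
have p0 n : 0 < 4 ^+ (n + N) :> R by rewrite exprn_gt0.
(* The successor puts the grid time at or after [s] and away from 0; the predecessor below keeps the
   other one under 1 even when [t = 1]. *)
pose a n := (Num.truncn (s * 4 ^+ (n + N))).+1.
pose b n := (Num.truncn (t * 4 ^+ (n + N))).-1.
have gE n i : grid (n + N) i = i%:R / 4 ^+ (n + N) :> R by rewrite /grid natrX.
have facts n : [/\ (a n <= b n)%N, (b n < 4 ^ (n + N))%N,
    s <= grid (n + N) (a n) <= s + 4 ^- (n + N) &
    t - 2 * 4 ^- (n + N) <= grid (n + N) (b n) <= t].
  have q0 := p0 n; set q := 4 ^+ (n + N) in q0 *.
  have gap : 3 <= (t - s) * q.
    have : q^-1 <= (t - s) / 3 by apply: hN; rewrite /= leq_addl.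
    by rewrite -(ler_pM2r q0) mulVf ?lt0r_neq0// mulrAC; lra.
  have /andP[h1 h2] : (Num.truncn (s * q))%:R <= s * q < (Num.truncn (s * q)).+1%:R.
    by apply: truncn_itv; rewrite mulr_ge0// ltW.
  have /andP[h3 h4] : (Num.truncn (t * q))%:R <= t * q < (Num.truncn (t * q)).+1%:R.
    by apply: truncn_itv; rewrite mulr_ge0// ltW.
  have tq : t * q <= q by rewrite ler_piMl// ltW.
  have sq : 0 <= s * q by rewrite mulr_ge0// ltW.
  have qE : q = (4 ^ (n + N))%:R by rewrite natrX.
  rewrite -!natr1 in h2 h4.
  have pos : (0 < Num.truncn (t * q))%N.
    by rewrite lt0n; apply/eqP => z; rewrite z in h4; lra.
  have bE : (b n)%:R = (Num.truncn (t * q))%:R - 1 :> R.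
    by rewrite -(prednK pos) -natr1 addrK.
  have aE : (a n)%:R = (Num.truncn (s * q))%:R + 1 :> R by rewrite natr1.
  split.
  - by rewrite -(ler_nat R) aE bE; lra.
  - by rewrite -(ltr_nat R) bE -qE; lra.
  - by rewrite gE -/q ler_pdivlMr// ler_pdivrMr// mulrDl mulVf ?lt0r_neq0// aE; lra.
  - by rewrite gE -/q ler_pdivlMr// ler_pdivrMr// mulrBl -mulrA mulVf ?lt0r_neq0// bE; lra.
have geoN : (4 ^+ (n + N))^-1 @[n --> \oo] --> (0 : R).
  by have := @cvg_shiftn N R (fun n => (4 ^+ n)^-1 : R) (nbhs (0 : R)); rewrite propeqE => -[_]; exact.
have cs : grid (n + N) (a n) @[n --> \oo] --> s.
  apply: (@squeeze_cvgr _ _ _ _ (fun=> s) (fun n => s + 4 ^- (n + N))).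
  - by apply: nearW => n; have [_ _ -> _] := facts n.
  - exact: cvg_cst.
  - rewrite -[in X in _ --> X](addr0 s); apply: cvgD; first exact: cvg_cst.
    exact: geoN.
have ct : grid (n + N) (b n) @[n --> \oo] --> t.
  apply: (@squeeze_cvgr _ _ _ _ (fun n => t - 2 * 4 ^- (n + N)) (fun=> t)).
  - by apply: nearW => n; have [_ _ _ ->] := facts n.
  - rewrite -[in X in _ --> X](subr0 t); apply: cvgB; first exact: cvg_cst.
    rewrite -(mulr0 2); apply: cvgMr.
    exact: geoN.
  - exact: cvg_cst.
pose u n := @grid R (n + N) (a n); pose v n := @grid R (n + N) (b n).
have rng n : 0 <= u n <= 1 /\ 0 <= v n <= 1.
  have [ab bq _ _] := facts n.
  have bq' := ltnW bq; have aq := leq_trans ab bq'.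
  by split; [exact: (grid_itv (R := R) aq)|exact: (grid_itv (R := R) bq')].
have [g ig hg] := mart_dominated hB x_fast.
have i1 (w : T) : `|\1_C w| <= 1 :> R.
  by rewrite indicE; case: (_ \in _); rewrite ?normr1 ?normr0.
have limM (r_ : nat -> R) (r : R) : (forall n, 0 <= r_ n <= 1) -> 0 <= r <= 1 ->
    r_ n @[n --> \oo] --> r ->
    expect P (fun w => \1_C w * M (r_ n) w) @[n --> \oo] --> expect P (fun w => \1_C w * M r w).
  move=> r_01 r01 cr.
  have mM (q : R) : 0 <= q <= 1 -> measurable_fun setT (fun w => \1_C w * M q w).
    move=> q01; apply: measurable_funM; first exact: measurable_indic.
    by apply: has_expect_measurable; exact: has_expect_mart.
  have [] := @expect_dominated _ _ _ P (fun n w => \1_C w * M (r_ n) w)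
    (fun w => \1_C w * M r w) g _ _ _ _ _ => //.
  - by move=> n; exact: mM.
  - exact: mM.
  - have := ae_good hB x_fast; apply: filterS => w gw; apply: cvgMr.
    have [h ch Mh] := mart_continuous_ext gw.
    rewrite Mh//; under eq_fun do rewrite Mh//.
    by apply: continuous_cvg => //; exact: ch.
  - apply: filterS hg => w hw n; apply: le_trans (hw _ (r_01 n)).
    by rewrite lee_fin normrM ler_piMl.
have ls := limM u s (fun n => (rng n).1) _ cs.
have lt := limM v t (fun n => (rng n).2) _ ct.
apply: (cvg_unique _ (ls _)) => //; first by rewrite s0.
suff E : (fun n => expect P (fun w => \1_C w * M (u n) w)) =
         (fun n => expect P (fun w => \1_C w * M (v n) w)).
  by rewrite E; apply: lt; rewrite t0.
apply/funext => n; have [ab bq /andP[sa _] _] := facts n; have [ra rb] := rng n.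
have [_] := expect_mart_grid hB x_fast x_form (ltn0Sn _) ab bq (path_gen_sigma_le sa sC).
have sM (r : R) : 0 <= r <= 1 -> has_expect P (fun w => \1_C w * M r w).
  move=> r01; apply: (has_expectM (c := 1)) => //; exact: has_expect_mart.
under [X in expect P X]eq_fun do rewrite mulrBr.
by rewrite expectB; [|exact: sM|exact: sM] => /eqP; rewrite subr_eq0 => /eqP ->.
Qed.

Lemma condexp_mart (s t : R) : 0 <= s -> s <= t -> t <= 1 ->
  is_condexp P <<s path_gen B s >> (M t) (M s).
Proof.
move=> s0 st t1; split.
- by move=> A mA; rewrite -[X in _ X]setTI; exact: (measurable_path_gen_mart s0 (lexx s)).
- by apply: has_expect_mart => //; rewrite s0 (le_trans st).
- move=> C sC.
  have mC : measurable C by apply: path_gen_sigma_measurable sC; lra.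
  have E (r : R) : 0 <= r <= 1 -> (\int[P]_(w in C) (M r w)%:E)%E = (expect P (fun w => \1_C w * M r w))%:E.
    move=> r01; rewrite expect_EFin; last first.
      apply: (has_expectM (c := 1)) => //; last exact: has_expect_mart.
      by move=> w; rewrite indicE; case: (_ \in _); rewrite ?normr1 ?normr0.
    rewrite integral_mkcond; apply: eq_integral => w _.
    by rewrite epatch_indic /= muleC EFinM.
  by rewrite !E ?(expect_mart_eq s0 st t1 sC)//; lra.
Qed.

Lemma cadlag_continuous_ext (f g : R -> R) : continuous g ->
  (forall t, 0 <= t <= 1 -> f t = g t) -> cadlag f.
Proof.
move=> cg fg; split=> [t /andP[t0 t1]|t /andP[t0 t1]].
- rewrite fg ?t0 ?ltW//.
  apply: cvg_trans (cvg_at_right_filter (cg t)); apply: near_eq_cvg.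
  near=> u; apply/esym/fg/andP; split; last by near: u; exact: nbhs_right_le.
  by rewrite (le_trans t0)//; near: u; exact: nbhs_right_ge.
- apply: (cvgP (g t)).
  apply: cvg_trans (cvg_at_left_filter (cg t)); apply: near_eq_cvg.
  near=> u; apply/esym/fg/andP; split; first by near: u; exact: nbhs_left_ge.
  by apply: le_trans t1; near: u; exact: nbhs_left_le.
Unshelve. all: by end_near. Qed.

Lemma martingale_mart : martingale P (fun t => <<s path_gen B t >>) M.
Proof.
split.
- move=> t; rewrite in_itv/= => /andP[t0 _] A mA; rewrite -[X in _ X]setTI.
  exact: (measurable_path_gen_mart t0 (lexx t)).
- by move=> t; rewrite in_itv/=; exact: has_expect_mart.
- exact: condexp_mart.
Qed.

Lemma stopped1_mart (t : R) : t <= 1 -> (fun w => stopped (fun=> 1) M t w - M 0 w) = M t.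
Proof. by move=> t1; apply/funext => w; rewrite /stopped mart0 subr0 min_l. Qed.

Lemma local_martingale_mart : local_martingale P (fun t => <<s path_gen B t >>) M.
Proof.
have [aM iM cM] := martingale_mart.
split=> //.
  have := ae_good hB x_fast; apply: filterS => w gw.
  by have [g cg Mg] := mart_continuous_ext gw; exact: cadlag_continuous_ext cg Mg.
(* The process is a true martingale on [0, 1], so the constant terminal time localizes it. *)
exists (fun (_ : nat) (_ : T) => 1 : R); split.
- move=> _; split => [w|t _]; first by rewrite in_itv/= ler01 lexx.
  have [F0 FC _] := smallest_sigma_algebra setT (path_gen B t).
  have [t1|t1] := boolP (1 <= t).
    have -> : [set w : T | is_true true] = setT by apply/seteqP; split.
    by have := FC _ F0; rewrite setD0.
  have -> : [set w : T | is_true false] = set0 by apply/seteqP; split.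
  exact: F0.
- by [].
- by apply: nearW => w; exists 0%N.
- move=> _; split.
  + move=> t t01; rewrite stopped1_mart; first exact: aM.
    by move: t01; rewrite in_itv/= => /andP[].
  + move=> t t01; rewrite stopped1_mart; first exact: iM.
    by move: t01; rewrite in_itv/= => /andP[].
  + by move=> s t s0 st t1; rewrite (stopped1_mart t1) (stopped1_mart (le_trans st t1)); exact: cM.
Qed.

Lemma finite_variation_drift :
  finite_variation_process P (fun t => <<s path_gen B t >>) (drift B x).
Proof.
split.
- move=> t _ A mA; rewrite -[X in _ X]setTI.
  have : measurable_fun setT (drift B x t : g_sigma_algebraType (path_gen B t) -> R).
    by apply: measurable_funM => //; exact: measurable_half_drift.
  exact.
- have := ae_good hB x_fast; apply: filterS => w gw.
  apply: (@cadlag_continuous_ext _ (drift B x ^~ w)) => // t.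
  by apply: cvgMr; exact: continuous_half_drift.
- have := ae_good hB x_fast; apply: filterS => w gw.
  have -> : drift B x ^~ w = (half_drift B x ^~ w) \+ (half_drift B x ^~ w).
    by apply/funext => t; rewrite /drift /=; ring.
  by apply: bounded_variationD => //; exact: half_drift_bounded_variation.
Qed.

Lemma semimartingale_vpath :
  semimartingale P (fun t => <<s path_gen B t >>) (fun t w => vpath B w t).
Proof.
split.
  split.
  - by move=> t _; exact: smallest_sigma_algebra.
  - by move=> t; rewrite in_itv/= => /andP[_ t1]; exact: path_gen_sigma_measurable.
  - by move=> s t _ st _; exact: path_gen_sigma_le.
exists M, (drift B x); split.
- exact: local_martingale_mart.
- exact: finite_variation_drift.
- exact: mart0.
- by move=> w; rewrite /drift half_drift0 mulr0.
- by move=> t _ w; rewrite vpath0 add0r /M /mart subrK.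
Qed.

End martingale_property.

Theorem theorem4p4 (d : measure_display) (T : measurableType d) (R : realType)
    (P : probability T R) (B : R -> {RV P >-> R})
    (hB : standard_brownian_motion B) :
  let V := fun (t : R) (w : T) => vervaat (fun s : R => B s w) t in
  semimartingale P (natural_filtration V) V.
Proof.
move=> V.
have [x [x_fast x_form]] := minimizing_sequence (simple0 T R) (linear_form_lin hB)
  (energy_lin hB) (energy_ge0 B) (linear_form_le hB).
exact (semimartingale_vpath hB x_fast x_form).
Qed.
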